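(* Let $\mathrm{G}$ be an $m$-dimensional matrix Lie group with Lie algebra $\mathfrak{g}$, let $\mathcal{S}:\mathbb{R}^m\to\mathfrak{g}$ be a linear map, and consider the problem of minimizing $f(\mathcal{G})$ over tuples $\mathcal{G}=\{\mathbf{G}_1,\dots,\mathbf{G}_n\}$, $\mathbf{G}_i\in\mathrm{G}$, subject to $g_i(\mathcal{G})\le 0$ ($i=1,\dots,n_1$) and $h_j(\mathcal{G})=0$ ($j=1,\dots,n_2$), where $f,g_i,h_j$ are real-valued and twice continuously differentiable, and the feasible set is nonempty and contains at least one strictly feasible point. Let $\mathsf{F}$ be the primal-dual KKT vector field, $\boldsymbol{\mathfrak{J}}^{\mathcal{X}}_{\mathsf{F}}$ its Sensitivity Matrix, and $\mathcal{L}$ the Lagrangian, all as defined in the context. Assume there is a point $\mathcal{X}^*=\{\mathcal{G}^*,\mathbf{Z}^*\}$, where $\mathbf{Z}^*$ encodes $(\nu^*,\lambda^*,s^* )$, such that, with $\mathbb{A}(\mathcal{G}^* )=\{i\mid g_i(\mathcal{G}^* )=0\}$: (1) $\mathcal{X}^*$ satisfies the KKT conditions, i.e. $\mathsf{F}(\mathcal{X}^* )=0$; (2) the set $\{\nabla_{h_j}^{\mathcal{G}^*}\}_{j=1}^{n_2}\cup\{\nabla_{g_i}^{\mathcal{G}^*}\}_{i\in\mathbb{A}(\mathcal{G}^* )}$ is linearly independent; (3) $\nu_i^*>0$ whenever $g_i(\mathcal{G}^* )=0$, $i=1,\dots,n_1$; (4) $\boldsymbol{\zeta}^\top\boldsymbol{\mathfrak{H}}^{\mathcal{G}^*}_{\mathcal{L}}\boldsymbol{\zeta}>0$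 for every nonzero $\boldsymbol{\zeta}\in\mathbb{R}^{nm}$ such that $\nabla_{h_j}^{\mathcal{G}^*}\boldsymbol{\zeta}=0$ for $j=1,\dots,n_2$ and $\nabla_{g_i}^{\mathcal{G}^*}\boldsymbol{\zeta}=0$ for $i\in\mathbb{A}(\mathcal{G}^* )$ (the curvature matrix of $\mathcal{L}$ being evaluated with multipliers $\nu^*,\lambda^*$). Then there exists a neighborhood $\mathcal{U}$ of $\mathcal{X}^*$ such that, for any initial point $\mathcal{X}^0\in\mathcal{U}$ sufficiently close to $\mathcal{X}^*$, the iteration $$\boldsymbol{\mathfrak{J}}^{\mathcal{X}^k}_{\mathsf{F}}\,\boldsymbol{\Delta x}^k=-\mathsf{F}(\mathcal{X}^k)+\rho_k,$$ with residual vectors $\rho_k$, combined with the exponential update $$\mathcal{X}^{k+1}=\mathcal{X}^k\boldsymbol{\exp}\big(\mathcal{S}(\alpha\,\boldsymbol{\Delta x}^k)\big),$$ with step size $\alpha\in(0,1]$, is well defined and generates a sequence $\{\mathcal{X}^k\}$ converging to $\mathcal{X}^*$. The local convergence rate is governed by the step size $\alpha$ and the residual $\rho_k$ as follows. For $\alpha=1$: (i) the convergence is quadratic if $\rho_k=0$ or $\|\rho_k\|=O(\|\mathsf{F}(\mathcal{X}^k)\|^2)$; (ii) the convergence is linear if $\|\rho_k\|=O(\|\mathsf{F}(\mathcal{X}^k)\|)$. For $0<\alpha<1$: (i) the convergence is linear if $\rho_k=0$ or $\|\rho_k\|=O(\|\mathsf{F}(\mathcal{X}^k)\|)$.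
   Context: **Derivatives on the group.** For a differentiable $\varphi:\mathrm{G}\to\mathbb{R}$ and $\mathbf{G}\in\mathrm{G}$, $\mathcal{D}\varphi_{[\mathbf{G}]}\in\mathbb{R}^{1\times m}$ is the row vector defined by $$\mathcal{D}\varphi_{[\mathbf{G}]}\boldsymbol{\zeta}=\lim_{\varepsilon\to0}\frac{\varphi\big(\mathbf{G}\exp(\mathcal{S}(\boldsymbol{\zeta})\varepsilon)\big)-\varphi(\mathbf{G})}{\varepsilon},\qquad \boldsymbol{\zeta}\in\mathbb{R}^m.$$ For a function $\varphi$ of a tuple $\mathcal{G}=\{\mathbf{G}_1,\dots,\mathbf{G}_n\}$, $\mathcal{D}\varphi_{[\mathbf{G}_i]}$ denotes this derivative with respect to the $i$-th entry, the others being fixed. The gradient is $$\nabla_\varphi^{\mathcal{G}}=[\mathcal{D}\varphi_{[\mathbf{G}_1]}\ \cdots\ \mathcal{D}\varphi_{[\mathbf{G}_n]}]\in\mathbb{R}^{1\times nm}.$$ For a vector-valued $\varphi=[\varphi^1,\dots,\varphi^l]^\top$, the Sensitivity Matrix $\boldsymbol{\mathfrak{J}}_\varphi^{\mathcal{G}}\in\mathbb{R}^{l\times nm}$ is the matrix whose $j$-th row is $\nabla_{\varphi^j}^{\mathcal{G}}$. For a twice differentiable scalar $\varphi$, the Curvature Matrix is $\boldsymbol{\mathfrak{H}}_\varphi^{\mathcal{G}}=\boldsymbol{\mathfrak{J}}^{\mathcal{G}}_{(\nabla_\varphi^{\mathcal{G}})^\top}\in\mathbb{R}^{nm\times nm}$.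 **Lagrangian and slack variables.** Write $g=(g_1,\dots,g_{n_1})^\top$ and $h=(h_1,\dots,h_{n_2})^\top$. The Lagrangian is $$\mathcal{L}(\mathcal{G},\nu,\lambda)=f(\mathcal{G})+\nu^\top g(\mathcal{G})+\lambda^\top h(\mathcal{G}),\qquad \nu\in\mathbb{R}^{n_1},\ \lambda\in\mathbb{R}^{n_2}.$$ Thus $(\nabla_{\mathcal{L}}^{\mathcal{G}})^\top=(\nabla_f^{\mathcal{G}})^\top+(\boldsymbol{\mathfrak{J}}_g^{\mathcal{G}})^\top\nu+(\boldsymbol{\mathfrak{J}}_h^{\mathcal{G}})^\top\lambda$ and $\boldsymbol{\mathfrak{H}}_{\mathcal{L}}^{\mathcal{G}}=\boldsymbol{\mathfrak{H}}_f^{\mathcal{G}}+\sum_i\nu_i\boldsymbol{\mathfrak{H}}_{g_i}^{\mathcal{G}}+\sum_j\lambda_j\boldsymbol{\mathfrak{H}}_{h_j}^{\mathcal{G}}$. Slack variables $s\in\mathbb{R}^{n_1}$ with $s_i>0$ turn the inequalities into $g(\mathcal{G})+s=0$. A strictly feasible point is one with $g_i(\mathcal{G})<0$ and $h_j(\mathcal{G})=0$ for all $i,j$. **Primal-dual variable.** Let $d=n_2+2n_1$, $\mathbf{z}=[\nu^\top\ \lambda^\top\ s^\top]^\top\in\mathbb{R}^d$, and $$\mathbf{Z}=\begin{bmatrix}\mathbf{I}_d&\mathbf{z}\\ \mathbf{0}_{1\times d}&1\end{bmatrix}\in\mathsf{T}(d),$$ where $\mathsf{T}(d)$ is the group of such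 translation matrices. On this component $\mathcal{S}$ maps $\zeta\in\mathbb{R}^d$ to $\begin{bmatrix}\mathbf{0}&\zeta\\ \mathbf{0}&0\end{bmatrix}$, so that multiplying $\mathbf{Z}$ on the right by $\exp(\mathcal{S}(\zeta))$ replaces $\mathbf{z}$ by $\mathbf{z}+\zeta$. Set $\mathcal{X}=\{\mathcal{G},\mathbf{Z}\}=\{\mathbf{G}_1,\dots,\mathbf{G}_n,\mathbf{Z}\}$. **KKT vector field.** With $\mathbf{S}=\operatorname{diag}(s)$, $e$ the all-ones vector, and $\mu>0$ the barrier parameter (a fixed parameter of $\mathsf{F}$), $$\mathsf{F}(\mathcal{X})=\begin{bmatrix}(\nabla_{\mathcal{L}}^{\mathcal{G}})^\top\\ g(\mathcal{G})+s\\ h(\mathcal{G})\\ \mathbf{S}\nu-\mu e\end{bmatrix}\in\mathbb{R}^{nm+d}.$$ Its Sensitivity Matrix (columns ordered as $\mathcal{G},\nu,\lambda,s$) is $$\boldsymbol{\mathfrak{J}}^{\mathcal{X}}_{\mathsf{F}}=\begin{bmatrix}\boldsymbol{\mathfrak{H}}^{\mathcal{G}}_{\mathcal{L}}&(\boldsymbol{\mathfrak{J}}_g^{\mathcal{G}})^\top&(\boldsymbol{\mathfrak{J}}_h^{\mathcal{G}})^\top&0\\ \boldsymbol{\mathfrak{J}}_g^{\mathcal{G}}&0&0&I\\ \boldsymbol{\mathfrak{J}}_h^{\mathcal{G}}&0&0&0\\ 0&\mathbf{S}&0&\operatorname{diag}(\nu)\end{bmatrix}.$$ **Update.** For $\boldsymbol{\Delta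 x}=[\Delta x_1^\top,\dots,\Delta x_n^\top,\Delta x_{n+1}^\top]^\top\in\mathbb{R}^{nm+d}$ with $\Delta x_i\in\mathbb{R}^m$ ($i\le n$) and $\Delta x_{n+1}\in\mathbb{R}^d$, $$\mathcal{X}\boldsymbol{\exp}(\mathcal{S}(\alpha\boldsymbol{\Delta x}))=\{\mathbf{G}_1\exp(\mathcal{S}(\alpha\Delta x_1)),\dots,\mathbf{G}_n\exp(\mathcal{S}(\alpha\Delta x_n)),\mathbf{Z}\exp(\mathcal{S}(\alpha\Delta x_{n+1}))\}.$$ The residuals satisfy $\rho_k\in\mathbb{R}^{nm+d}$. **Rates.** The rate is measured through the KKT residual: convergence is quadratic if $\|\mathsf{F}(\mathcal{X}^{k+1})\|\le C\|\mathsf{F}(\mathcal{X}^k)\|^2$ for some constant $C$ and all large $k$, and linear if $\|\mathsf{F}(\mathcal{X}^{k+1})\|\le c\|\mathsf{F}(\mathcal{X}^k)\|$ for some $c\in(0,1)$ and all large $k$. The notation $\|\rho_k\|=O(\|\mathsf{F}(\mathcal{X}^k)\|^p)$ means $\|\rho_k\|\le C\|\mathsf{F}(\mathcal{X}^k)\|^p$ for a constant $C$ independent of $k$.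
   Formalization: The claim as printed is false at two points and is corrected: when ‖ρ_k‖ ≤ C‖F(X^k)‖, C < 1 is required (ρ_k = F(X^k) stalls the iteration); and the quadratic rate also assumes that the curvature matrix of the Lagrangian (at ν*, λ* ) is Lipschitz at G* (C² alone is not enough). *)

(* Defs.v *)
From HB Require Import structures.
From mathcomp Require Import all_boot all_order all_algebra.
From mathcomp Require Import all_classical all_reals all_analysis.

Set Implicit Arguments.
Unset Strict Implicit.
Unset Printing Implicit Defensive.

Import Order.TTheory GRing.Theory Num.Theory.
Import numFieldNormedType.Exports.

Local Open Scope classical_set_scope.
Local Open Scope ring_scope.

(* Euclidean norm; the canonical norm [`|x|] on matrices is the sup norm. *)
Definition enorm (R : realType) (k : nat) (x : 'cV[R]_k) : R :=
  Num.sqrt (\sum_i x i 0 ^+ 2).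

Definition expmx (R : realType) (N : nat) (A : 'M[R]_N) : 'M[R]_N :=
  lim (series (fun k => (k`!%:R)^-1 *: A ^+ k) @ \oo).

(* A subgroup of GL_N(R) that is closed in GL_N(R), not necessarily in the
   space of all matrices. *)
Definition matrix_lie_group (R : realType) (N : nat) (G : set 'M[R]_N) : Prop :=
  [/\ G `<=` [set A | A \in unitmx], G 1%:M,
      (forall A B, G A -> G B -> G (A *m B)),
      (forall A, G A -> G (invmx A)) &
      (forall A, closure G A -> A \in unitmx -> G A)].

Definition lie_algebra (R : realType) (N : nat) (G : set 'M[R]_N) :
    set 'M[R]_N :=
  [set A | forall t : R, G (expmx (t *: A))].

Definition lie_dim (R : realType) (N : nat) (G : set 'M[R]_N) (m : nat) : Prop :=
  exists V : {vspace 'M[R]_N},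
    (forall A, A \in V <-> lie_algebra G A) /\ \dim V = m.

(* An n-tuple of N x N matrices is stored as an n x N^2 matrix whose i-th row is
   [mxvec] of the i-th entry, so that tuples live in a library normed space. *)
Notation mxtuple R n N := ('M[R]_(n, N * N)).

Definition entry (R : realType) (n N : nat) (Y : mxtuple R n N) (i : 'I_n) :
    'M[R]_N :=
  vec_mx (row i Y).

Definition mktuple (R : realType) (n N : nat) (A : 'I_n -> 'M[R]_N) :
    mxtuple R n N :=
  \matrix_i mxvec (A i).

Definition set_entry (R : realType) (n N : nat) (Y : mxtuple R n N) (i : 'I_n)
    (A : 'M[R]_N) : mxtuple R n N :=
  mktuple (fun k => if k == i then A else entry Y k).

Definition in_group (R : realType) (n N : nat) (G : set 'M[R]_N) :
    set (mxtuple R n N) :=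
  [set Y | forall i, G (entry Y i)].

(* C^k on an open set U of a finite-dimensional space: all iterated directional
   derivatives up to order k exist and are continuous on U. *)
Fixpoint class_C (R : realType) (V : normedModType R) (k : nat) (U : set V)
    (phi : V -> R) : Prop :=
  (forall Y, U Y -> {for Y, continuous phi}) /\
  (if k is k'.+1 then
     forall v, (forall Y, U Y -> derivable phi Y v) /\
               class_C k' U (fun Y => 'D_v phi Y)
   else True).

(* A function on G^n is a total function on tuples of matrices of which only the
   values on G^n matter; it is of class C^2 when near each point of G^n it is the
   restriction of a C^2 function on an open subset of the ambient space. *)
Definition C2_on_group (R : realType) (n N : nat) (G : set 'M[R]_N)
    (phi : mxtuple R n N -> R) : Prop :=
  forall Y, in_group G Y ->
    exists (U : set (mxtuple R n N)) (psi : mxtuple R n N -> R),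
      [/\ open U, U Y, class_C 2 U psi &
          forall Y', U Y' -> in_group G Y' -> psi Y' = phi Y'].

(* The row vector whose product with zeta is the derivative of phi at A in the
   direction zeta, given by its values on the standard basis. *)
Definition lieD (R : realType) (N m : nat) (S : 'cV[R]_m -> 'M[R]_N)
    (phi : 'M[R]_N -> R) (A : 'M[R]_N) : 'rV[R]_m :=
  \row_a derive1 (fun eps : R =>
                    phi (A *m expmx (eps *: S (delta_mx a 0)))) 0.

(* R^{nm} is indexed by [mxvec_index i a], i.e. blocks of size m, one for each
   entry i of the tuple. *)
Definition grad (R : realType) (n N m : nat) (S : 'cV[R]_m -> 'M[R]_N)
    (phi : mxtuple R n N -> R) (Y : mxtuple R n N) : 'rV[R]_(n * m) :=
  mxvec (\matrix_i lieD S (fun A => phi (set_entry Y i A)) (entry Y i)).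

Definition sensitivity (R : realType) (n N m l : nat) (S : 'cV[R]_m -> 'M[R]_N)
    (phi : mxtuple R n N -> 'cV[R]_l) (Y : mxtuple R n N) : 'M[R]_(l, n * m) :=
  \matrix_j grad S (fun Y' => phi Y' j 0) Y.

Definition curvature (R : realType) (n N m : nat) (S : 'cV[R]_m -> 'M[R]_N)
    (phi : mxtuple R n N -> R) (Y : mxtuple R n N) : 'M[R]_(n * m) :=
  sensitivity S (fun Y' => (grad S phi Y')^T) Y.

Definition trans_mx (R : realType) (d : nat) (z : 'cV[R]_d) : 'M[R]_(d + 1) :=
  block_mx 1%:M z 0 1%:M.

Definition trans_alg (R : realType) (d : nat) (zeta : 'cV[R]_d) :
    'M[R]_(d + 1) :=
  block_mx 0 zeta 0 0.

(* z = [nu; lam; s], so d = n1 + (n2 + n1). *)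
Notation pd_dim n1 n2 := (n1 + (n2 + n1))%N.

(* Pairs (Y, Z), Y the tuple of group elements and Z of size d + 1; Z is meant to range over the translation matrices. *)
Notation pd_type R n N n1 n2 :=
  ('M[R]_(n, N * N) * 'M[R]_(pd_dim n1 n2 + 1))%type.

Section PrimalDual.
Context (R : realType) (n N n1 n2 : nat).
Local Notation point := (pd_type R n N n1 n2).
Implicit Types X : point.

Definition pd_nu X : 'cV[R]_n1 := usubmx (ursubmx X.2).
Definition pd_lam X : 'cV[R]_n2 := usubmx (dsubmx (ursubmx X.2)).
Definition pd_slack X : 'cV[R]_n1 := dsubmx (dsubmx (ursubmx X.2)).

Definition pd_point (G : set 'M[R]_N) : set point :=
  [set X | [/\ in_group G X.1, range (@trans_mx R (pd_dim n1 n2)) X.2 &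
               forall i, 0 < pd_slack X i 0]].

Context (m : nat) (S : 'cV[R]_m -> 'M[R]_N).

Definition pd_sensitivity (l : nat) (phi : point -> 'cV[R]_l) X :
    'M[R]_(l, n * m + pd_dim n1 n2) :=
  row_mx (sensitivity S (fun Y => phi (Y, X.2)) X.1)
         (\matrix_j lieD (@trans_alg R (pd_dim n1 n2))
                         (fun Z => phi (X.1, Z) j 0) X.2).

Definition pd_update X (dx : 'cV[R]_(n * m + pd_dim n1 n2)) : point :=
  (mktuple (fun i => entry X.1 i *m
                     expmx (S (\col_a usubmx dx (mxvec_index i a) 0))),
   X.2 *m expmx (trans_alg (dsubmx dx))).

Context (f : mxtuple R n N -> R).
Context (g : mxtuple R n N -> 'cV[R]_n1) (h : mxtuple R n N -> 'cV[R]_n2).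

Definition feasible (G : set 'M[R]_N) : set (mxtuple R n N) :=
  [set Y | [/\ in_group G Y, forall i, g Y i 0 <= 0 & h Y = 0]].

Definition strictly_feasible (G : set 'M[R]_N) : set (mxtuple R n N) :=
  [set Y | [/\ in_group G Y, forall i, g Y i 0 < 0 & h Y = 0]].

Definition active (Y : mxtuple R n N) : {set 'I_n1} := [set i | g Y i 0 == 0].

Definition lagrangian (nu : 'cV[R]_n1) (lam : 'cV[R]_n2) (Y : mxtuple R n N) :
    R :=
  f Y + (nu^T *m g Y) 0 0 + (lam^T *m h Y) 0 0.

Definition kkt (mu : R) X : 'cV[R]_(n * m + pd_dim n1 n2) :=
  col_mx (grad S (lagrangian (pd_nu X) (pd_lam X)) X.1)^T
    (col_mx (g X.1 + pd_slack X)
      (col_mx (h X.1)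
        (diag_mx (pd_slack X)^T *m pd_nu X - const_mx mu))).

Definition newton_step (mu alpha : R) (X : nat -> point)
    (dx rho : nat -> 'cV[R]_(n * m + pd_dim n1 n2)) (k : nat) : Prop :=
  pd_sensitivity (kkt mu) (X k) *m dx k = - kkt mu (X k) + rho k /\
  X k.+1 = pd_update (X k) (alpha *: dx k).

End PrimalDual.

Definition quadratic_rate (R : realType) (r : nat -> R) : Prop :=
  exists C : R, \forall k \near \oo, r k.+1 <= C * r k ^+ 2.

Definition linear_rate (R : realType) (r : nat -> R) : Prop :=
  exists c : R, 0 < c < 1 /\ \forall k \near \oo, r k.+1 <= c * r k.

(* Main.v *)
Require Import Defs.
From HB Require Import structures.
From mathcomp Require Import all_boot all_order all_algebra.
From mathcomp Require Import all_classical all_reals all_analysis.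
From mathcomp Require Import ring lra.

(** Since mu is positive and F vanishes at Xs, every product s_i nu_i equals mu.
    With positive slacks all multipliers nu_i are positive, and g = - s is
    negative: no inequality is active at Xs.  If the sensitivity matrix J of F
    at Xs kills a direction with group part zeta, eliminating the slack and nu
    components leaves
      zeta^T K zeta + sum_i (nu_i / s_i) (grad g_i zeta)^2 = 0,
    with K the curvature of the Lagrangian and zeta in the kernel of the
    gradients of h.  The second-order condition
    forces zeta = 0, and independence of these gradients forces lam = 0; hence J
    is invertible at Xs ([kkt_sensitivity_inj]) and, by continuity, near Xs.

    A Newton step is a right translation of each group element, so that
    t |-> X exp(S (t w)) is a curve in the group whose derivative is a linear
    function of its current point.  The mean value theorem along it gives
      F (X exp(S w)) = F X + J X w + remainder,
    where the remainder is o(|w|) because J is continuous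
    ([newton_remainder_small]), and O(|w| (|X - Xs| + |w|)) when the curvature
    of the Lagrangian is Lipschitz at Xs ([newton_remainder_quadratic]).
    Inserting the Newton equation, a step multiplies the residual |F X| by at
    most 1 - alpha, plus the contribution alpha |rho| and the remainder; since
    |w| = O(|F X|), the residual contracts by a fixed factor below 1.  When
    alpha = 1 and |rho| = O(|F X|^2), the O(|w| (|X - Xs| + |w|)) remainder
    makes the new residual O(|F X|^2).

    These estimates control |F X|, not the distance |X - Xs|.  The link is the
    bound k |X - Xs| <= |F X| for X near Xs with entries in the group
    ([kkt_lower_bound]).  If it failed, points X_k tending to Xs would satisfy
    |F X_k| = o(|X_k - Xs|); a limit W of the normalised differences is nonzero
    and is killed by the differential of F.  Its components, translated to the
    identity, are tangent to the closed group, hence belong to the Lie algebra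
    ([tangent_lie_algebra], the elementary half of the closed subgroup theorem),
    which is the range of S: S is injective because J is invertible at Xs, and
    the dimensions agree ([lie_algebra_surj]).  So W is the velocity of a
    direction killed by J, and therefore zero, a contradiction.  The same bound
    is what keeps the iterates inside the neighbourhood where the estimates
    hold.

    Functions on the group are only given near each of its points as
    restrictions of functions on the ambient space.  Once continuous partial
    derivatives are known to give Frechet differentiability ([class_C1]), the
    derivatives along right translations are the differential of any such
    extension applied to the velocity ([sens_diff]), and calculus on the group
    reduces to calculus in a normed space. *)

Set Implicit Arguments.
Unset Strict Implicit.
Unset Printing Implicit Defensive.

Import Order.TTheory GRing.Theory Num.Theory.
Import numFieldNormedType.Exports.

Local Open Scope classical_set_scope.
Local Open Scope ring_scope.

(** * Matrix norms, entrywise limits and derivatives, the Euclidean norm *)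

Section MatrixTopology.
Context {R : realType}.

Lemma ler_mx_entry (p q : nat) (A : 'M[R]_(p, q)) i j : `|A i j| <= `|A|.
Proof.
by rewrite [leRHS]/Num.Def.normr /= mx_normrE; exact: (le_bigmax _ _ (i, j)).
Qed.

Lemma mx_norm_le (p q : nat) (A : 'M[R]_(p, q)) (e : R) :
  0 <= e -> (forall i j, `|A i j| <= e) -> `|A| <= e.
Proof.
by move=> e0 Ae; rewrite /Num.Def.normr /= mx_normrE bigmax_le // => -[].
Qed.

Lemma ler_norm_mulmx (p q r : nat) (A : 'M[R]_(p, q)) (B : 'M[R]_(q, r)) :
  `|A *m B| <= q%:R * (`|A| * `|B|).
Proof.
apply: mx_norm_le => [|i j]; first by rewrite !mulr_ge0.
rewrite mxE (le_trans (ler_norm_sum _ _ _)) //.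
rewrite (_ : q%:R * _ = \sum_(k < q) `|A| * `|B|); last first.
  by rewrite sumr_const card_ord mulr_natl.
apply: ler_sum => k _.
by rewrite normrM ler_pM // ler_mx_entry.
Qed.

Lemma cvg_mx (T : Type) (F : set_system T) (FF : Filter F) (p q : nat)
    (u : T -> 'M[R]_(p, q)) (l : 'M[R]_(p, q)) :
  (forall i j, u x i j @[x --> F] --> l i j) -> u x @[x --> F] --> l.
Proof.
move=> ul; apply/cvgrPdist_le => /= e e0; near=> x.
apply: mx_norm_le => [|i j]; first exact: ltW.
rewrite !mxE; move: i j; near: x; apply: filter_forall => i; apply: filter_forall => j.
by move/cvgrPdist_le : (ul i j) => /(_ _ e0).
Unshelve. all: by end_near. Qed.

(** A linear map out of a matrix space is a finite combination of entries. *)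
Lemma linear_mx_continuous (p q : nat) (W : normedModType R)
    (L : {linear 'M[R]_(p, q) -> W}) : continuous L.
Proof.
rewrite (_ : (L : _ -> _) =
    fun A => \sum_(i < p) \sum_(j < q) A i j *: L (delta_mx i j)); last first.
  apply/funext => A; rewrite {1}[A]matrix_sum_delta linear_sum.
  by apply: eq_bigr => i _; rewrite linear_sum; under eq_bigr do rewrite linearZ.
have sumc T (r : seq T) (f : T -> 'M[R]_(p, q) -> W) :
    (forall i, continuous (f i)) -> continuous (fun A => \sum_(i <- r) f i A).
  by move=> fc; apply: continuous_big => [|i _]; [exact: add_continuous|exact: fc].
apply: (sumc _ _ (fun i A => \sum_j A i j *: L (delta_mx i j))) => i.
apply: (sumc _ _ (fun j A => A i j *: L (delta_mx i j))) => j A.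
apply: (@cvgZ _ _ _ (nbhs A)); [exact: coord_continuous|exact: cvg_cst].
Qed.
End MatrixTopology.

Section MatrixDerivative.
Context {R : realType}.

Lemma cvg_mx_entry (T : Type) (F : set_system T) (FF : Filter F) (p q : nat)
    (u : T -> 'M[R]_(p, q)) (l : 'M[R]_(p, q)) i j :
  u x @[x --> F] --> l -> u x i j @[x --> F] --> l i j.
Proof.
move=> ul; apply/cvgrPdist_le => e e0.
move/cvgrPdist_le : ul => /(_ _ e0); apply: filterS => x.
by apply: le_trans; apply: le_trans (ler_mx_entry _ i j); rewrite !mxE.
Qed.

Lemma is_derive_mx (V : normedModType R) (p q : nat) (M : V -> 'M[R]_(p, q))
    (t v : V) (D : 'M[R]_(p, q)) :
  (forall i j, is_derive t v (fun s => M s i j) (D i j)) -> is_derive t v M D.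
Proof.
move=> dM; have dvM : derivable M t v by apply/derivable_mxP => i j.
split=> //; rewrite derive_mx //; apply/matrixP => i j.
by rewrite mxE; exact: derive_val.
Qed.

Lemma is_derive_mx_entry (V : normedModType R) (p q : nat) (M : V -> 'M[R]_(p, q))
    (t v : V) (D : 'M[R]_(p, q)) i j :
  is_derive t v M D -> is_derive t v (fun s => M s i j) (D i j).
Proof.
move=> [dM <-]; split; first by move/derivable_mxP : dM.
by rewrite derive_mx // mxE.
Qed.

Lemma is_derive_sum_fun (V W : normedModType R) (I : Type) (r : seq I)
    (h : I -> V -> W) (t v : V) (dh : I -> W) :
  (forall i, is_derive t v (h i) (dh i)) ->
  is_derive t v (fun x => \sum_(i <- r) h i x) (\sum_(i <- r) dh i).
Proof.
move=> H; elim: r => [|i r IH].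
  rewrite big_nil (_ : (fun _ => _) = cst 0); first exact: is_derive_cst.
  by apply/funext => x; rewrite big_nil.
rewrite big_cons (_ : (fun _ => _) = h i + (fun x => \sum_(i <- r) h i x)).
  exact: is_deriveD.
by apply/funext => x; rewrite big_cons.
Qed.

Lemma is_derive_mulmx (V : normedModType R) (p q r : nat)
    (A : V -> 'M[R]_(p, q)) (B : V -> 'M[R]_(q, r)) (t v : V) dA dB :
  is_derive t v A dA -> is_derive t v B dB ->
  is_derive t v (fun s => A s *m B s) (dA *m B t + A t *m dB).
Proof.
move=> HA HB; apply: is_derive_mx => i j.
rewrite (_ : (fun _ => _) = fun s => \sum_k A s i k * B s k j); last first.
  by apply/funext => s; rewrite mxE.
rewrite !mxE -big_split; apply: is_derive_sum_fun => k.
have HAk := is_derive_mx_entry i k HA; have HBk := is_derive_mx_entry k j HB.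
have := is_deriveM HAk HBk.
by rewrite addrC /GRing.scale /= [B t k j * _]mulrC.
Qed.

Lemma cvg_mulmx (T : Type) (F : set_system T) (FF : Filter F) (p q r : nat)
    (A : T -> 'M[R]_(p, q)) (B : T -> 'M[R]_(q, r))
    (A0 : 'M[R]_(p, q)) (B0 : 'M[R]_(q, r)) :
  A x @[x --> F] --> A0 -> B x @[x --> F] --> B0 ->
  A x *m B x @[x --> F] --> A0 *m B0.
Proof.
move=> cA cB; apply: cvg_mx => i j; rewrite mxE.
rewrite (_ : (fun x => _) = fun x => \sum_k A x i k * B x k j); last first.
  by apply/funext => s; rewrite mxE.
apply: cvg_big => [|k _]; first exact: add_continuous.
by apply: cvgM; apply: cvg_mx_entry.
Qed.

End MatrixDerivative.

Lemma subr_mxE (R : zmodType) (p q : nat) (A B : 'M[R]_(p, q)) i j :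
  (A - B) i j = A i j - B i j.
Proof. by rewrite !mxE. Qed.

Lemma is_derive_pair (R : realType) (V W W' : normedModType R) (f : V -> W) (g : V -> W')
    (t v : V) df dg : is_derive t v f df -> is_derive t v g dg ->
  is_derive t v (fun x => (f x, g x)) (df, dg).
Proof.
move=> [/cvg_ex[/= l cl] fE] [/cvg_ex[/= l' cl'] gE].
have lE : l = df by rewrite -fE; apply/esym/cvg_lim.
have lE' : l' = dg by rewrite -gE; apply/esym/cvg_lim.
have c : (fun h : R => h^-1 *: ((f (h *: v + t), g (h *: v + t)) - (f t, g t)))
    @ 0^' --> (df, dg).
  by rewrite -lE -lE'; exact: cvg_pair.
split; first by apply/cvg_ex; exists (df, dg).
exact: cvg_lim.
Qed.

Lemma ler_pair_norm (R : realType) (V W : normedModType R) (x : V * W) (e : R) :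
  (`|x| <= e) = (`|x.1| <= e) && (`|x.2| <= e).
Proof. by rewrite prod_normE ge_max. Qed.

Section Ultra.
Context {R : realType}.

Lemma ultra_pushforward (T U : Type) (F : set_system T) (u : T -> U) :
  UltraFilter F -> UltraFilter (u @ F).
Proof.
move=> FU; have FP := @ultra_proper _ _ FU; split; first exact: fmap_proper_filter.
move=> G GP FG; apply/seteqP; split=> // A GA.
have [//|FnA] := in_ultra_setVsetC (u @^-1` A) FU.
have : G (~` A) by apply: FG.
by move=> GnA; have [x []] := filter_ex (filterI GA GnA).
Qed.

(** Along an ultrafilter each bounded entry converges by compactness of
    segments, so that limit points are obtained without extracting
    subsequences. *)
Lemma ultra_cvg_mx (T : Type) (F : set_system T) (p q : nat) (u : T -> 'M[R]_(p, q))
    (M : R) : UltraFilter F -> (\forall x \near F, `|u x| <= M) ->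
  exists l : 'M[R]_(p, q), u x @[x --> F] --> l.
Proof.
move=> FU uM; have FP := @ultra_proper _ _ FU.
have c i j : exists l : R, u x i j @[x --> F] --> l.
  have := @segment_compact R (- M) M; rewrite compact_ultra.
  move=> /(_ _ (ultra_pushforward (fun x => u x i j) FU)) [|l [_ cl]]; last by exists l.
  near_simpl; apply: filterS uM => x ux /=; rewrite in_itv /= -ler_norml.
  exact: le_trans (ler_mx_entry _ _ _) ux.
exists (\matrix_(i, j) sval (cid (c i j))).
by apply: cvg_mx => i j; rewrite mxE; exact: svalP (cid (c i j)).
Qed.
End Ultra.

Lemma free_rows_eq0 (R : fieldType) (k l : nat) (v : 'I_k -> 'rV[R]_l) (c : 'I_k -> R) :
  free [seq v j | j : 'I_k] -> (forall b, \sum_j c j * v j 0 b = 0) -> forall j, c j = 0.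
Proof.
move=> fv cv j; have fv' : free (tuple.mktuple v) by [].
have := freeP fv' c; apply; apply/rowP => b.
rewrite summxE mxE -[RHS](cv b); apply: eq_bigr => i _.
by rewrite nth_mktuple mxE.
Qed.

Section EuclideanNorm.
Context {R : realType} {k : nat}.
Implicit Types x y : 'cV[R]_k.

Lemma enorm_ge0 x : 0 <= enorm x.
Proof. exact: sqrtr_ge0. Qed.

Lemma enorm_sqr x : enorm x ^+ 2 = \sum_i x i 0 ^+ 2.
Proof. by rewrite sqr_sqrtr // sumr_ge0 // => i _; exact: sqr_ge0. Qed.

Lemma enormZ (a : R) x : enorm (a *: x) = `|a| * enorm x.
Proof.
rewrite /enorm -sqrtr_sqr -sqrtrM ?sqr_ge0 // mulr_sumr.
by congr Num.sqrt; apply: eq_bigr => i _; rewrite mxE exprMn.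
Qed.

Lemma enormN x : enorm (- x) = enorm x.
Proof. by rewrite -scaleN1r enormZ normrN1 mul1r. Qed.

Lemma ler_norm_enorm x : `|x| <= enorm x.
Proof.
apply: mx_norm_le => [|i j]; first exact: enorm_ge0.
rewrite ord1 -(ler_pXn2r (n := 2)) ?nnegrE ?enorm_ge0 // enorm_sqr real_normK ?num_real //.
by rewrite (bigD1 i) //= lerDl sumr_ge0 // => l _; exact: sqr_ge0.
Qed.

Lemma enorm0_eq0 x : enorm x = 0 -> x = 0.
Proof.
by move=> x0; apply/eqP; rewrite -normr_le0 (le_trans (ler_norm_enorm x)) // x0.
Qed.

Lemma ler_enorm_norm x : enorm x <= k%:R * `|x|.
Proof.
rewrite -(ler_pXn2r (n := 2)) ?nnegrE ?enorm_ge0 ?mulr_ge0 // enorm_sqr.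
apply: (@le_trans _ _ (k%:R * `|x| ^+ 2)).
  have -> : k%:R * `|x| ^+ 2 = \sum_(i < k) `|x| ^+ 2.
    by rewrite sumr_const card_ord mulr_natl.
  apply: ler_sum => i _.
  rewrite -[x i 0 ^+ 2]real_normK ?num_real // lerXn2r ?nnegrE //.
  exact: ler_mx_entry.
rewrite exprMn ler_wpM2r ?exprn_ge0 // -natrX ler_nat.
by case: (k) => // k'; rewrite expnS leq_pmulr.
Qed.

(** Minkowski inequality, from Cauchy-Schwarz; the latter is the nonnegativity
    of the sum of the squares of |y| x_i - |x| y_i. *)
Lemma ler_enormD x y : enorm (x + y) <= enorm x + enorm y.
Proof.
have [x0|xn0] := eqVneq (enorm x) 0; first by rewrite x0 (enorm0_eq0 x0) !add0r.
have [y0|yn0] := eqVneq (enorm y) 0; first by rewrite y0 (enorm0_eq0 y0) !addr0.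
have xp : 0 < enorm x by rewrite lt_def xn0 enorm_ge0.
have yp : 0 < enorm y by rewrite lt_def yn0 enorm_ge0.
pose p := \sum_i x i 0 * y i 0.
have CS : p <= enorm x * enorm y.
  have : 0 <= \sum_i (enorm y * x i 0 - enorm x * y i 0) ^+ 2.
    by rewrite sumr_ge0 // => i _; exact: sqr_ge0.
  have -> : \sum_i (enorm y * x i 0 - enorm x * y i 0) ^+ 2 =
      2 * (enorm x * enorm y) * (enorm x * enorm y - p).
    have -> : \sum_i (enorm y * x i 0 - enorm x * y i 0) ^+ 2 =
        enorm y ^+ 2 * enorm x ^+ 2 + enorm x ^+ 2 * enorm y ^+ 2
        - 2 * (enorm x * enorm y) * p; last by ring.
      set a := enorm x; set b := enorm y.
      rewrite [X in _ = b ^+ 2 * X + _ - _]enorm_sqr [X in _ = _ + a ^+ 2 * X - _]enorm_sqr.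
      rewrite /p !mulr_sumr -sumrN -!big_split /=.
      by apply: eq_bigr => i _; ring.
  by rewrite pmulr_rge0 ?mulr_gt0 // subr_ge0.
rewrite -(ler_pXn2r (n := 2)) ?nnegrE ?enorm_ge0 ?addr_ge0 ?enorm_ge0 //.
have -> : enorm (x + y) ^+ 2 = enorm x ^+ 2 + enorm y ^+ 2 + 2 * p.
  rewrite !enorm_sqr /p mulr_sumr -!big_split /=; apply: eq_bigr => i _.
  by rewrite mxE; ring.
have -> : (enorm x + enorm y) ^+ 2 = enorm x ^+ 2 + enorm y ^+ 2 + 2 * (enorm x * enorm y).
  by ring.
by rewrite lerD2l ler_wpM2l.
Qed.
End EuclideanNorm.

Lemma mulmx_inj_unit (K : fieldType) (k : nat) (A : 'M[K]_k) :
  (forall w : 'cV[K]_k, A *m w = 0 -> w = 0) -> A \in unitmx.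
Proof.
move=> inj; rewrite -unitmx_tr -row_free_unit -kermx_eq0; apply/eqP/row_matrixP => i.
rewrite row0; apply: trmx_inj; rewrite trmx0; apply: inj.
apply: trmx_inj; rewrite trmx_mul trmxK trmx0.
by rewrite -row_mul mulmx_ker row0.
Qed.

Lemma unitmx_unique_solution (K : fieldType) (k : nat) (A : 'M[K]_k) (b : 'cV[K]_k) :
  A \in unitmx -> exists! x, A *m x = b.
Proof.
move=> uA; exists (invmx A *m b); split; first by rewrite mulKVmx.
by move=> x <-; rewrite mulKmx.
Qed.

Lemma near_ball_lt (R : realType) (V : normedModType R) (x0 : V) (r : R) :
  0 < r -> \forall x \near x0, `|x - x0| < r.
Proof.
by move=> r0; apply/nbhs_ballP; exists r => // x; rewrite -ball_normE /= distrC.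
Qed.

(** Both admissible sizes of the perturbation rho reduce to one: a fixed
    fraction b < 1 of the residual t, as long as t is small. For p = 2 this
    comes from C t^2 = (C t) t. *)
Lemma residual_bound (R : realType) (k p : nat) (C : R) : (p = 1%N /\ C < 1) \/ p = 2%N ->
  exists b dl : R, [/\ 0 <= b, b < 1, 0 < dl & forall (rho : 'cV[R]_k) (t : R),
    0 <= t <= dl -> (rho = 0 \/ enorm rho <= C * t ^+ p) -> enorm rho <= b * t].
Proof.
have en0 : enorm (0 : 'cV[R]_k) = 0.
  by apply/eqP; rewrite eq_le enorm_ge0 andbT (le_trans (ler_enorm_norm _)) // normr0 mulr0.
move=> [[-> C1]|->].
  exists (Num.max C 0), 1; split => //; first by rewrite le_max lexx orbT.
    by rewrite gt_max C1 ltr01.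
  move=> rho t /andP[t0 _] [->|]; first by rewrite en0 mulr_ge0 // le_max lexx orbT.
  by move=> /le_trans; apply; rewrite expr1 ler_wpM2r // le_max lexx.
exists (1 / 2), (1 / (2 * (`|C| + 1))).
have C0 : 0 < 2 * (`|C| + 1) by rewrite mulr_gt0 // ltr_wpDl.
split; [lra|lra|exact: divr_gt0|].
move=> rho t /andP[t0 t1] [->|]; first by rewrite en0 mulr_ge0 // divr_ge0.
move=> /le_trans; apply; rewrite expr2 mulrA ler_wpM2r //.
move: t1; rewrite ler_pdivlMr // => t1.
have : C * t <= (`|C| + 1) * t by rewrite ler_wpM2r // (le_trans (ler_norm _)) // lerDl.
by move=> h1; lra.
Qed.

(** * The matrix exponential *)

Section Exponential.
Context {R : realType} {N : nat}.
Implicit Types A B : 'M[R]_N.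

(** The sup norm of the identity is at most 1 but |A B| <= N |A| |B| carries a
    factor N; absorbing it into the base of the power leaves no constant in
    front. *)
Lemma ler_norm_expmx_pow A k : `|A ^+ k| <= (N%:R * `|A|) ^+ k.
Proof.
elim: k => [|k IH].
  rewrite !expr0; apply: mx_norm_le => // i j.
  by rewrite mxE; case: eqP => _; rewrite ?normr1 ?normr0.
rewrite !exprS (le_trans (ler_norm_mulmx _ _)) // -mulrA.
by rewrite ler_wpM2l ?ler0n // ler_wpM2l.
Qed.

Lemma ler_norm_expmx_coeff A i j k :
  `|(A ^+ k) i j / k`!%:R| <= exp_coeff (N%:R * `|A|) k.
Proof.
rewrite normrM normfV [`|k`!%:R|]ger0_norm ?ler0n // /exp_coeff /=.
rewrite ler_wpM2r ?invr_ge0 ?ler0n // (le_trans (ler_mx_entry _ _ _)) //.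
exact: ler_norm_expmx_pow.
Qed.

Lemma is_cvg_normed_expmx_coeff A i j :
  cvgn [normed series (fun k => (A ^+ k) i j / k`!%:R)].
Proof.
apply: series_le_cvg (is_cvg_series_exp_coeff (N%:R * `|A|)) => k //=.
  by rewrite exp_coeff_ge0 // mulr_ge0.
exact: ler_norm_expmx_coeff.
Qed.

Lemma expmxE A i j : expmx A i j = limn (series (fun k => (A ^+ k) i j / k`!%:R)).
Proof.
suff -> : expmx A = \matrix_(i, j) limn (series (fun k => (A ^+ k) i j / k`!%:R)).
  by rewrite mxE.
apply: cvg_lim => //; apply: cvg_mx => a b; rewrite mxE.
rewrite (_ : (fun n => _) = series (fun k => (A ^+ k) a b / k`!%:R)).
  exact: normed_cvg (@is_cvg_normed_expmx_coeff A a b).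
apply/funext => n; rewrite /series /= summxE; apply: eq_bigr => k _.
by rewrite mxE mulrC.
Qed.

Lemma cvg_expmx A i j :
  series (fun k => (A ^+ k) i j / k`!%:R) @ \oo --> expmx A i j.
Proof. by rewrite expmxE; exact: normed_cvg (@is_cvg_normed_expmx_coeff A i j). Qed.

Lemma ler_norm_expmx A : `|expmx A| <= expR (N%:R * `|A|).
Proof.
apply: mx_norm_le => [|i j]; first exact: expR_ge0.
have cA := @is_cvg_normed_expmx_coeff A i j.
rewrite expmxE (le_trans (lim_series_norm cA)) //.
apply: ler_lim => //; first exact: is_cvg_series_exp_coeff.
by near=> n; apply: ler_sum => k _; exact: ler_norm_expmx_coeff.
Unshelve. all: by end_near. Qed.

Lemma expmx_0 : expmx (0 : 'M[R]_N) = 1%:M.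
Proof.
apply/matrixP => i j; rewrite expmxE; apply: cvg_lim => //.
rewrite -(cvg_shiftn 1) /=; apply: cvg_near_cst; near=> n.
rewrite /series /= addn1 big_nat_recl // expr0 fact0 divr1 big1 ?addr0 // => k _.
by rewrite exprS mul0r mxE mul0r.
Unshelve. all: by end_near. Qed.

Lemma exprZmx A (s : R) k : (s *: A) ^+ k = s ^+ k *: A ^+ k.
Proof.
elim: k => [|k IH]; first by rewrite !expr0 scale1r.
by rewrite !exprS IH -[LHS]scalemxAl -[in LHS]scalemxAr scalerA.
Qed.

(** Each entry of exp(s A) is a real power series in s, whose termwise
    derivative is the power series of the same entry of exp(s A) A. *)
Lemma is_derive_expmx_entry A i j (t : R) :
  is_derive t (1 : R) (fun s : R => expmx (s *: A) i j) ((expmx (t *: A) *m A) i j).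
Proof.
pose c m k := (A ^+ (k + m)) i j / k`!%:R.
have powE s k : (s *: A) ^+ k = s ^+ k *: A ^+ k by exact: exprZmx.
have dc m : pseries_diffs (c m) = c m.+1.
  apply/funext => k; rewrite /pseries_diffs /c addSnnS mulrCA; congr (_ * _).
  by rewrite factS natrM invfM mulrA divff ?mul1r // pnatr_eq0.
have cc m s : cvgn (pseries (c m) s).
  apply: normed_cvg.
  apply: (@series_le_cvg _ _ (fun k =>
    (N%:R * `|A|) ^+ m * exp_coeff (N%:R * `|A| * `|s|) k)) => [k|k|k|] //=;
      last exact: is_cvg_seriesZ (is_cvg_series_exp_coeff _).
    by rewrite mulr_ge0 ?exp_coeff_ge0 ?exprn_ge0 ?mulr_ge0.
  have -> : (N%:R * `|A|) ^+ m * exp_coeff (N%:R * `|A| * `|s|) k =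
      (N%:R * `|A|) ^+ (k + m) / k`!%:R * `|s| ^+ k.
    set q := _ * `|A|; rewrite /exp_coeff /= (exprMn k q) exprD.
    by rewrite !mulrA [q ^+ m * _]mulrC mulrAC.
  rewrite /c !normrM normrX ler_wpM2r ?exprn_ge0 //.
  rewrite normfV [`|k`!%:R|]ger0_norm ?ler0n //.
  rewrite ler_wpM2r ?invr_ge0 ?ler0n // (le_trans (ler_mx_entry _ _ _)) //.
  exact: ler_norm_expmx_pow.
have -> : (fun s => expmx (s *: A) i j) = fun s => limn (pseries (c 0%N) s).
  apply/funext => s; rewrite expmxE; congr (limn (series _)).
  apply/funext => k; rewrite /= /c addn0 powE mxE.
  by rewrite [s ^+ k * _]mulrC mulrAC.
suff <- : limn (pseries (c 1%N) t) = (expmx (t *: A) *m A) i j.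
  rewrite -dc; apply: (@pseries_snd_diffs _ _ (`|t| + 1)); rewrite ?dc //.
  by rewrite [ltRHS]ger0_norm ?addr_ge0 // ltrDl.
apply: cvg_lim => //.
rewrite (_ : pseries _ _ = fun n => \sum_l
    series (fun k => ((t *: A) ^+ k) i l / k`!%:R) n * A l j); last first.
  apply/funext => n; rewrite /pseries /series /=.
  under [RHS]eq_bigr do rewrite mulr_suml.
  rewrite exchange_big; apply: eq_bigr => k _ /=.
  rewrite /c addn1 exprSr mxE !mulr_suml; apply: eq_bigr => l _.
  by rewrite powE mxE; ring.
rewrite mxE; apply: cvg_big => [|l _]; first exact: add_continuous.
by apply: cvgM; [exact: cvg_expmx|exact: cvg_cst].
Qed.
End Exponential.

Section ExponentialTheory.
Context {R : realType} {N : nat}.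
Implicit Types A B : 'M[R]_N.

Lemma is_derive_expmx A (t : R) :
  is_derive t (1 : R) (fun s : R => expmx (s *: A)) (expmx (t *: A) *m A).
Proof. by apply: is_derive_mx => i j; exact: is_derive_expmx_entry. Qed.

Lemma cvg_series_expmx A :
  series (fun k => (k`!%:R)^-1 *: A ^+ k) @ \oo --> expmx A.
Proof.
apply: cvg_mx => i j.
rewrite (_ : (fun n => _) = series (fun k => (A ^+ k) i j / k`!%:R)).
  exact: cvg_expmx.
apply/funext => n; rewrite /series /= summxE; apply: eq_bigr => k _.
by rewrite mxE mulrC.
Qed.

Lemma expmx_comm A B : A *m B = B *m A -> A *m expmx B = expmx B *m A.
Proof.
move=> AB.
have c1 : (A *m series (fun k => (k`!%:R)^-1 *: B ^+ k) n) @[n --> \oo]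
    --> A *m expmx B.
  by apply: cvg_mulmx; [exact: cvg_cst|exact: cvg_series_expmx].
have c2 : (series (fun k => (k`!%:R)^-1 *: B ^+ k) n *m A) @[n --> \oo]
    --> expmx B *m A.
  by apply: cvg_mulmx; [exact: cvg_series_expmx|exact: cvg_cst].
apply: (cvg_unique _ c1); first exact: norm_hausdorff.
rewrite [X in X @ _](_ : _ = fun n =>
  series (fun k => (k`!%:R)^-1 *: B ^+ k) n *m A) //.
apply/funext => n; rewrite /series /= mulmx_sumr mulmx_suml.
apply: eq_bigr => k _; rewrite -scalemxAr -scalemxAl; congr (_ *: _).
exact: (commrX k AB).
Qed.

Lemma is_derive_expmx_affine A (a b x : R) :
  is_derive x (1 : R) (fun s : R => expmx ((a * s + b) *: A))
    (a *: (expmx ((a * x + b) *: A) *m A)).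
Proof.
apply: is_derive_mx => i j; rewrite mxE mulrC.
apply: (@is_derive1_comp R (fun s => expmx (s *: A) i j) (fun s => a * s + b)).
  exact: is_derive_expmx_entry.
by apply: is_derive_eq; rewrite addr0 /GRing.scale /= mulr1.
Qed.

(** The product exp((x + u) A) exp(- x A) has zero derivative in x, hence is
    its value exp(u A) at x = 0; taking u = 0 shows that exp(- x A) inverts
    exp(x A). *)
Lemma expmxD A (s t : R) :
  expmx ((s + t) *: A) = expmx (s *: A) *m expmx (t *: A).
Proof.
have key u x : expmx ((x + u) *: A) *m expmx (- x *: A) = expmx (u *: A).
  pose phi x := expmx ((1 * x + u) *: A) *m expmx ((-1 * x + 0) *: A).
  have phi0 y : is_derive y (1 : R) phi (0 : 'M[R]_N).
    have := is_derive_mulmx (is_derive_expmx_affine A 1 u y)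
      (is_derive_expmx_affine A (-1) 0 y).
    rewrite !scale1r scaleN1r mulmxN -!mulmxA [A *m expmx _]expmx_comm ?subrr //.
    by rewrite -scalemxAr -scalemxAl.
  have phiE : phi x = phi 0.
    apply/matrixP => i j.
    apply: (@is_derive_0_is_cst R (fun y => phi y i j)) => y.
    by have := is_derive_mx_entry i j (phi0 y); rewrite mxE.
  move: phiE; rewrite /phi !mulr0 mul1r !add0r scale0r expmx_0 mulmx1 addr0.
  by rewrite mulN1r.
have inv x : expmx (- x *: A) *m expmx (x *: A) = 1%:M.
  by have := key 0 (- x); rewrite addr0 scale0r expmx_0 opprK.
have := congr1 (fun M => M *m expmx (t *: A)) (key s t).
by rewrite /= -mulmxA (inv t) mulmx1 [t + s]addrC.
Qed.

Lemma expmxN A : expmx A *m expmx (- A) = 1%:M.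
Proof. by have := expmxD A 1 (-1); rewrite subrr scale0r expmx_0 scale1r scaleN1r. Qed.

Lemma expmx_unit A : expmx A \in unitmx.
Proof. by case: (mulmx1_unit (expmxN A)). Qed.

Lemma expmxMn A k : expmx (k%:R *: A) = expmx A ^+ k.
Proof.
elim: k => [|k IH]; first by rewrite scale0r expmx_0 expr0.
by rewrite -natr1 expmxD scale1r IH exprSr.
Qed.

(** Mean value theorem on each entry of exp(s A), for s between 0 and 1. *)
Lemma ler_norm_expmx_sub1 A :
  `|expmx A - 1%:M| <= N%:R * (expR (N%:R * `|A|) * `|A|).
Proof.
apply: mx_norm_le => [|i j]; first by rewrite !mulr_ge0 // expR_ge0.
have [||c c01] := @MVT R (fun s => expmx (s *: A) i j)
  (fun s => (expmx (s *: A) *m A) i j) 0 1 ltr01.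
- by move=> x _; exact: is_derive_expmx_entry.
- apply: derivable_within_continuous => x _.
  by case: (is_derive_expmx_entry A i j x).
rewrite scale1r scale0r expmx_0 subr0 mulr1 => E.
have -> : (expmx A - 1%:M) i j = expmx A i j - 1%:M i j by rewrite !mxE.
rewrite E (le_trans (ler_mx_entry _ _ _)) //.
rewrite (le_trans (ler_norm_mulmx _ _)) // ler_wpM2l // ler_wpM2r //.
rewrite (le_trans (ler_norm_expmx _)) // ler_expR ler_wpM2l // normrZ.
move: c01; rewrite in_itv /= => /andP[c0 c1].
by rewrite [`|c|]ger0_norm ?ler_piMl // ltW.
Qed.

Lemma continuous_expmxZ A : continuous (fun t : R => expmx (t *: A)).
Proof.
move=> t; apply: differentiable_continuous; apply/derivable1_diffP.
by case: (is_derive_expmx A t).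
Qed.

End ExponentialTheory.

(** The square of a translation generator vanishes, which leaves two terms of
    the exponential series. *)
Lemma expmx_trans (R : realType) (d : nat) (z : 'cV[R]_d) :
  expmx (trans_alg z) = trans_mx z.
Proof.
have sq : trans_alg z *m trans_alg z = 0.
  by rewrite /trans_alg mulmx_block !mul0mx !mulmx0 !addr0 block_mx0.
apply: cvg_lim; first exact: norm_hausdorff.
rewrite -(cvg_shiftn 2) /=; apply: cvg_near_cst; near=> n.
rewrite /series /= addn2 !big_nat_recl // big1 => [|k _].
  rewrite addr0 expr0 expr1 invr1 !scale1r /trans_mx /trans_alg.
  rewrite [1](scalar_mx_block d 1 1) add_block_mx.
  by rewrite !add0r !addr0.
by rewrite exprS exprS mulrA -[_ * _ * _]/(_ *m _ *m _) sq mul0mx scaler0.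
Unshelve. all: by end_near. Qed.

(** * Tangent directions of a closed matrix group *)

Section Tangent.
Context {R : realType} {N : nat}.
Implicit Types A E B D : 'M[R]_N.

(** Submultiplicativity of the sup norm would cost a factor N for each
    multiplication. Near the identity this is avoided by the recursion A^(k+1)
    = A^k + (A - 1) A^k, where only the small factor A - 1 is multiplied. *)
Lemma ler_norm_exprmx A (q : R) k :
  N%:R * `|A - 1%:M| <= q -> `|A ^+ k| <= (1 + q) ^+ k.
Proof.
move=> Aq; have q0 : 0 <= q by rewrite (le_trans _ Aq) // mulr_ge0.
elim: k => [|k IH].
  rewrite !expr0; apply: mx_norm_le => // i j.
  by rewrite mxE; case: eqP => _; rewrite ?normr1 ?normr0.
rewrite exprS -[A * _]/(A *m _) -[in X in X *m _](subrK 1%:M A) mulmxDl mul1mx addrC.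
rewrite (le_trans (ler_normD _ _)) // exprS mulrDl mul1r lerD //.
rewrite (le_trans (ler_norm_mulmx _ _)) // mulrA ler_pM //.
Qed.

(** The difference d_k = A^k - E^k satisfies
    d_(k+1) = d_k + (A - 1) d_k + (A - E) E^k, so it grows by a factor 1 + q and
    a small increment at each step. *)
Lemma ler_norm_exprmx_sub A E (q : R) k :
  N%:R * `|A - 1%:M| <= q -> N%:R * `|E - 1%:M| <= q ->
  `|A ^+ k - E ^+ k| <= k%:R * (N%:R * `|A - E|) * (1 + q) ^+ k.
Proof.
move=> Aq Eq; have q0 : 0 <= q by rewrite (le_trans _ Aq) // mulr_ge0.
elim: k => [|k IH]; first by rewrite !expr0 subrr normr0 mul0r mul0r.
have -> : A ^+ k.+1 - E ^+ k.+1 = (A ^+ k - E ^+ k) +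
    ((A - 1%:M) *m (A ^+ k - E ^+ k) + (A - E) *m E ^+ k).
  rewrite !exprS -[A * _]/(A *m _) -[E * _]/(E *m _).
  rewrite !mulmxBl mul1mx [RHS]addrA [X in _ = X + _]addrC subrK mulmxBr.
  by rewrite addrA subrK.
set d := _ - E ^+ k in IH *.
have h1 : `|(A - 1%:M) *m d| <= q * `|d|.
  by rewrite (le_trans (ler_norm_mulmx _ _)) // mulrA ler_wpM2r.
have h2 : `|(A - E) *m E ^+ k| <= N%:R * `|A - E| * (1 + q) ^+ k.
  rewrite (le_trans (ler_norm_mulmx _ _)) // mulrA ler_wpM2l ?mulr_ge0 //.
  exact: ler_norm_exprmx.
apply: (@le_trans _ _ (`|d| * (1 + q) + N%:R * `|A - E| * (1 + q) ^+ k)).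
  rewrite (le_trans (ler_normD _ _)) // mulrDr mulr1 -addrA lerD2l.
  by rewrite (le_trans (ler_normD _ _)) // lerD // mulrC.
apply: (@le_trans _ _ (k%:R * (N%:R * `|A - E|) * (1 + q) ^+ k.+1 +
                       N%:R * `|A - E| * (1 + q) ^+ k.+1)).
  rewrite lerD //; first by rewrite exprSr [leRHS]mulrA ler_wpM2r // addr_ge0.
  rewrite ler_wpM2l ?mulr_ge0 // exprSr ler_peMr ?lerDl //.
  by rewrite exprn_ge0 // addr_ge0.
by rewrite -mulrDl -[X in _ + X]mul1r -mulrDl natr1.
Qed.

(** If A_x is in G and A_x = 1 + u_x B + o(u_x), then the powers A_x^n with n =
    floor(t / u_x) stay in G and tend to exp(t B): they are compared with
    exp(u_x B)^n = exp(n u_x B), the error being n o(u_x) = o(1). As G is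
    closed among invertible matrices, exp(t B) is in G. *)
Lemma tangent_lie_algebra (T : Type) (F : set_system T) (FF : ProperFilter F)
    (G : set 'M[R]_N) (A : T -> 'M[R]_N) (u : T -> R) (B : 'M[R]_N) :
  matrix_lie_group G -> (\forall x \near F, G (A x)) ->
  (\forall x \near F, 0 < u x) -> u x @[x --> F] --> 0 ->
  (u x)^-1 *: (A x - 1%:M) @[x --> F] --> B -> lie_algebra G B.
Proof.
move=> [Gunit G1 GM GV Gcl] GA u0 uF AB.
have GX C k : G C -> G (C ^+ k).
  by move=> GC; elim: k => [|k IH]; rewrite ?expr0 // exprS; exact: GM.
suff H t : 0 <= t -> G (expmx (t *: B)).
  move=> t; have [/H//|t0] := leP 0 t.
  have /H/GV : 0 <= - t by rewrite oppr_ge0 ltW.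
  suff -> : invmx (expmx (- t *: B)) = expmx (t *: B) by [].
  have := expmxN (- t *: B); rewrite scaleNr opprK.
  move=> /(congr1 (mulmx (invmx (expmx (- (t *: B)))))).
  by rewrite mulKmx ?mulmx1 // expmx_unit.
move=> t0; apply: Gcl; last exact: expmx_unit.
pose n x := Num.truncn (t / u x).
pose E x := expmx (u x *: B).
have nut x : 0 < u x -> (n x)%:R * u x <= t < (n x)%:R * u x + u x.
  move=> ux0; have : (n x)%:R <= t / u x < (n x).+1%:R.
    by apply: truncn_itv; rewrite divr_ge0 // ltW.
  by rewrite ler_pdivlMr // ltr_pdivrMr // -natr1 mulrDl mul1r.
have nu : (n x)%:R * u x @[x --> F] --> t.
  apply/cvgrPdist_le => e e0; near=> x.
  have ux0 : 0 < u x by near: x.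
  have /andP[n1 n2] := nut x ux0.
  rewrite ger0_norm ?subr_ge0 // lerBlDl (le_trans (ltW n2)) // lerD2l.
  by rewrite -(ger0_norm (ltW ux0)); near: x; exact: cvgr0_norm_le.
have EB : (u x)^-1 *: (E x - 1%:M) @[x --> F] --> B.
  have [dE DE] := is_derive_expmx B 0.
  have : h^-1 *: (expmx (h *: B) - 1%:M) @[h --> 0^'] --> B.
    move: dE => /cvg_ex[/= l cl].
    have lB : l = B.
      by move: DE; rewrite scale0r expmx_0 mul1mx => <-; apply/esym/cvg_lim.
    move: cl; rewrite lB.
    by under eq_fun do rewrite scale0r expmx_0 addr0 [_ *: 1]mulr1.
  apply: cvg_comp.
  move=> U [e /= e0 eU]; near=> x; apply: eU => /=.
    by near: x; move/cvgrPdist_lt : uF; exact.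
  by rewrite gt_eqF //; near: x.
pose w x : 'M[R]_N := (u x)^-1 *: (A x - 1%:M) - (u x)^-1 *: (E x - 1%:M).
have w0 : w x @[x --> F] --> (0 : 'M[R]_N) by rewrite -(subrr B); exact: cvgB.
pose q := N%:R * (`|B| + 1).
have q0 : 0 <= q by rewrite mulr_ge0 ?addr_ge0.
have small (C : T -> 'M[R]_N) : (u x)^-1 *: (C x - 1%:M) @[x --> F] --> B ->
    \forall x \near F, N%:R * `|C x - 1%:M| <= q * u x.
  move=> CB; near=> x.
  have ux0 : 0 < u x by near: x.
  rewrite -mulrA ler_wpM2l // -ler_pdivrMr // mulrC -{1}(gtr0_norm ux0).
  rewrite -normfV -normrZ.
  near: x; by apply: (cvgr_norm_le _ CB); rewrite ltrDl.
have AnE : (A x ^+ n x - E x ^+ n x) @[x --> F] --> (0 : 'M[R]_N).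
  (* From n u <= t the comparison of powers gives |A^n - E^n| <= K |w|, with
     the growth factor (1 + q u)^n at most exp(q t). *)
  pose K := N%:R * (t * expR (q * t)) + 1.
  have K0 : 0 < K by rewrite ltr_wpDl // !mulr_ge0 // expR_ge0.
  apply/cvgr0Pnorm_le => e e0; near=> x.
  have ux0 : 0 < u x by near: x.
  have /andP[n1 _] := nut x ux0.
  apply: (@le_trans _ _ (K * `|w x|)); last first.
    by rewrite -ler_pdivlMl //; near: x; apply: cvgr0_norm_le; rewrite ?mulr_gt0 ?invr_gt0.
  have nAx : N%:R * `|A x - 1%:M| <= q * u x by near: x; exact: small.
  have nEx : N%:R * `|E x - 1%:M| <= q * u x by near: x; exact: small.
  rewrite (le_trans (ler_norm_exprmx_sub (n x) nAx nEx)) //.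
  have -> : (n x)%:R * (N%:R * `|A x - E x|) = N%:R * ((n x)%:R * u x * `|w x|).
    rewrite /w -scalerBr normrZ normfV (gtr0_norm ux0) opprB addrA subrK.
    by field; rewrite gt_eqF.
  have h2 : (1 + q * u x) ^+ n x <= expR (q * t).
    apply: (@le_trans _ _ (expR (q * u x) ^+ n x)).
      rewrite lerXn2r ?nnegrE ?expR_ge0 ?expR_ge1Dx //.
      by rewrite addr_ge0 // mulr_ge0 // ltW.
    by rewrite -expRM_natl ler_expR mulrCA ler_wpM2l.
  rewrite /K mulrDl mul1r ler_wpDr //.
  rewrite [leRHS](_ : _ = N%:R * (t * `|w x|) * expR (q * t)); last by ring.
  have ux1 : 0 <= u x := ltW ux0.
  apply: ler_pM => //; rewrite ?exprn_ge0 ?addr_ge0 ?mulr_ge0 //.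
  by rewrite ler_wpM2l // ler_wpM2r.
have En : E x ^+ n x @[x --> F] --> expmx (t *: B).
  rewrite (_ : (fun x => _) = fun x => expmx (((n x)%:R * u x) *: B)); last first.
    by apply/funext => x; rewrite -expmxMn scalerA.
  exact: (@cvg_comp _ _ _ (fun x => (n x)%:R * u x) (fun s => expmx (s *: B))
    _ _ _ nu (@continuous_expmxZ R N B t)).
have An : A x ^+ n x @[x --> F] --> expmx (t *: B).
  rewrite -[expmx _]add0r (_ : (fun x => _) = fun x => A x ^+ n x - E x ^+ n x + E x ^+ n x).
    exact: cvgD.
  by apply/funext => x /=; rewrite subrK.
move=> U /An FU; have [x [Gx Ux]] := filter_ex (filterI GA FU).
by exists (A x ^+ n x); split => //; exact: GX.
Unshelve. all: by end_near. Qed.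

End Tangent.

(** * Continuously differentiable functions *)

Section Differentiability.
Context {R : realType}.

Lemma near_eq_continuous_at (T U : topologicalType) (f g : T -> U) (x : T) :
  (\forall y \near x, f y = g y) -> {for x, continuous f} -> {for x, continuous g}.
Proof.
move=> fg cf; have fgx : f x = g x := nbhs_singleton fg.
rewrite /prop_for /continuous_at -fgx.
by apply: cvg_trans cf; exact: near_eq_cvg.
Qed.

Lemma differentiable_intro (V : normedModType R) (f : V -> R) (df : {linear V -> R})
    (x : V) : continuous df ->
  (forall e : R, 0 < e -> \forall h \near (0 : V), `|f (h + x) - f x - df h| <= e * `|h|) ->
  differentiable f x /\ 'd f x = df :> (V -> R).
Proof.
move=> dfc H.
have eqo : f \o shift x = cst (f x) + df +o_ (0 : V) id.
  apply/eqaddoP => e e0; near=> h.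
  rewrite /= -[X in `|X|]/(f (h + x) - (f x + df h)) opprD addrA.
  by near: h; exact: H.
have dE := diff_unique dfc eqo.
by split => //; apply/diff_locallyP; rewrite dE.
Unshelve. all: by end_near. Qed.

Lemma differentiable_expansion (V : normedModType R) (f : V -> R) (x : V) (e : R) :
  differentiable f x -> 0 < e ->
  \forall y \near x, `|f y - f x - 'd f x (y - x)| <= e * `|y - x|.
Proof.
move=> /diff_locallyP [_ /eqaddoP /(_ _) H] e0.
have /nbhs_ballP[d /= d0 Hd] := H _ e0.
apply/nbhs_ballP; exists d => //= y; rewrite -ball_normE /= => xy.
have := Hd (y - x); rewrite -ball_normE /= sub0r normrN distrC => /(_ xy).
rewrite /= -[X in `|X| <= _ -> _]/(f (y - x + x) - (f x + 'd f x (y - x))).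
by rewrite subrK opprD addrA.
Qed.

Lemma is_derive_line (V : normedModType R) (f : V -> R) (x v : V) (s : R) :
  derivable f (x + s *: v) v ->
  is_derive s (1 : R) (fun t : R => f (x + t *: v)) ('D_v f (x + s *: v)).
Proof.
have E : (fun h : R => h^-1 *: (f (x + (h *: (1 : R) + s) *: v) - f (x + s *: v))) =
         (fun h => h^-1 *: (f (h *: v + (x + s *: v)) - f (x + s *: v))).
  apply/funext => h; rewrite [h *: 1]mulr1 scalerDl.
  by rewrite addrCA.
by move=> df; split; rewrite /derivable /derive /= E.
Qed.

(** Moving from x to x + sum_i c_i b_i one direction at a time, the mean value
    theorem expresses each increment as c_i times a partial derivative at a
    nearby point. The bound is uniform in c, which is what differentiability
    requires. *)
Lemma partials_bound (V : normedModType R) (I : Type) (b : I -> V) (psi : V -> R)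
    (U : set V) (x : V) (s : seq I) (e : R) :
  open U -> U x -> (forall i y, U y -> derivable psi y (b i)) ->
  (forall i, {for x, continuous (fun y => 'D_(b i) psi y)}) -> 0 < e ->
  exists2 d : R, 0 < d & forall c : I -> R, (forall i, `|c i| < d) ->
    `|psi (x + \sum_(i <- s) c i *: b i) - psi x
        - \sum_(i <- s) c i * 'D_(b i) psi x| <= e * \sum_(i <- s) `|c i|.
Proof.
move=> oU Ux dpsi cpsi e0; elim: s => [|i s [d d0 IH]].
  by exists 1 => // c _; rewrite !big_nil addr0 subrr subr0 normr0 mulr0.
have [r /= r0 Hr] : exists2 r : R, 0 < r & forall y, `|y - x| < r ->
    U y /\ `|'D_(b i) psi y - 'D_(b i) psi x| <= e.
  have near1 : \forall y \near x, U y /\ `|'D_(b i) psi y - 'D_(b i) psi x| <= e.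
    have cp : \forall y \near x, `|'D_(b i) psi x - 'D_(b i) psi y| <= e.
      by move/cvgrPdist_le : (cpsi i); exact.
    near=> y; split; first by near: y; exact: open_nbhs_nbhs.
    by rewrite distrC; near: y.
  have /nbhs_ballP[r /= r0 Hr] := near1.
  by exists r => // y xy; apply: Hr; rewrite -ball_normE /= distrC.
pose S := \sum_(j <- i :: s) `|b j|.
have S0 : 0 <= S by rewrite sumr_ge0.
pose d' := Num.min d (r / (S + 1)).
have d'0 : 0 < d' by rewrite lt_min d0 divr_gt0 // ltr_wpDl.
exists d' => // c cd.
have cd1 j : `|c j| < d by rewrite (lt_le_trans (cd j)) // ge_min lexx.
pose y := x + \sum_(j <- s) c j *: b j.
have inball (t : R) : 0 <= t <= 1 -> `|y + (t * c i) *: b i - x| < r.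
  move=> /andP[t0 t1]; rewrite /y addrAC [x + _]addrC addrK.
  rewrite (le_lt_trans (ler_normD _ _)) //.
  apply: (@le_lt_trans _ _ (d' * S)); last first.
    rewrite (@le_lt_trans _ _ (r / (S + 1) * S)) ?ler_wpM2r ?ge_min ?lexx ?orbT //.
    by rewrite mulrAC ltr_pdivrMr ?ltr_wpDl // ltr_pM2l // ltrDl.
  rewrite /S big_cons mulrDr addrC lerD //.
    rewrite normrZ normrM (ger0_norm t0) ler_wpM2r // ltW //.
    by rewrite (le_lt_trans _ (cd i)) // ler_piMl.
  rewrite (le_trans (ler_norm_sum _ _ _)) // mulr_sumr; apply: ler_sum => j _.
  by rewrite normrZ ler_wpM2r // ltW.
have dt (t : R) : 0 <= t <= 1 -> is_derive t (1 : R)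
    (fun t : R => psi (y + (t * c i) *: b i)) ('D_(b i) psi (y + (t * c i) *: b i) * c i).
  move=> t01; apply: (@is_derive1_comp R (fun s => psi (y + s *: b i)) (fun t => t * c i)).
    by apply: is_derive_line; apply: dpsi; have [] := Hr _ (inball t t01).
  by apply: is_derive_eq; rewrite scaler0 add0r /GRing.scale /= mulr1.
have [||t t01] := @MVT R (fun t => psi (y + (t * c i) *: b i))
  (fun t => 'D_(b i) psi (y + (t * c i) *: b i) * c i) 0 1 ltr01.
- by move=> t; rewrite in_itv /= => /andP[t0 t1]; apply: dt; rewrite !ltW.
- apply: derivable_within_continuous => t; rewrite in_itv /= => t01.
  by case: (dt t t01).
rewrite mul1r mul0r scale0r addr0 subr0 mulr1 => Et.
rewrite !big_cons.
have -> : x + (c i *: b i + \sum_(j <- s) c j *: b j) = y + c i *: b i.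
  by rewrite /y [c i *: _ + _]addrC addrA.
set a := psi _ in Et *; set sm := \sum_(j <- s) c j * _.
have -> : a - psi x - (c i * 'D_(b i) psi x + sm) =
   (a - psi y - c i * 'D_(b i) psi x) + (psi y - psi x - sm) by ring.
rewrite (le_trans (ler_normD _ _)) // mulrDr lerD //; last exact: IH.
rewrite Et [c i * _]mulrC -mulrBl normrM ler_wpM2r //.
move: t01; rewrite in_itv /= => /andP[t0 t1].
have t01 : 0 <= t <= 1 by rewrite !ltW.
by have [] := Hr _ (inball t t01).
Unshelve. all: by end_near. Qed.

End Differentiability.

Section C1.
Context {R : realType}.

(** Packages a function with a proof of linearity, to make the theory of linear
    maps available. *)
Lemma linear_of (V W : lmodType R) (f : V -> W) : linear f ->
  {L : {linear V -> W} | L = f :> (V -> W)}.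
Proof.
move=> lf; pose fM := GRing.isLinear.Build _ _ _ _ _ lf.
by exists (HB.pack f fM : {linear V -> W}).
Qed.

(** The differential is required to be continuous jointly in the point and the
    direction, so that composing with a moving direction, such as a velocity
    field, stays continuous. *)
Definition C1 (V : normedModType R) (U : set V) (psi : V -> R) : Prop :=
  forall x, U x -> differentiable psi x /\
    forall v, {for (x, v), continuous (fun p : V * V => 'd psi (p.1) (p.2))}.

Section C1Theory.
Context {V : normedModType R}.
Implicit Types (U : set V) (f g psi : V -> R).

Lemma C1_sub U U' f : U `<=` U' -> C1 U' f -> C1 U f.
Proof. by move=> UU' H x /UU' /H. Qed.

Lemma near_fst (x v : V) (P : set V) : (\forall y \near x, P y) ->
  \forall p \near ((x, v) : V * V), P p.1.
Proof. by move=> nP; apply: (cvg_fst nP). Qed.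

Lemma C1_intro U f (df : V -> V -> R) : open U ->
  (forall x, U x -> differentiable f x /\ 'd f x = df x :> (V -> R)) ->
  (forall x v, U x -> {for (x, v), continuous (fun p : V * V => df p.1 p.2)}) ->
  C1 U f.
Proof.
move=> oU dE dc x Ux; split; first by case: (dE x Ux).
move=> v; apply: near_eq_continuous_at (dc x v Ux); near=> p.
have Up : U p.1 by near: p; apply: near_fst; exact: open_nbhs_nbhs.
by have [_ ->] := dE _ Up.
Unshelve. all: by end_near. Qed.

Lemma C1_cst U (a : R) : open U -> C1 U (cst a).
Proof.
move=> oU; apply: (@C1_intro U (cst a) (fun _ _ => 0)) => // [x _|x v _].
  by split; [exact: differentiable_cst|exact: diff_cst].
exact: cst_continuous.
Qed.

Lemma C1D U f g : open U -> C1 U f -> C1 U g -> C1 U (f \+ g).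
Proof.
move=> oU cf cg.
apply: (@C1_intro U _ (fun x v => 'd f x v + 'd g x v)) => // [x Ux|x v Ux].
  have [df _] := cf x Ux; have [dg _] := cg x Ux.
  split; first exact: (differentiableD df dg).
  exact: (diffD df dg).
have [_ df] := cf x Ux; have [_ dg] := cg x Ux.
exact: (continuousD (df v) (dg v)).
Qed.

Lemma C1M U f g : open U -> C1 U f -> C1 U g -> C1 U (f \* g).
Proof.
move=> oU cf cg.
apply: (@C1_intro U _ (fun x v => f x * 'd g x v + g x * 'd f x v)) => // [x Ux|x v Ux].
  have [df _] := cf x Ux; have [dg _] := cg x Ux.
  split; first exact: (differentiableM df dg).
  exact: (diffM df dg).
have [df0 df] := cf x Ux; have [dg0 dg] := cg x Ux.
have c1 (h : V -> R) : differentiable h x -> {for (x, v), continuous (fun p : V * V => h p.1)}.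
  move=> dh; apply: (@continuous_comp _ _ _ fst h); first exact: cvg_fst.
  exact: differentiable_continuous.
exact: (continuousD (continuousM (c1 _ df0) (dg v)) (continuousM (c1 _ dg0) (df v))).
Qed.

Lemma C1_linear U (L : {linear V -> R}) : open U -> continuous L -> C1 U L.
Proof.
move=> oU cL; apply: (@C1_intro U _ (fun x v => L v)) => // [x Ux|x v Ux].
  by split; [exact: linear_differentiable|exact: diff_lin].
by apply: (@continuous_comp _ _ _ snd L); [exact: cvg_snd|exact: cL].
Qed.

Lemma C1_sum U (I : Type) (s : seq I) (f : I -> V -> R) : open U ->
  (forall i, C1 U (f i)) -> C1 U (fun x => \sum_(i <- s) f i x).
Proof.
move=> oU cf; elim: s => [|i s IH].
  rewrite (_ : (fun _ => _) = cst 0); first exact: C1_cst.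
  by apply/funext => x; rewrite big_nil.
rewrite (_ : (fun _ => _) = f i \+ (fun x => \sum_(j <- s) f j x)).
  exact: (C1D oU (cf i) IH).
by apply/funext => x; rewrite big_cons.
Qed.
End C1Theory.

Lemma C1_comp (V W : normedModType R) (U : set V) (f : V -> R)
    (L : {linear W -> V}) : open U -> continuous L -> C1 U f -> C1 (L @^-1` U) (f \o L).
Proof.
move=> oU cL cf.
have dL y : differentiable L y by exact: linear_differentiable.
apply: (@C1_intro _ _ _ (fun x v => 'd f (L x) (L v))) => [|x Ux|x v Ux].
- by apply: open_comp => // y _; exact: cL.
- have [df c] := cf _ Ux; split; first exact: differentiable_comp.
  by rewrite diff_comp // diff_lin.
have [df c] := cf _ Ux.
apply: (@continuous_comp _ _ _ (fun p : W * W => (L p.1, L p.2))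
  (fun p : V * V => 'd f (p.1) (p.2))); last exact: c.
apply: cvg_pair.
  by apply: (@continuous_comp _ _ _ fst L); [exact: cvg_fst|exact: cL].
by apply: (@continuous_comp _ _ _ snd L); [exact: cvg_snd|exact: cL].
Qed.

(** The candidate differential is the combination of the partial derivatives
    along elementary matrices; these are continuous, so that the mean value
    estimate along coordinates makes it the Frechet differential, jointly
    continuous in point and direction. *)
Lemma class_C1 (p q : nat) (U : set 'M[R]_(p, q)) (psi : 'M[R]_(p, q) -> R) :
  open U -> class_C 1 U psi -> C1 U psi.
Proof.
move=> oU [_ Cpsi].
have dpsi v y : U y -> derivable psi y v by case: (Cpsi v) => + _; exact.
have cpsi v y : U y -> {for y, continuous (fun y => 'D_v psi y)}.
  by case: (Cpsi v) => _ [+ _]; exact.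
pose D x (ij : 'I_p * 'I_q) := 'D_(delta_mx ij.1 ij.2) psi x.
pose L x (h : 'M[R]_(p, q)) := \sum_ij h ij.1 ij.2 * D x ij.
have linL x : linear (L x).
  move=> a u v; rewrite /L scaler_sumr -big_split; apply: eq_bigr => ij _.
  by rewrite !mxE mulrDl /GRing.scale /= mulrA.
apply: (@C1_intro _ _ _ L) => // [x Ux|x v Ux].
  have [LL LE] := linear_of (linL x); rewrite -LE.
  apply: differentiable_intro; first exact: linear_mx_continuous.
  move=> e e0.
  pose K : R := #|{: 'I_p * 'I_q}|%:R + 1.
  have K0 : 0 < K by rewrite ltr_wpDl.
  have [|||d d0 Hd] := @partials_bound R _ _ (fun ij : 'I_p * 'I_q => delta_mx ij.1 ij.2)
    psi U x (index_enum _) (e / K) oU Ux.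
  - by move=> ij y Uy; exact: dpsi.
  - by move=> ij; exact: cpsi.
  - by rewrite divr_gt0.
  near=> h.
  have hd ij : `|h ij.1 ij.2| < d.
    apply: le_lt_trans (ler_mx_entry _ _ _) _.
    near: h; have H := @pseudometric_normed_Zmodule.nbhs0_lt _ ('M[R]_(p, q)) d d0.
    by apply H.
  have := Hd (fun ij => h ij.1 ij.2) hd.
  have -> : \sum_ij h ij.1 ij.2 *: delta_mx ij.1 ij.2 = h.
    by rewrite [RHS]matrix_sum_delta pair_bigA.
  rewrite [h + x]addrC LE /L => Hh; apply: (le_trans Hh).
  apply: (@le_trans _ _ (e / K * (K * `|h|))); last by rewrite mulrA divfK ?gt_eqF.
  apply: ler_wpM2l; first by rewrite divr_ge0 // ltW.
  rewrite /K mulrDl mul1r ler_wpDr // mulr_natl -sumr_const.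
  by apply: ler_sum => ij _; exact: ler_mx_entry.
rewrite /L; apply: cvg_big => [|ij _]; first exact: add_continuous.
apply: cvgM.
  apply: (@continuous_comp _ _ _ snd (fun h : 'M[R]_(p, q) => h ij.1 ij.2)).
    exact: cvg_snd.
  exact: coord_continuous.
apply: (@continuous_comp _ _ _ fst (fun y => D y ij)); first exact: cvg_fst.
exact: cpsi.
Unshelve. all: by end_near. Qed.

End C1.

(** * Differentiation along right translations of a subset *)

Section Flow.
Context {R : realType}.

(** A function on the group is only determined by its values on H; a local
    C^1 extension gives access to its differential. *)
Definition C1_near (V : normedModType R) (H : set V) (x0 : V) (phi : V -> R) : Prop :=
  exists (U : set V) (psi : V -> R),
    [/\ open U, U x0, C1 U psi & forall x, U x -> H x -> psi x = phi x].

(** Right translation by one-parameter subgroups, in the abstract: upd x z is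
    the point reached from x in the direction z, and the curve t |-> upd x (t
    z) solves the equation with velocity field vel, which is linear in the
    direction. *)
Definition is_flow (V : normedModType R) (k : nat) (H : set V)
    (upd vel : V -> 'cV[R]_k -> V) : Prop :=
  [/\ forall x z, H x -> H (upd x z),
      forall x, H x -> upd x 0 = x,
      forall x z (t : R), H x ->
        is_derive t (1 : R) (fun t : R => upd x (t *: z)) (vel (upd x (t *: z)) z),
      forall x, linear (vel x) &
      forall z, continuous (fun x => vel x z)].

(** The common form of the gradient on tuples and of the rows of the
    sensitivity matrix on primal-dual pairs. *)
Definition sens (V : normedModType R) (k : nat) (upd : V -> 'cV[R]_k -> V)
    (phi : V -> R) (x : V) : 'rV[R]_k :=
  \row_c derive1 (fun eps : R => phi (upd x (eps *: delta_mx c 0))) 0.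

Lemma is_derive_continuous (V : normedModType R) (g : R -> V) (t : R) (w : V) :
  is_derive t (1 : R) g w -> {for t, continuous g}.
Proof.
by move=> [dg _]; apply: differentiable_continuous; apply/derivable1_diffP.
Qed.

Lemma is_derive_diff_comp (V : normedModType R) (g : R -> V) (f : V -> R) (t : R) (w : V) :
  differentiable f (g t) -> is_derive t (1 : R) g w ->
  is_derive t (1 : R) (fun s => f (g s)) ('d f (g t) w).
Proof.
move=> df [dg gw]; have dg' : differentiable g t by apply/derivable1_diffP.
have dfg : differentiable (f \o g) t by exact: differentiable_comp.
split; first by apply/derivable1_diffP.
rewrite (deriveE _ dfg) diff_comp //=; congr ('d f (g t) _).
by rewrite -deriveE.
Qed.

Section FlowTheory.
Context {V : normedModType R} {k : nat} (H : set V) (upd vel : V -> 'cV[R]_k -> V).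

(** Both functions agree on the curve near 0, as the curve stays in H and
    starts inside the open set where they coincide on H. *)
Lemma is_derive_flow U psi (phi : V -> R) (x : V) (z : 'cV[R]_k) :
  is_flow H upd vel -> open U -> C1 U psi ->
  (forall x, U x -> H x -> psi x = phi x) -> U x -> H x ->
  is_derive 0 (1 : R) (fun e : R => phi (upd x (e *: z))) ('d psi x (vel x z)).
Proof.
move=> [Hupd upd0 dupd _ _] oU cU pp Ux Hx.
have dc := dupd x z 0 Hx; rewrite scale0r upd0 // in dc.
have [dpsi _] := cU x Ux.
have dpsi' : is_derive 0 (1 : R) (fun e : R => psi (upd x (e *: z))) ('d psi x (vel x z)).
  have := @is_derive_diff_comp V (fun e : R => upd x (e *: z)) psi 0 (vel x z).
  by rewrite scale0r upd0 //; apply.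
apply: near_eq_is_derive dpsi'.
have Uc : \forall e \near (0 : R), U (upd x (e *: z)).
  apply: (is_derive_continuous dc); rewrite scale0r upd0 //.
  exact: open_nbhs_nbhs.
by near=> e; apply: pp; [near: e|exact: Hupd].
Unshelve. all: by end_near. Qed.

(** Turns the row of derivatives along basis directions into a genuine linear
    form: the differential of the extension psi is linear in the velocity,
    which is itself linear in z. *)
Lemma sens_diff U psi (phi : V -> R) (x : V) (z : 'cV[R]_k) :
  is_flow H upd vel -> open U -> C1 U psi ->
  (forall x, U x -> H x -> psi x = phi x) -> U x -> H x ->
  (sens upd phi x *m z) 0 0 = 'd psi x (vel x z).
Proof.
move=> fl oU cU pp Ux Hx; have [_ _ _ lvel _] := fl.
have [L LE] := linear_of (lvel x).
have zE : z = \sum_c z c 0 *: delta_mx c 0.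
  rewrite {1}[z]matrix_sum_delta; apply: eq_bigr => c _.
  by rewrite big_ord_recl big_ord0 addr0.
rewrite {2}zE -LE linear_sum linear_sum mxE; apply: eq_bigr => c _.
rewrite !linearZ /= mxE derive1E mulrC; congr (_ * _); rewrite LE.
have D := @is_derive_flow U psi phi x (delta_mx c 0) fl oU cU pp Ux Hx.
exact: derive_val.
Qed.

Lemma is_derive_sens (phi : V -> R) (x : V) (z : 'cV[R]_k) :
  is_flow H upd vel -> H x -> C1_near H x phi ->
  is_derive 0 (1 : R) (fun e : R => phi (upd x (e *: z))) ((sens upd phi x *m z) 0 0).
Proof.
move=> fl Hx [U [psi [oU Ux cU pp]]].
by rewrite (sens_diff _ fl oU cU pp Ux Hx); exact: is_derive_flow pp Ux Hx.
Qed.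

Lemma sens_continuous (phi : V -> R) (x0 : V) c (e : R) :
  is_flow H upd vel -> H x0 -> C1_near H x0 phi -> 0 < e ->
  \forall x \near x0, H x -> `|sens upd phi x 0 c - sens upd phi x0 0 c| <= e.
Proof.
move=> fl Hx0 [U [psi [oU Ux cU pp]]] e0; have [_ _ _ _ cvel] := fl.
have sE x : U x -> H x -> sens upd phi x 0 c = 'd psi x (vel x (delta_mx c 0)).
  move=> Ux' Hx; rewrite -(sens_diff _ fl oU cU pp Ux' Hx).
  by rewrite -colE [RHS]mxE.
have cc : {for x0, continuous (fun x => 'd psi x (vel x (delta_mx c 0)))}.
  have [_ /(_ (vel x0 (delta_mx c 0))) cd] := cU x0 Ux.
  apply: (@continuous_comp _ _ _ (fun x => (x, vel x (delta_mx c 0)))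
    (fun p : V * V => 'd psi (p.1) (p.2))) => //.
  by apply: cvg_pair; [exact: cvg_id|exact: cvel].
have nU : \forall x \near x0, U x by exact: open_nbhs_nbhs.
have ncc := (cvgrPdist_le _ _).1 cc _ e0; near=> x => Hx.
rewrite sE //; last by (near: x; exact nU).
rewrite sE // distrC; near: x.
exact (ncc _).
Unshelve. all: by end_near. Qed.

Lemma C1_near_lip (phi : V -> R) (x0 : V) :
  H x0 -> C1_near H x0 phi ->
  exists M : R, \forall x \near x0, H x -> `|phi x - phi x0| <= M * `|x - x0|.
Proof.
move=> Hx0 [U [psi [oU Ux cU pp]]]; have [dpsi _] := cU x0 Ux.
have [K K0 HK] := linear_lipschitz (diff_continuous dpsi).
exists (K + 1).
have := differentiable_expansion dpsi (@ltr01 R).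
have nU : \forall x \near x0, U x by exact: open_nbhs_nbhs.
move=> nd; near=> x => Hx; rewrite -(pp x0) // -(pp x) //; last by (near: x; exact nU).
rewrite -(subrK ('d psi x0 (x - x0)) (psi x - psi x0)) addrC mulrDl.
rewrite (le_trans (ler_normD _ _)) // lerD //.
by near: x; exact nd.
Unshelve. all: by end_near. Qed.

(** Mean value theorem along t |-> upd x (t z). Its derivative at time th is
    again a value of sens, at the intermediate point and with the same
    direction z, because the velocity of the curve depends only on the current
    point. The displacement bound keeps the curve inside the domain of the
    extension. *)
Lemma sens_mvt (phi : V -> R) (x0 : V) (K r0 : R) :
  is_flow H upd vel -> H x0 -> C1_near H x0 phi -> 0 < r0 -> 0 < K ->
  (forall x z, H x -> `|x - x0| < r0 -> `|z| < r0 -> `|upd x z - x| <= K * `|z|) ->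
  exists2 r : R, 0 < r & forall x z, H x -> `|x - x0| < r -> `|z| < r ->
    exists2 th : R, 0 < th < 1 &
      phi (upd x z) - phi x = (sens upd phi (upd x (th *: z)) *m z) 0 0.
Proof.
move=> fl Hx0 [U [psi [oU Ux0 cU pp]]] r00 K0 HK; have [Hupd upd0 dupd _ _] := fl.
have /nbhs_ballP[d /= d0 Hd] : nbhs x0 U by exact: open_nbhs_nbhs.
exists (Num.min r0 (d / (K + 1))); first by rewrite lt_min r00 divr_gt0 // addr_gt0.
move=> x z Hx; rewrite !lt_min => /andP[xr xd] /andP[zr zd].
have inU (t : R) : 0 <= t <= 1 -> U (upd x (t *: z)).
  move=> /andP[t0 t1]; apply: Hd; rewrite -ball_normE /= distrC.
  have tz : `|t *: z| <= `|z| by rewrite normrZ ger0_norm // ler_piMl.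
  rewrite -(subrK x (upd x _)) -addrA (le_lt_trans (ler_normD _ _)) //.
  have h1 : `|upd x (t *: z) - x| <= K * (d / (K + 1)).
    rewrite (le_trans (HK _ _ Hx xr _)) ?(le_lt_trans tz) //.
    by rewrite ler_wpM2l ?ltW // (le_lt_trans tz).
  rewrite (lt_le_trans (ler_ltD h1 xd)) // -[X in _ + X]mul1r -mulrDl.
  by rewrite mulrC divfK // gt_eqF // addr_gt0.
have dpsi (t : R) : 0 <= t <= 1 -> is_derive t (1 : R) (fun t : R => psi (upd x (t *: z)))
    ('d psi (upd x (t *: z)) (vel (upd x (t *: z)) z)).
  move=> t01; have [dp _] := cU _ (inU t t01).
  exact: (is_derive_diff_comp dp (dupd x z t Hx)).
have [||t t01] := @MVT R (fun t => psi (upd x (t *: z)))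
  (fun t => 'd psi (upd x (t *: z)) (vel (upd x (t *: z)) z)) 0 1 ltr01.
- by move=> t; rewrite in_itv /= => /andP[t0 t1]; apply: dpsi; rewrite !ltW.
- apply: derivable_within_continuous => t; rewrite in_itv /= => t01.
  by case: (dpsi t t01).
move: t01; rewrite in_itv /= => /andP[t0 t1]; rewrite subr0 mulr1 scale1r scale0r upd0 //.
have U0 : U x by have := inU 0; rewrite scale0r upd0 //; apply; rewrite lexx ler01.
have U1 : U (upd x z) by have := inU 1; rewrite scale1r; apply; rewrite ler01 lexx.
have Ut : U (upd x (t *: z)) by apply: inU; rewrite !ltW.
rewrite !pp // ?Hupd //; last exact: Hupd.
move=> ->; exists t; first by rewrite t0.
by rewrite (sens_diff _ fl oU cU pp Ut) //; exact: Hupd.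
Qed.
End FlowTheory.
End Flow.

Section C1NearTheory.
Context {R : realType} {V : normedModType R} (H : set V).
Implicit Types (f g phi : V -> R) (x : V).

Lemma C1_near_ext f g x : (forall y, H y -> f y = g y) -> C1_near H x f -> C1_near H x g.
Proof.
move=> fg [U [psi [oU Ux cU pp]]]; exists U, psi; split => // y Uy Hy.
by rewrite pp // fg.
Qed.

Lemma C1_near_cst x (a : R) : C1_near H x (fun=> a).
Proof. by exists setT, (cst a); split => //; [exact: openT|apply: C1_cst; exact: openT]. Qed.

Lemma C1_near_linear x (L : {linear V -> R}) : continuous L -> C1_near H x L.
Proof.
move=> cL; exists setT, L; split => //; first exact: openT.
by apply: C1_linear => //; exact: openT.
Qed.

Lemma C1_nearD x f g : C1_near H x f -> C1_near H x g -> C1_near H x (fun y => f y + g y).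
Proof.
move=> [U [p [oU Ux cp pf]]] [U' [q [oU' Ux' cq qg]]].
exists (U `&` U'), (p \+ q); split; [exact: openI|by []| |].
  by apply: C1D; [exact: openI|apply: C1_sub cp => y []|apply: C1_sub cq => y []].
by move=> y [Uy Uy'] Hy /=; rewrite pf // qg.
Qed.

Lemma C1_nearM x f g : C1_near H x f -> C1_near H x g -> C1_near H x (fun y => f y * g y).
Proof.
move=> [U [p [oU Ux cp pf]]] [U' [q [oU' Ux' cq qg]]].
exists (U `&` U'), (p \* q); split; [exact: openI|by []| |].
  by apply: C1M; [exact: openI|apply: C1_sub cp => y []|apply: C1_sub cq => y []].
by move=> y [Uy Uy'] Hy /=; rewrite pf // qg.
Qed.

Lemma C1_near_sum x (I : Type) (s : seq I) (f : I -> V -> R) :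
  (forall i, C1_near H x (f i)) -> C1_near H x (fun y => \sum_(i <- s) f i y).
Proof.
move=> Hf; elim: s => [|i s IH].
  by under eq_fun do rewrite big_nil; exact: C1_near_cst.
by under eq_fun do rewrite big_cons; exact: C1_nearD.
Qed.
End C1NearTheory.

Lemma C1_near_comp (R : realType) (V W : normedModType R) (H : set V) (H' : set W)
    (L : {linear W -> V}) (f : V -> R) (y : W) : continuous L ->
  (forall z, H' z -> H (L z)) -> C1_near H (L y) f -> C1_near H' y (f \o L).
Proof.
move=> cL HH [U [psi [oU Ux cU pp]]]; exists (L @^-1` U), (psi \o L); split => //.
- by apply: open_comp => // z _; exact: cL.
- exact: C1_comp.
- by move=> z Uz /HH Hz /=; exact: pp.
Qed.

Lemma sens_is_derive (R : realType) (V : normedModType R) k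
    (upd : V -> 'cV[R]_k -> V) (phi : V -> R) x c D :
  is_derive 0 (1 : R) (fun e : R => phi (upd x (e *: delta_mx c 0))) D ->
  sens upd phi x 0 c = D.
Proof. by move=> dphi; rewrite mxE derive1E; exact: derive_val. Qed.

Lemma is_derive_unique (R : realType) (V : normedModType R) (f : R -> V) (t : R) D D' :
  is_derive t (1 : R) f D -> is_derive t (1 : R) f D' -> D = D'.
Proof. by move=> [_ <-] [_ <-]. Qed.

Section LipschitzAt.
Context {R : realType} {V : normedModType R} (H : set V) (x0 : V).
Implicit Types q : V -> R.

(** Lipschitz only with respect to the centre x0: both the hypothesis on the
    curvature and the quadratic estimate compare with Xs alone. *)
Definition lip_at q := exists2 M : R, 0 <= M &
  \forall x \near x0, H x -> `|q x - q x0| <= M * `|x - x0|.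

Lemma lip_at_intro q (M : R) :
  (\forall x \near x0, H x -> `|q x - q x0| <= M * `|x - x0|) -> lip_at q.
Proof.
move=> HM; exists `|M| => //; apply: filterS HM => x + Hx => /(_ Hx) qM.
by rewrite (le_trans qM) // ler_wpM2r // ler_norm.
Qed.

Lemma lip_at_ext q q' : H x0 -> (forall x, H x -> q x = q' x) -> lip_at q -> lip_at q'.
Proof.
move=> Hx0 qq' [M M0 HM]; exists M => //; apply: filterS HM => x + Hx => /(_ Hx).
by rewrite !qq'.
Qed.

Lemma lip_at_C1 q : H x0 -> C1_near H x0 q -> lip_at q.
Proof. by move=> Hx0 /(C1_near_lip Hx0)[M HM]; exact: lip_at_intro HM. Qed.

Lemma lip_at_cst (a : R) : lip_at (fun=> a).
Proof. by exists 0 => //; apply: filterE => x _; rewrite subrr normr0 mul0r. Qed.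

Lemma lip_atD q q' : lip_at q -> lip_at q' -> lip_at (fun x => q x + q' x).
Proof.
move=> [M M0 HM] [M' M'0 HM']; exists (M + M'); first exact: addr_ge0.
apply: filterS2 HM HM' => x qx qx' Hx.
rewrite opprD addrACA (le_trans (ler_normD _ _)) // mulrDl lerD //; [exact: qx|exact: qx'].
Qed.

Lemma lip_atMl (a : R) q : lip_at q -> lip_at (fun x => a * q x).
Proof.
move=> [M M0 HM]; exists (`|a| * M); first exact: mulr_ge0.
apply: filterS HM => x qx Hx; rewrite -mulrBr normrM -mulrA ler_wpM2l //.
exact: qx.
Qed.

Lemma lip_at_sum (I : Type) (s : seq I) (q : I -> V -> R) :
  (forall i, lip_at (q i)) -> lip_at (fun x => \sum_(i <- s) q i x).
Proof.
move=> Hq; elim: s => [|i s IH].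
  by under eq_fun do rewrite big_nil; exact: lip_at_cst.
by under eq_fun do rewrite big_cons; exact: lip_atD.
Qed.

(** A factor that vanishes at x0 supplies the Lipschitz bound, so the other
    factor only has to be bounded. *)
Lemma lip_at_mul_bounded q b (B : R) : q x0 = 0 -> lip_at q ->
  (\forall x \near x0, H x -> `|b x| <= B) -> lip_at (fun x => q x * b x).
Proof.
move=> q0 [M M0 HM] HB; apply: (@lip_at_intro _ (M * B)).
apply: filterS2 HM HB => x qx bx Hx; rewrite q0 mul0r subr0 normrM.
have := qx Hx; rewrite q0 subr0 => qM.
rewrite (@le_trans _ _ (M * `|x - x0| * B)) //; last by rewrite mulrAC.
by apply: ler_pM => //; exact: bx.
Qed.
End LipschitzAt.

(** * Tuples of group elements and primal-dual pairs *)

Section Tuples.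
Context {R : realType} {n N m : nat}.
Implicit Types (Y : mxtuple R n N).

Lemma entry_mktuple (A : 'I_n -> 'M[R]_N) i : entry (Defs.mktuple A) i = A i.
Proof. by rewrite /entry /Defs.mktuple rowK mxvecK. Qed.

Lemma mktuple_entry Y : Defs.mktuple (entry Y) = Y.
Proof. by apply/row_matrixP => i; rewrite rowK vec_mxK. Qed.

Lemma entryE Y i a b : entry Y i a b = Y i (mxvec_index a b).
Proof. by rewrite mxE mxE. Qed.

Lemma entryP Y Y' : (forall i, entry Y i = entry Y' i) -> Y = Y'.
Proof.
by move=> YY; rewrite -(mktuple_entry Y) -(mktuple_entry Y'); congr Defs.mktuple; apply/funext.
Qed.

Lemma entry_linear i : linear (fun Y => entry Y i).
Proof. by move=> a u v; apply/matrixP => p q; rewrite !entryE !mxE -!entryE. Qed.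

Lemma is_derive_tuple (V : normedModType R) (g : V -> mxtuple R n N) (t v : V) D :
  (forall i, is_derive t v (fun s => entry (g s) i) (entry D i)) -> is_derive t v g D.
Proof.
move=> H; apply: is_derive_mx => i j; case/mxvec_indexP : j => a b.
rewrite -entryE (_ : (fun s => _) = fun s => entry (g s) i a b); last first.
  by apply/funext => s; rewrite entryE.
exact: is_derive_mx_entry.
Qed.

Definition block (z : 'cV[R]_(n * m)) (i : 'I_n) : 'cV[R]_m :=
  \col_a z (mxvec_index i a) 0.

Lemma block_linear i : linear (fun z => block z i).
Proof. by move=> a u v; apply/matrixP => p q; rewrite !mxE. Qed.

Lemma blockZ (a : R) z i : block (a *: z) i = a *: block z i.
Proof. by apply/matrixP => p q; rewrite !mxE. Qed.

Lemma block0 i : block 0 i = 0.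
Proof. by apply/matrixP => p q; rewrite !mxE. Qed.

Lemma block_delta i a k :
  block (delta_mx (mxvec_index i a) 0) k = if k == i then delta_mx a 0 else 0.
Proof.
apply/matrixP => p q; rewrite !mxE ord1 eqxx andbT.
have -> : (mxvec_index k p == mxvec_index i a) = (k == i) && (p == a).
  apply/eqP/andP => [|[/eqP-> /eqP->]//].
  by move=> /(f_equal (fun x => enum_val (cast_ord (esym (mxvec_cast n m)) x)));
    rewrite /mxvec_index !cast_ordK !enum_rankK => -[-> ->].
by case: eqP => _; rewrite !mxE ?eqxx ?andbT.
Qed.

Context (S : {linear 'cV[R]_m -> 'M[R]_N}).

Definition tuple_update Y (z : 'cV[R]_(n * m)) : mxtuple R n N :=
  Defs.mktuple (fun i => entry Y i *m expmx (S (block z i))).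

Definition tuple_velocity Y (z : 'cV[R]_(n * m)) : mxtuple R n N :=
  Defs.mktuple (fun i => entry Y i *m S (block z i)).

Lemma tuple_update_entry Y z i (t : R) :
  entry (tuple_update Y (t *: z)) i = entry Y i *m expmx (t *: S (block z i)).
Proof. by rewrite entry_mktuple blockZ linearZ. Qed.

Lemma is_derive_tuple_update Y z (t : R) :
  is_derive t (1 : R) (fun t : R => tuple_update Y (t *: z))
    (tuple_velocity (tuple_update Y (t *: z)) z).
Proof.
apply: is_derive_tuple => i.
rewrite (_ : (fun s => _) = fun s : R => entry Y i *m expmx (s *: S (block z i))); last first.
  by apply/funext => s; rewrite tuple_update_entry.
rewrite entry_mktuple tuple_update_entry -mulmxA.
have := is_derive_mulmx (is_derive_cst (entry Y i) t (1 : R))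
  (is_derive_expmx (S (block z i)) t).
by rewrite mul0mx add0r.
Qed.

Lemma tuple_velocity_linearl z : linear (fun Y => tuple_velocity Y z).
Proof.
move=> a u v; apply: entryP => i.
by rewrite entry_linear !entry_mktuple entry_linear mulmxDl scalemxAl.
Qed.

Lemma tuple_velocity_linearr Y : linear (tuple_velocity Y).
Proof.
move=> a u v; apply: entryP => i.
by rewrite entry_linear !entry_mktuple block_linear linearP mulmxDr scalemxAr.
Qed.

Lemma tuple_update0 Y : tuple_update Y 0 = Y.
Proof.
by apply: entryP => i; rewrite entry_mktuple block0 linear0 expmx_0 mulmx1.
Qed.

Lemma continuous_tuple_velocity z : continuous (fun Y => tuple_velocity Y z).
Proof.
have [L <-] := linear_of (tuple_velocity_linearl z).
exact: linear_mx_continuous.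
Qed.

Lemma in_group_tuple_update (G : set 'M[R]_N) Y z :
  matrix_lie_group G -> (forall zeta, lie_algebra G (S zeta)) ->
  in_group G Y -> in_group G (tuple_update Y z).
Proof.
move=> [_ _ GM _ _] GS GY i; rewrite entry_mktuple; apply: GM => //.
by have := GS (block z i) 1; rewrite scale1r.
Qed.

Lemma tuple_is_flow (G : set 'M[R]_N) :
  matrix_lie_group G -> (forall zeta, lie_algebra G (S zeta)) ->
  is_flow (in_group G) tuple_update tuple_velocity.
Proof.
move=> Ggrp GS; split.
- by move=> Y z; exact: in_group_tuple_update.
- by move=> Y _; exact: tuple_update0.
- by move=> Y z t _; exact: is_derive_tuple_update.
- exact: tuple_velocity_linearr.
- exact: continuous_tuple_velocity.
Qed.

Lemma set_entry_update Y i a (e : R) :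
  set_entry Y i (entry Y i *m expmx (e *: S (delta_mx a 0))) =
  tuple_update Y (e *: delta_mx (mxvec_index i a) 0).
Proof.
apply: entryP => k; rewrite tuple_update_entry entry_mktuple block_delta.
by case: eqP => [->//|_]; rewrite linear0 scaler0 expmx_0 mulmx1.
Qed.

(** The coordinate of index (i, a) moves only the i-th entry of a tuple, so the
    blockwise gradient is the row of derivatives along the update of whole
    tuples. *)
Lemma grad_sens (phi : mxtuple R n N -> R) Y : grad S phi Y = sens tuple_update phi Y.
Proof.
apply/rowP => c; case/mxvec_indexP : c => i a.
rewrite mxvecE !mxE; congr (derive1 _ 0); apply/funext => e.
by rewrite set_entry_update.
Qed.

Lemma C2_C1_near (G : set 'M[R]_N) (phi : mxtuple R n N -> R) Y :
  C2_on_group G phi -> in_group G Y -> C1_near (in_group G) Y phi.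
Proof.
move=> C2 /C2[U [psi [oU UY [cpsi dpsi] pp]]]; exists U, psi; split=> //.
apply: class_C1 => //; split=> // v; have [dv [cv _]] := dpsi v.
by split=> //; split.
Qed.

(** In coordinates the gradient of phi is a sum of entries of the velocity,
    linear in Y, times first partial derivatives of the extension of phi, which
    are again of class C^1. *)
Lemma grad_C1_near (G : set 'M[R]_N) (phi : mxtuple R n N -> R) Y c :
  matrix_lie_group G -> (forall zeta, lie_algebra G (S zeta)) ->
  C2_on_group G phi -> in_group G Y ->
  C1_near (in_group G) Y (fun Y' => grad S phi Y' 0 c).
Proof.
move=> Ggrp GS C2 /C2[U [psi [oU UY Cpsi pp]]].
have Cpsi1 : C1 U psi.
  apply: class_C1 => //; have [cpsi dpsi] := Cpsi.
  by split=> // v; have [dv [cv _]] := dpsi v; split=> //; split.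
pose D := delta_mx c 0 : 'cV[R]_(n * m).
exists U, (fun Y => \sum_(i < n) \sum_(j < N * N)
  tuple_velocity Y D i j * 'D_(delta_mx i j) psi Y).
split; [exact: oU|exact: UY| |].
  apply: C1_sum; [exact: oU|move=> i].
  apply: C1_sum; [exact: oU|move=> j].
  apply: C1M; first exact: oU.
    have lin : linear (fun Y => tuple_velocity Y D i j).
      by move=> a u v; rewrite tuple_velocity_linearl !mxE.
    have [L <-] := linear_of lin.
    by apply: C1_linear => //; exact: linear_mx_continuous.
  by apply: class_C1 => //; have [_ /(_ (delta_mx i j)) []] := Cpsi.
move=> Y' UY' GY'; have [dpsi _] := Cpsi1 _ UY'.
rewrite grad_sens; have := @sens_diff _ _ _ _ _ _ U psi phi Y' D
  (tuple_is_flow Ggrp GS) oU Cpsi1 pp UY' GY'.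
rewrite -colE [LHS]mxE => ->.
rewrite [in RHS](matrix_sum_delta (tuple_velocity Y' D)) linear_sum.
apply: eq_bigr => i _; rewrite linear_sum; apply: eq_bigr => j _.
by rewrite linearZ deriveE.
Qed.
End Tuples.

Section Pairs.
Context {R : realType} {n N m n1 n2 : nat}.
Context (S : {linear 'cV[R]_m -> 'M[R]_N}).
Local Notation point := (pd_type R n N n1 n2).
Local Notation d := (pd_dim n1 n2).
Implicit Types (X : point) (w : 'cV[R]_(n * m + d)).

Definition pd_velocity X w : point :=
  (tuple_velocity S X.1 (usubmx w), X.2 *m trans_alg (dsubmx w)).

(** Unlike primal-dual points, slacks may have any sign here; this makes the
    set invariant under all updates. *)
Definition pd_group (G : set 'M[R]_N) : set point :=
  [set X | in_group G X.1 /\ range (@trans_mx R d) X.2].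

Lemma trans_mxM (k : nat) (z z' : 'cV[R]_k) : trans_mx z *m trans_mx z' = trans_mx (z + z').
Proof.
rewrite /trans_mx mulmx_block !mulmx0 !mul0mx !mulmx1 !mul1mx addr0 add0r.
by rewrite add0r addrC.
Qed.

Lemma trans_algZ (k : nat) (a : R) (z : 'cV[R]_k) : trans_alg (a *: z) = a *: trans_alg z.
Proof. by rewrite /trans_alg scale_block_mx !scaler0. Qed.

Lemma trans_alg_linear (k : nat) : linear (@trans_alg R k).
Proof.
move=> a u v; rewrite /trans_alg scale_block_mx !scaler0 add_block_mx.
by rewrite !addr0.
Qed.

Lemma pd_updateE X w : pd_update S X w =
  (tuple_update S X.1 (usubmx w), X.2 *m trans_mx (dsubmx w)).
Proof. by rewrite /pd_update expmx_trans. Qed.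

Lemma pd_group_update (G : set 'M[R]_N) X w :
  matrix_lie_group G -> (forall zeta, lie_algebra G (S zeta)) ->
  pd_group G X -> pd_group G (pd_update S X w).
Proof.
move=> Ggrp GS [GX [z _ zX]]; rewrite pd_updateE; split=> /=.
  exact: in_group_tuple_update.
by exists (z + dsubmx w) => //; rewrite -trans_mxM zX.
Qed.

Lemma ursubmx_pd_update (G : set 'M[R]_N) X w : pd_group G X ->
  ursubmx (pd_update S X w).2 = ursubmx X.2 + dsubmx w.
Proof.
move=> [_ [z _ zX]]; rewrite pd_updateE /= -zX trans_mxM.
by rewrite !block_mxKur.
Qed.

Lemma pd_velocity_linear X : linear (pd_velocity X).
Proof.
move=> a u v; rewrite /pd_velocity !linearP /= tuple_velocity_linearr.
by rewrite trans_alg_linear mulmxDr -scalemxAr.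
Qed.

Lemma continuous_pd_velocity w : continuous (fun X => pd_velocity X w).
Proof.
move=> X.
have c1 : {for X, continuous (fun X : point => tuple_velocity S X.1 (usubmx w))}.
  apply: (@continuous_comp _ _ _ fst (fun Y => tuple_velocity S Y (usubmx w))).
    exact: cvg_fst.
  exact: continuous_tuple_velocity.
have c2 : {for X, continuous (fun X : point => X.2 *m trans_alg (dsubmx w))}.
  apply: (@continuous_comp _ _ _ snd (mulmxr (trans_alg (dsubmx w)))).
    exact: cvg_snd.
  exact: linear_mx_continuous.
exact: (cvg_pair c1 c2).
Qed.

Lemma pd_is_flow (G : set 'M[R]_N) :
  matrix_lie_group G -> (forall zeta, lie_algebra G (S zeta)) ->
  is_flow (pd_group G) (pd_update S) pd_velocity.
Proof.
move=> Ggrp GS; split.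
- by move=> X w; exact: pd_group_update.
- move=> X _; rewrite [RHS]surjective_pairing /pd_update /=.
  congr pair.
    rewrite -[RHS](tuple_update0 S); congr (tuple_update S X.1 _).
    by rewrite linear0.
  by rewrite linear0 -[0](scale0r (0 : 'cV[R]_d)) trans_algZ scale0r expmx_0 mulmx1.
- move=> X w t _; apply: is_derive_pair => /=.
    rewrite (_ : (fun s => _) = fun s : R => tuple_update S X.1 (s *: usubmx w)); last first.
      by apply/funext => s; rewrite /tuple_update linearZ.
    by rewrite /= linearZ; exact: is_derive_tuple_update.
  rewrite (_ : (fun s => _) = fun s : R => X.2 *m expmx (s *: trans_alg (dsubmx w))); last first.
    by apply/funext => s; rewrite linearZ /= trans_algZ.
  rewrite linearZ /= trans_algZ -mulmxA.
  have := is_derive_mulmx (is_derive_cst X.2 t (1 : R))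
    (is_derive_expmx (trans_alg (dsubmx w)) t).
  by rewrite mul0mx add0r.
- exact: pd_velocity_linear.
- exact: continuous_pd_velocity.
Qed.

(** The first n m columns move the tuple and leave Z unchanged, the others move
    Z and leave the tuple unchanged; both are coordinate directions of the
    joint update. *)
Lemma pd_sensitivityE l (phi : point -> 'cV[R]_l) X j c :
  pd_sensitivity S phi X j c = sens (pd_update S) (fun X => phi X j 0) X 0 c.
Proof.
have updl (c' : 'I_(n * m)) (e : R) : pd_update S X (e *: delta_mx (lshift d c') 0) =
    (tuple_update S X.1 (e *: delta_mx c' 0), X.2).
  have usub : usubmx (e *: delta_mx (lshift d c') 0 : 'cV[R]_(n * m + d)) = e *: delta_mx c' 0.
    by apply/matrixP => a b; rewrite !mxE eq_lshift.
  have dsub : dsubmx (e *: delta_mx (lshift d c') 0 : 'cV[R]_(n * m + d)) = 0.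
    by apply/matrixP => a b; rewrite !mxE eq_rlshift mulr0.
  have trans0 : trans_mx (0 : 'cV[R]_d) = 1%:M by rewrite /trans_mx -scalar_mx_block.
  by rewrite pd_updateE usub dsub trans0 mulmx1.
have updr (c' : 'I_d) (e : R) : pd_update S X (e *: delta_mx (rshift (n * m) c') 0) =
    (X.1, X.2 *m expmx (e *: trans_alg (delta_mx c' 0))).
  rewrite /pd_update; congr pair.
    rewrite -[RHS](tuple_update0 S); congr (tuple_update S X.1 _).
    by apply/matrixP => a b; rewrite !mxE eq_lrshift mulr0.
  rewrite -trans_algZ; congr (_ *m expmx (trans_alg _)).
  by apply/matrixP => a b; rewrite !mxE eq_rshift.
rewrite /pd_sensitivity !mxE; case: split_ordP => c' ->; rewrite !mxE.
  rewrite grad_sens mxE; congr (derive1 _ 0); apply/funext => e.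
  by rewrite updl.
by congr (derive1 _ 0); apply/funext => e; rewrite updr.
Qed.

(** From |exp A - 1| = O(|A|), uniformly for X in a ball around X0 and w in the
    unit ball. *)
Lemma pd_update_displacement (X0 : point) :
  exists2 K : R, 0 < K & forall X w, `|X - X0| < 1 -> `|w| < 1 ->
    `|pd_update S X w - X| <= K * `|w|.
Proof.
have [k k0 Hk] := linear_lipschitz (@linear_mx_continuous R m 1 _ S).
pose B := `|X0| + 1; pose E := expR (N%:R * k).
pose K1 := N%:R * (B * (N%:R * (E * k))); pose K2 := (d + 1)%:R * B.
have B0 : 0 <= B by rewrite addr_ge0.
have E0 : 0 <= E by exact: expR_ge0.
have K10 : 0 <= K1 by rewrite !mulr_ge0 // ltW.
have K20 : 0 <= K2 by rewrite mulr_ge0.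
exists (K1 + K2 + 1); first by rewrite ltr_wpDl // addr_ge0.
move=> X w XX0 w1; have w0 : 0 <= `|w| by [].
have XB : `|X| <= B.
  by rewrite -(subrK X0 X) (le_trans (ler_normD _ _)) // addrC lerD2l ltW.
move: XB; rewrite ler_pair_norm => /andP[X1B X2B].
rewrite ler_pair_norm pd_updateE /=; apply/andP; split.
  apply: (@le_trans _ _ (K1 * `|w|)); last by rewrite ler_wpM2r // -addrA lerDl addr_ge0.
  apply: mx_norm_le => [|i j]; first by rewrite mulr_ge0.
  case/mxvec_indexP : j => a b.
  set Y := tuple_update _ _ _.
  have -> : (Y - X.1) i (mxvec_index a b) = (entry Y i - entry X.1 i) a b.
    by rewrite !subr_mxE !entryE.
  rewrite entry_mktuple -[X in _ - X]mulmx1 -mulmxBr.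
  set b0 := block _ _.
  have b0w : `|b0| <= `|w|.
    by apply: mx_norm_le => // p q; rewrite !mxE ler_mx_entry.
  have Sb : `|S b0| <= k * `|w| by rewrite (le_trans (Hk _)) // ler_wpM2l // ltW.
  have Sk : `|S b0| <= k by rewrite (le_trans Sb) // ler_piMr ?ltW.
  have YB : `|entry X.1 i| <= B.
    by apply: mx_norm_le => // p q; rewrite entryE (le_trans (ler_mx_entry _ _ _)).
  rewrite (le_trans (ler_mx_entry _ _ _)) // (le_trans (ler_norm_mulmx _ _)) //.
  rewrite /K1 -!mulrA; apply: ler_wpM2l => //; apply: ler_pM => //.
  rewrite (le_trans (ler_norm_expmx_sub1 _)) //; apply: ler_wpM2l => //.
  apply: ler_pM => //; rewrite ?expR_ge0 //.
  by rewrite /E ler_expR ler_wpM2l.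
apply: (@le_trans _ _ (K2 * `|w|)).
  rewrite -[X in _ - X]mulmx1 -mulmxBr (le_trans (ler_norm_mulmx _ _)) //.
  rewrite /K2 -mulrA; apply: ler_wpM2l => //; apply: ler_pM => //.
  rewrite [1%:M](scalar_mx_block d 1 1) opp_block_mx add_block_mx !subrr.
  apply: mx_norm_le => // i j; rewrite !mxE.
  case: splitP => a _; rewrite mxE; case: splitP => b _;
    by rewrite !mxE ?normr0 // subr0 ler_mx_entry.
by rewrite ler_wpM2r // [K1 + K2]addrC -addrA lerDl addr_ge0.
Qed.
End Pairs.

(** A head constant for the coordinates of the constraint maps, so that they
    can be handled as scalar functions on tuples. *)
Definition component (R : realType) (n N l : nat) (phi : mxtuple R n N -> 'cV[R]_l)
  (i : 'I_l) (Y : mxtuple R n N) : R := phi Y i 0.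

Section KKT.
Context {R : realType} {n N m n1 n2 : nat}.
Context (G : set 'M[R]_N) (S : {linear 'cV[R]_m -> 'M[R]_N}).
Context (f : mxtuple R n N -> R) (g : mxtuple R n N -> 'cV[R]_n1)
  (h : mxtuple R n N -> 'cV[R]_n2) (mu : R).
Context (Ggrp : matrix_lie_group G) (GS : forall zeta, lie_algebra G (S zeta)).
Context (C2f : C2_on_group G f) (C2g : forall i, C2_on_group G (fun Y => g Y i 0))
  (C2h : forall j, C2_on_group G (fun Y => h Y j 0)).
Local Notation point := (pd_type R n N n1 n2).
Local Notation d := (pd_dim n1 n2).
Local Notation D := (n * m + pd_dim n1 n2)%N.
Local Notation H := (@pd_group R n N n1 n2 G).
Local Notation F := (kkt S f g h mu).
Local Notation J := (pd_sensitivity S F).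
Local Notation upd := (pd_update S).
Local Notation vel := (pd_velocity S).
Local Notation gi := (component g).
Local Notation hj := (component h).
Local Notation res X := (enorm (F X)).
Implicit Types (X : point) (Y : mxtuple R n N) (z : 'cV[R]_(n * m)) (w : 'cV[R]_D)
  (phi : mxtuple R n N -> R).

(** * The KKT field and the rows of its sensitivity matrix *)

Lemma is_derive_grad phi Y z :
  in_group G Y -> C1_near (in_group G) Y phi ->
  is_derive 0 (1 : R) (fun e : R => phi (tuple_update S Y (e *: z))) ((grad S phi Y *m z) 0 0).
Proof.
move=> GY cphi; rewrite grad_sens.
exact: is_derive_sens (tuple_is_flow Ggrp GS) GY cphi.
Qed.

Lemma curvature_row phi Y z c :
  (curvature S phi Y *m z) c 0 = (grad S (fun Y' => grad S phi Y' 0 c) Y *m z) 0 0.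
Proof.
rewrite !mxE; apply: eq_bigr => k _; rewrite /curvature /sensitivity !mxE.
congr (_ * _); rewrite !grad_sens !mxE; congr (derive1 _ 0).
by apply/funext => e; rewrite mxE.
Qed.

Lemma is_derive_curvature phi Y z c :
  in_group G Y -> C2_on_group G phi ->
  is_derive 0 (1 : R) (fun e : R => grad S phi (tuple_update S Y (e *: z)) 0 c)
    ((curvature S phi Y *m z) c 0).
Proof.
move=> GY C2; rewrite curvature_row.
by apply: is_derive_grad => //; exact: grad_C1_near.
Qed.

Lemma grad_lagrangian nu lam Y c : in_group G Y ->
  grad S (lagrangian f g h nu lam) Y 0 c =
  grad S f Y 0 c + \sum_j nu j 0 * grad S (gi j) Y 0 c
                 + \sum_j lam j 0 * grad S (hj j) Y 0 c.
Proof.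
move=> GY; rewrite grad_sens; apply: sens_is_derive.
have gE (phi : mxtuple R n N -> R) : C2_on_group G phi -> is_derive 0 (1 : R)
    (fun e : R => phi (tuple_update S Y (e *: delta_mx c 0))) (grad S phi Y 0 c).
  move=> C2; have := is_derive_grad (delta_mx c 0) GY (C2_C1_near C2 GY).
  by rewrite -colE [in X in is_derive _ _ _ X]mxE.
rewrite (_ : (fun e => _) =
  (fun e : R => f (tuple_update S Y (e *: delta_mx c 0))) +
  (fun e : R => \sum_j nu j 0 * gi j (tuple_update S Y (e *: delta_mx c 0))) +
  (fun e : R => \sum_j lam j 0 * hj j (tuple_update S Y (e *: delta_mx c 0)))); last first.
  apply/funext => e; rewrite /lagrangian !mxE.
  by congr (_ + _ + _); apply: eq_bigr => j _; rewrite mxE.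
apply: is_deriveD; first (apply: is_deriveD; first exact: gE).
  apply: is_derive_sum_fun => j; apply: is_deriveZ; exact: (gE _ (C2g j)).
apply: is_derive_sum_fun => j; apply: is_deriveZ; exact: (gE _ (C2h j)).
Qed.

(** The gradient of the Lagrangian is a combination of gradients with constant
    coefficients nu, lam; differentiating that identity along the flow and
    using uniqueness of derivatives gives the curvature. *)
Lemma curvature_lagrangian nu lam Y z c : in_group G Y ->
  (curvature S (lagrangian f g h nu lam) Y *m z) c 0 =
  (curvature S f Y *m z) c 0 + \sum_j nu j 0 * (curvature S (gi j) Y *m z) c 0
                 + \sum_j lam j 0 * (curvature S (hj j) Y *m z) c 0.
Proof.
move=> GY.
have D : is_derive 0 (1 : R) (fun e : R => grad S f (tuple_update S Y (e *: z)) 0 c +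
    \sum_j nu j 0 * grad S (gi j) (tuple_update S Y (e *: z)) 0 c +
    \sum_j lam j 0 * grad S (hj j) (tuple_update S Y (e *: z)) 0 c)
  ((curvature S f Y *m z) c 0 + \sum_j nu j 0 * (curvature S (gi j) Y *m z) c 0
                 + \sum_j lam j 0 * (curvature S (hj j) Y *m z) c 0).
  apply: is_deriveD; first (apply: is_deriveD; first exact: is_derive_curvature).
    apply: is_derive_sum_fun => j; apply: is_deriveZ.
    exact: (is_derive_curvature z c GY (C2g j)).
  apply: is_derive_sum_fun => j; apply: is_deriveZ.
  exact: (is_derive_curvature z c GY (C2h j)).
apply: is_derive_unique D.
rewrite curvature_row.
have -> : (fun e : R => grad S f (tuple_update S Y (e *: z)) 0 c +
    \sum_j nu j 0 * grad S (gi j) (tuple_update S Y (e *: z)) 0 c +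
    \sum_j lam j 0 * grad S (hj j) (tuple_update S Y (e *: z)) 0 c) =
  fun e : R => grad S (lagrangian f g h nu lam) (tuple_update S Y (e *: z)) 0 c.
  by apply/funext => e; rewrite grad_lagrangian //; exact: in_group_tuple_update.
apply: is_derive_grad => //.
apply: (@C1_near_ext _ _ _ (fun Y => grad S f Y 0 c + \sum_j nu j 0 * grad S (gi j) Y 0 c
                 + \sum_j lam j 0 * grad S (hj j) Y 0 c)).
  by move=> Y' GY'; rewrite grad_lagrangian.
apply: C1_nearD; first (apply: C1_nearD; first exact: grad_C1_near).
  apply: C1_near_sum => j; apply: C1_nearM; first exact: C1_near_cst.
  exact: (grad_C1_near _ Ggrp GS (C2g j)).
apply: C1_near_sum => j; apply: C1_nearM; first exact: C1_near_cst.
exact: (grad_C1_near _ Ggrp GS (C2h j)).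
Qed.

Definition dir_nu w : 'cV[R]_n1 := usubmx (dsubmx w).
Definition dir_lam w : 'cV[R]_n2 := usubmx (dsubmx (dsubmx w)).
Definition dir_slack w : 'cV[R]_n1 := dsubmx (dsubmx (dsubmx w)).

Lemma pd_nu_update X w j : H X -> pd_nu (upd X w) j 0 = pd_nu X j 0 + dir_nu w j 0.
Proof. by move=> HX; rewrite /pd_nu (ursubmx_pd_update _ _ HX) !mxE. Qed.

Lemma pd_lam_update X w j : H X -> pd_lam (upd X w) j 0 = pd_lam X j 0 + dir_lam w j 0.
Proof. by move=> HX; rewrite /pd_lam (ursubmx_pd_update _ _ HX) !mxE. Qed.

Lemma pd_slack_update X w j : H X -> pd_slack (upd X w) j 0 = pd_slack X j 0 + dir_slack w j 0.
Proof. by move=> HX; rewrite /pd_slack (ursubmx_pd_update _ _ HX) !mxE. Qed.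

Lemma kkt_rows (P : 'I_(n * m + d) -> Prop) :
  (forall c, P (lshift d c)) ->
  (forall i, P (rshift (n * m) (lshift (n2 + n1) i))) ->
  (forall j, P (rshift (n * m) (rshift n1 (lshift n1 j)))) ->
  (forall i, P (rshift (n * m) (rshift n1 (rshift n2 i)))) -> forall r, P r.
Proof.
move=> P1 P2 P3 P4 r; case: (split_ordP r) => [c ->//|{}r ->].
case: (split_ordP r) => [i ->//|{}r ->].
by case: (split_ordP r) => [j ->|i ->].
Qed.

Lemma kkt_grad X c : in_group G X.1 -> F X (lshift d c) 0 =
  grad S f X.1 0 c + \sum_j pd_nu X j 0 * grad S (gi j) X.1 0 c
                   + \sum_j pd_lam X j 0 * grad S (hj j) X.1 0 c.
Proof.
by move=> GX; rewrite /kkt col_mxEu [LHS]mxE grad_lagrangian.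
Qed.

Lemma kkt_g X i : F X (rshift (n * m) (lshift (n2 + n1) i)) 0 = gi i X.1 + pd_slack X i 0.
Proof. by rewrite /kkt col_mxEd col_mxEu mxE. Qed.

Lemma kkt_h X j : F X (rshift (n * m) (rshift n1 (lshift n1 j))) 0 = hj j X.1.
Proof. by rewrite /kkt !col_mxEd col_mxEu. Qed.

Lemma kkt_slack X i : F X (rshift (n * m) (rshift n1 (rshift n2 i))) 0 =
  pd_slack X i 0 * pd_nu X i 0 - mu.
Proof. by rewrite /kkt !col_mxEd subr_mxE mul_diag_mx !mxE. Qed.

Lemma linear_snd_C1_near X0 (p : 'M[R]_(d + 1) -> R) : linear p ->
  C1_near H X0 (fun X => p X.2).
Proof.
move=> lp; have [L <-] := linear_of lp.
have lL : linear (fun X : point => L X.2) by move=> a u v; rewrite linearP.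
have [L' L'E] := linear_of lL; rewrite -L'E; apply: C1_near_linear; rewrite L'E.
move=> X; apply: (@continuous_comp _ _ _ snd L); first exact: cvg_snd.
exact: linear_mx_continuous.
Qed.

Lemma pd_nu_C1 X j : C1_near H X (fun X => pd_nu X j 0).
Proof.
by apply: (@linear_snd_C1_near X (fun Z => usubmx (ursubmx Z) j 0)) => a u v; rewrite !mxE.
Qed.

Lemma pd_lam_C1 X j : C1_near H X (fun X => pd_lam X j 0).
Proof.
by apply: (@linear_snd_C1_near X (fun Z => usubmx (dsubmx (ursubmx Z)) j 0)) => a u v; rewrite !mxE.
Qed.

Lemma pd_slack_C1 X j : C1_near H X (fun X => pd_slack X j 0).
Proof.
by apply: (@linear_snd_C1_near X (fun Z => dsubmx (dsubmx (ursubmx Z)) j 0)) => a u v; rewrite !mxE.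
Qed.

Lemma fst_C1_near X (phi : mxtuple R n N -> R) :
  C1_near (in_group G) X.1 phi -> C1_near H X (fun X => phi X.1).
Proof.
have lL : linear (fst : point -> mxtuple R n N) by [].
have [L LE] := linear_of lL.
have := @C1_near_comp R _ _ (in_group G) H L phi X; rewrite LE; apply.
  by move=> Z; exact: cvg_fst.
by move=> Z [].
Qed.

Lemma kkt_C1_near X r : H X -> C1_near H X (fun X => F X r 0).
Proof.
move=> HX; have GX : in_group G X.1 by case: HX.
elim/kkt_rows: r => [c|i|j|i].
- apply: (@C1_near_ext _ _ _ (fun X => grad S f X.1 0 c
   + \sum_j pd_nu X j 0 * grad S (gi j) X.1 0 c
   + \sum_j pd_lam X j 0 * grad S (hj j) X.1 0 c)).
    by move=> Z [GZ _]; rewrite kkt_grad.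
  apply: C1_nearD; first apply: C1_nearD.
  + apply: (@fst_C1_near X (fun Y => grad S f Y 0 c)); exact: grad_C1_near.
  + apply: C1_near_sum => j; apply: C1_nearM; first exact: pd_nu_C1.
    apply: (@fst_C1_near X (fun Y => grad S (gi j) Y 0 c)).
    exact: (grad_C1_near _ Ggrp GS (C2g j)).
  + apply: C1_near_sum => j; apply: C1_nearM; first exact: pd_lam_C1.
    apply: (@fst_C1_near X (fun Y => grad S (hj j) Y 0 c)).
    exact: (grad_C1_near _ Ggrp GS (C2h j)).
- apply: (@C1_near_ext _ _ _ (fun X => gi i X.1 + pd_slack X i 0)).
    by move=> Z _; rewrite kkt_g.
  apply: C1_nearD; last exact: pd_slack_C1.
  exact: (@fst_C1_near X (gi i) (C2_C1_near (C2g i) GX)).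
- apply: (@C1_near_ext _ _ _ (fun X => hj j X.1)); first by move=> Z _; rewrite kkt_h.
  exact: (@fst_C1_near X (hj j) (C2_C1_near (C2h j) GX)).
- apply: (@C1_near_ext _ _ _ (fun X => pd_slack X i 0 * pd_nu X i 0 + - mu)).
    by move=> Z _; rewrite kkt_slack.
  apply: C1_nearD; last exact: C1_near_cst.
  by apply: C1_nearM; [exact: pd_slack_C1|exact: pd_nu_C1].
Qed.

Lemma kkt_sensitivity_sens X w r :
  (J X *m w) r 0 = (sens upd (fun X => F X r 0) X *m w) 0 0.
Proof. by rewrite !mxE; apply: eq_bigr => c _; rewrite pd_sensitivityE. Qed.

(** Along the update from X, a row of F differentiates to the corresponding row
    of J w; each block of J can thus be read off by differentiating the
    explicit formula for that row of F. *)
Lemma kkt_sensitivity_is_derive X w r D : H X ->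
  is_derive 0 (1 : R) (fun e : R => F (upd X (e *: w)) r 0) D -> (J X *m w) r 0 = D.
Proof.
move=> HX; rewrite kkt_sensitivity_sens; apply: is_derive_unique.
exact: (is_derive_sens w (@pd_is_flow R n N m n1 n2 S G Ggrp GS) HX (kkt_C1_near r HX)).
Qed.

Lemma pd_update_fst X w (e : R) :
  (upd X (e *: w)).1 = tuple_update S X.1 (e *: usubmx w).
Proof. by rewrite pd_updateE /= linearZ. Qed.

Lemma dir_nuZ (e : R) w j : dir_nu (e *: w) j 0 = e * dir_nu w j 0.
Proof. by rewrite !mxE. Qed.

Lemma dir_lamZ (e : R) w j : dir_lam (e *: w) j 0 = e * dir_lam w j 0.
Proof. by rewrite !mxE. Qed.

Lemma dir_slackZ (e : R) w j : dir_slack (e *: w) j 0 = e * dir_slack w j 0.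
Proof. by rewrite !mxE. Qed.

Lemma is_derive_affine (a b : R) : is_derive 0 (1 : R) (fun e : R => a + e * b) b.
Proof. by apply: is_derive_eq; rewrite /GRing.scale /=; ring. Qed.

Lemma is_derive_mul_affine (a b : R) (q : R -> R) D :
  is_derive 0 (1 : R) q D -> is_derive 0 (1 : R) (fun e : R => (a + e * b) * q e) (a * D + b * q 0).
Proof.
move=> dq; have := is_deriveM (is_derive_affine a b) dq.
by rewrite mul0r addr0 /GRing.scale /= [q 0 * b]mulrC.
Qed.

(** The multipliers also move along the update, and the product rule adds the
    gradients of g and h weighted by the multiplier directions to the curvature
    term. *)
Lemma kkt_sensitivity_grad X w c : H X -> (J X *m w) (lshift d c) 0 =
  (curvature S (lagrangian f g h (pd_nu X) (pd_lam X)) X.1 *m usubmx w) c 0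
  + \sum_j dir_nu w j 0 * grad S (gi j) X.1 0 c
  + \sum_j dir_lam w j 0 * grad S (hj j) X.1 0 c.
Proof.
move=> HX; have GX : in_group G X.1 by case: HX.
apply: kkt_sensitivity_is_derive => //.
set z := usubmx w; pose Y e := tuple_update S X.1 (e *: z).
have Y0 : Y 0 = X.1 by rewrite /Y scale0r tuple_update0.
rewrite (_ : (fun e => _) = fun e : R => grad S f (Y e) 0 c
  + \sum_j (pd_nu X j 0 + e * dir_nu w j 0) * grad S (gi j) (Y e) 0 c
  + \sum_j (pd_lam X j 0 + e * dir_lam w j 0) * grad S (hj j) (Y e) 0 c); last first.
  apply/funext => e; rewrite kkt_grad pd_update_fst; last exact: in_group_tuple_update.
  by congr (_ + _ + _); apply: eq_bigr => j _;
    rewrite ?pd_nu_update ?pd_lam_update ?dir_nuZ ?dir_lamZ.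
rewrite curvature_lagrangian //.
have reorder (A B C B' C' : R) : A + B + C + B' + C' = A + (B + B') + (C + C') by ring.
rewrite [X in is_derive _ _ _ X]reorder.
apply: is_deriveD; first apply: is_deriveD.
- exact: (is_derive_curvature z c GX C2f).
- rewrite -big_split; apply: is_derive_sum_fun => j; rewrite -{2}Y0.
  apply: (@is_derive_mul_affine _ _ (fun e => grad S (gi j) (Y e) 0 c)).
  exact: (is_derive_curvature z c GX (C2g j)).
- rewrite -big_split; apply: is_derive_sum_fun => j; rewrite -{2}Y0.
  apply: (@is_derive_mul_affine _ _ (fun e => grad S (hj j) (Y e) 0 c)).
  exact: (is_derive_curvature z c GX (C2h j)).
Qed.

Lemma kkt_sensitivity_g X w i : H X ->
  (J X *m w) (rshift (n * m) (lshift (n2 + n1) i)) 0 =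
  (grad S (gi i) X.1 *m usubmx w) 0 0 + dir_slack w i 0.
Proof.
move=> HX; have GX : in_group G X.1 by case: HX.
apply: kkt_sensitivity_is_derive => //.
rewrite (_ : (fun e => _) = fun e : R => gi i (tuple_update S X.1 (e *: usubmx w))
  + (pd_slack X i 0 + e * dir_slack w i 0)); last first.
  by apply/funext => e; rewrite kkt_g pd_update_fst pd_slack_update // dir_slackZ.
apply: is_deriveD; last exact: is_derive_affine.
exact: (is_derive_grad _ GX (C2_C1_near (C2g i) GX)).
Qed.

Lemma kkt_sensitivity_h X w j : H X ->
  (J X *m w) (rshift (n * m) (rshift n1 (lshift n1 j))) 0 =
  (grad S (hj j) X.1 *m usubmx w) 0 0.
Proof.
move=> HX; have GX : in_group G X.1 by case: HX.
apply: kkt_sensitivity_is_derive => //.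
rewrite (_ : (fun e => _) = fun e : R => hj j (tuple_update S X.1 (e *: usubmx w))).
  exact: (is_derive_grad _ GX (C2_C1_near (C2h j) GX)).
by apply/funext => e; rewrite kkt_h pd_update_fst.
Qed.

Lemma kkt_sensitivity_slack X w i : H X ->
  (J X *m w) (rshift (n * m) (rshift n1 (rshift n2 i))) 0 =
  pd_slack X i 0 * dir_nu w i 0 + dir_slack w i 0 * pd_nu X i 0.
Proof.
move=> HX; apply: kkt_sensitivity_is_derive => //.
rewrite (_ : (fun e => _) = (fun e : R => (pd_slack X i 0 + e * dir_slack w i 0) *
  (pd_nu X i 0 + e * dir_nu w i 0)) + cst (- mu)); last first.
  by apply/funext => e; rewrite kkt_slack pd_slack_update // dir_slackZ pd_nu_update // dir_nuZ.
rewrite -[X in is_derive _ _ _ X]addr0; apply: is_deriveD.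
have := is_derive_mul_affine (pd_slack X i 0) (dir_slack w i 0)
  (is_derive_affine (pd_nu X i 0) (dir_nu w i 0)).
by rewrite mul0r addr0.
Qed.

(** * Local estimates of the KKT field and of its Newton remainder *)

Context (Xs : point) (HXs : H Xs).
Local Notation L := (lagrangian f g h (pd_nu Xs) (pd_lam Xs)).

Lemma kkt_continuous (e : R) : 0 < e -> \forall X \near Xs, H X -> `|F X - F Xs| <= e.
Proof.
move=> e0; have FXs : Filter (nbhs Xs) by exact: nbhs_filter.
have rows r : \forall X \near Xs, H X -> `|F X r 0 - F Xs r 0| <= e.
  have [M HM] := C1_near_lip HXs (kkt_C1_near r HXs).
  have K0 : 0 < `|M| + 1 by rewrite ltr_wpDl.
  have XXs : \forall X \near Xs, `|X - Xs| <= e / (`|M| + 1).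
    have e1 : 0 < e / (`|M| + 1) by exact: divr_gt0.
    apply/nbhs_ballP; exists (e / (`|M| + 1)) => // X.
    by rewrite -ball_normE /= distrC => /ltW.
  near=> X => HX.
  have Xe : `|X - Xs| <= e / (`|M| + 1) by near: X.
  have XM : H X -> `|F X r 0 - F Xs r 0| <= M * `|X - Xs| by near: X.
  rewrite (le_trans (XM HX)) // (@le_trans _ _ ((`|M| + 1) * `|X - Xs|)) //.
    by rewrite ler_wpM2r // (le_trans (ler_norm _)) // lerDl.
  by rewrite mulrC -ler_pdivlMr.
have nrows : \forall X \near Xs, forall r, H X -> `|F X r 0 - F Xs r 0| <= e.
  exact: (filter_forall (nbhs_filter Xs) rows).
apply: filterS nrows => X rX HX.
by apply: mx_norm_le => [|i j]; [exact: ltW|rewrite ord1 subr_mxE; exact: rX].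
Unshelve. all: by end_near. Qed.

Lemma kkt_sensitivity_continuous (e : R) : 0 < e ->
  \forall X \near Xs, H X -> `|J X - J Xs| <= e.
Proof.
move=> e0; have FXs : Filter (nbhs Xs) by exact: nbhs_filter.
have rows r : \forall X \near Xs, forall c, H X -> `|J X r c - J Xs r c| <= e.
  have cols c : \forall X \near Xs, H X -> `|J X r c - J Xs r c| <= e.
    have := sens_continuous c (pd_is_flow Ggrp GS) HXs
      (kkt_C1_near r HXs) e0.
    have JE X : J X r c = sens upd (fun X => F X r 0) X 0 c.
      exact: pd_sensitivityE.
    apply: filterS => X cX HX.
    have DE : J X r c - J Xs r c = sens upd (fun X => F X r 0) X 0 c
      - sens upd (fun X => F X r 0) Xs 0 c.
      by congr (_ - _); exact: JE.
    rewrite DE.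
    exact: (cX HX).
  exact: (filter_forall (nbhs_filter Xs) cols).
have nrows : \forall X \near Xs, forall r c, H X -> `|J X r c - J Xs r c| <= e.
  exact: (filter_forall (nbhs_filter Xs) rows).
apply: filterS nrows => X rX HX.
by apply: mx_norm_le => [|i j]; [exact: ltW|rewrite subr_mxE; exact: rX].
Qed.

(** Mean value theorem for each of the finitely many rows of F, with a radius
    common to all; the variation of J along the curve bounds the error. *)
Lemma kkt_taylor : exists2 r : R, 0 < r & forall X w (e : R), H X ->
  `|X - Xs| < r -> `|w| < r ->
  (forall th, 0 < th < 1 -> `|J (upd X (th *: w)) - J X| <= e) ->
  `|F (upd X w) - F X - J X *m w| <= (n * m + d)%:R * (e * `|w|).
Proof.
have [K K0 HK] := @pd_update_displacement R n N m n1 n2 S Xs.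
have mvt r := @sens_mvt R _ _ _ _ _ _ Xs K 1 (pd_is_flow Ggrp GS) HXs
  (kkt_C1_near r HXs) ltr01 K0 (fun X w _ => HK X w).
have ex r : exists r0 : R, 0 < r0 /\ forall X w, H X -> `|X - Xs| < r0 -> `|w| < r0 ->
    exists2 th : R, 0 < th < 1 &
      F (upd X w) r 0 - F X r 0 = (sens upd (fun X => F X r 0) (upd X (th *: w)) *m w) 0 0.
  by have [r0 r00 Hr] := mvt r; exists r0; split.
have [rr Hrr] := choice ex.
have nr : \forall s \near (0 : R)^'+, forall r, s < rr r.
  have Q r : \forall s \near (0 : R)^'+, s < rr r by apply: nbhs_right_lt; case: (Hrr r).
  exact: (filter_forall _ Q).
near (0 : R)^'+ => s.
have s0 : 0 < s by near: s; exact: nbhs_right_gt.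
have sr : forall r, s < rr r by near: s.
exists s => // X w e HX Xs' ws Je.
have e0 : 0 <= e by apply: le_trans (Je (1 / 2) _) => //; apply/andP; split; lra.
apply: mx_norm_le => [|r j]; first by rewrite !mulr_ge0.
rewrite ord1 !subr_mxE.
have [_ /(_ X w HX (lt_trans Xs' (sr r)) (lt_trans ws (sr r)))[th th01 ->]] := Hrr r.
rewrite -kkt_sensitivity_sens -subr_mxE -mulmxBl (le_trans (ler_mx_entry _ _ _)) //.
by rewrite (le_trans (ler_norm_mulmx _ _)) // ler_wpM2l // ler_wpM2r // Je.
Unshelve. all: by end_near. Qed.

(** An invertible matrix is bounded below, and a perturbation smaller than half
    of that bound keeps half of it. *)
Lemma kkt_sensitivity_lower : (forall w, J Xs *m w = 0 -> w = 0) ->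
  exists2 k : R, 0 < k & \forall X \near Xs, H X -> forall w, k * `|w| <= `|J X *m w|.
Proof.
move=> Jinj; have uJ := mulmx_inj_unit Jinj.
set D := (n * m + d)%N.
pose c : R := D%:R * `|invmx (J Xs)| + 1.
have c0 : 0 < c by rewrite ltr_wpDl // mulr_ge0.
have low w : `|w| <= c * `|J Xs *m w|.
  rewrite -{1}(mulKmx uJ w) (le_trans (ler_norm_mulmx _ _)) // mulrA.
  by rewrite ler_wpM2r // lerDl.
pose e : R := (2 * c * (D%:R + 1))^-1.
have D0 : 0 < D%:R + 1 :> R by rewrite ltr_wpDl.
have e0 : 0 < e by rewrite invr_gt0 !mulr_gt0.
exists (2 * c)^-1; first by rewrite invr_gt0 mulr_gt0.
have := kkt_sensitivity_continuous e0; apply: filterS => X JX HX w.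
have h1 : `|(J X - J Xs) *m w| <= (2 * c)^-1 * `|w|.
  rewrite (le_trans (ler_norm_mulmx _ _)) // mulrA ler_wpM2r //.
  rewrite (@le_trans _ _ ((D%:R + 1) * e)) //.
    by rewrite ler_pM // ?lerDl // JX.
  by rewrite /e invfM mulrCA divff ?mulr1 // gt_eqF.
have h2 : c^-1 * `|w| <= `|J Xs *m w| by rewrite ler_pdivrMl.
have h3 : `|J Xs *m w| <= `|J X *m w| + `|(J X - J Xs) *m w|.
  by rewrite -[X in `|X| <= _](subKr (J X *m w)) -mulmxBl ler_normB.
have E : c^-1 = (2 * c)^-1 + (2 * c)^-1 by field; rewrite gt_eqF.
rewrite -(lerD2r ((2 * c)^-1 * `|w|)) -mulrDl -E.
by rewrite (le_trans h2) // (le_trans h3) // lerD2l.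
Qed.

Lemma near_fst_point (P : set (mxtuple R n N)) :
  (\forall Y \near Xs.1, P Y) -> \forall X \near Xs, P X.1.
Proof. by move=> nP; have [Y Z] := Xs; exact: (cvg_fst nP). Qed.

Lemma lip_at_grad (phi : mxtuple R n N -> R) z : C2_on_group G phi ->
  lip_at H Xs (fun X => (grad S phi X.1 *m z) 0 0).
Proof.
move=> C2; have GXs : in_group G Xs.1 by case: HXs.
apply: (@lip_at_ext _ _ _ _ (fun X => \sum_k z k 0 * grad S phi X.1 0 k)) => //.
  by move=> X _; rewrite mxE; apply: eq_bigr => k _; rewrite mulrC.
apply: lip_at_sum => k; apply: lip_atMl; apply: lip_at_C1 => //.
apply: (@fst_C1_near Xs (fun Y => grad S phi Y 0 k)).
exact: grad_C1_near.
Qed.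

Lemma lip_at_grad_entry (phi : mxtuple R n N -> R) k : C2_on_group G phi ->
  lip_at H Xs (fun X => grad S phi X.1 0 k).
Proof.
move=> C2; have GXs : in_group G Xs.1 by case: HXs.
apply: lip_at_C1 => //.
apply: (@fst_C1_near Xs (fun Y => grad S phi Y 0 k)).
exact: grad_C1_near.
Qed.

Lemma curvature_bounded (phi : mxtuple R n N -> R) z c : C2_on_group G phi ->
  exists B : R, \forall X \near Xs, H X -> `|(curvature S phi X.1 *m z) c 0| <= B.
Proof.
move=> C2; have GXs : in_group G Xs.1 by case: HXs.
pose q k X := grad S (fun Y => grad S phi Y 0 c) X.1 0 k.
have nq k : \forall X \near Xs, H X -> `|q k X| <= `|q k Xs| + 1.
  have := sens_continuous k (tuple_is_flow Ggrp GS) GXs (grad_C1_near c Ggrp GS C2 GXs) ltr01.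
  move/near_fst_point; apply: filterS => X qX [GX _].
  rewrite -[q k X](subrK (q k Xs)) addrC (le_trans (ler_normD _ _)) // lerD2l.
  by rewrite /q !grad_sens; exact: qX.
have nqa := filter_forall (nbhs_filter Xs) nq.
exists (\sum_k (`|q k Xs| + 1) * `|z k 0|); apply: filterS nqa => X qX HX.
rewrite curvature_row mxE (le_trans (ler_norm_sum _ _ _)) //.
by apply: ler_sum => k _; rewrite normrM ler_wpM2r //; exact: qX.
Qed.

(** Only the curvature of the Lagrangian at the fixed multipliers nu*, lam* of
    Xs is assumed Lipschitz. The curvature at the multipliers of X differs from
    it by sums of (nu_j - nu*_j) and (lam_j - lam*_j) times curvatures of g_j
    and h_j, which are merely bounded near Xs. All other entries of J are
    continuously differentiable. *)
Lemma kkt_sensitivity_lipschitz :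
  (exists M : R, \forall Y \near Xs.1, in_group G Y ->
     `|curvature S L Y - curvature S L Xs.1| <= M * `|Y - Xs.1|) ->
  exists2 M : R, 0 <= M & \forall X \near Xs, H X -> `|J X - J Xs| <= M * `|X - Xs|.
Proof.
move=> [M HM]; have GXs : in_group G Xs.1 by case: HXs.
have lipcurv z c : lip_at H Xs (fun X => (curvature S L X.1 *m z) c 0).
  apply: (@lip_at_intro _ _ _ _ _ ((n * m)%:R * (`|M| * `|z|))).
  have := near_fst_point HM; apply: filterS => X cX [GX _].
  rewrite -subr_mxE -mulmxBl (le_trans (ler_mx_entry _ _ _)) //.
  rewrite (le_trans (ler_norm_mulmx _ _)) // -!mulrA ler_wpM2l //.
  rewrite [`|z| * _]mulrC mulrA ler_wpM2r // (le_trans (cX GX)) //.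
  rewrite (le_trans (ler_wpM2r _ (ler_norm M))) // ler_wpM2l //.
  by have := lexx `|X - Xs|; rewrite {1}ler_pair_norm => /andP[].
have lipJ r c : lip_at H Xs (fun X => J X r c).
  pose w : 'cV[R]_(n * m + d) := delta_mx c 0.
  have JE X : (J X *m w) r 0 = J X r c by rewrite -colE [LHS]mxE.
  suff : lip_at H Xs (fun X => (J X *m w) r 0).
    by apply: lip_at_ext => // X _; exact: JE.
  move: r {JE}; apply: (@kkt_rows
    (fun r => lip_at H Xs (fun X => (J X *m w) r 0))) => [r|i|j|i].
  - apply: (@lip_at_ext _ _ _ _ (fun X => ((curvature S L X.1 *m usubmx w) r 0
      + \sum_j (pd_nu X j 0 - pd_nu Xs j 0) * (curvature S (gi j) X.1 *m usubmx w) r 0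
      + \sum_j (pd_lam X j 0 - pd_lam Xs j 0) * (curvature S (hj j) X.1 *m usubmx w) r 0)
      + \sum_j dir_nu w j 0 * grad S (gi j) X.1 0 r
      + \sum_j dir_lam w j 0 * grad S (hj j) X.1 0 r)) => //.
      move=> X HX; have GX : in_group G X.1 by case: HX.
      rewrite kkt_sensitivity_grad //; congr (_ + _ + _).
      have CL nu lam := @curvature_lagrangian nu lam X.1 (usubmx w) r GX.
      apply: esym; apply: (etrans (CL (pd_nu X) (pd_lam X))); apply: esym.
      apply: (etrans (congr1 (fun t => t + _ + _) (CL (pd_nu Xs) (pd_lam Xs)))).
      have E (A B B' C C' : R) : A + B + C + (B' - B) + (C' - C) = A + B' + C' by ring.
      under [X in _ + X + _]eq_bigr do rewrite mulrBl.
      under [X in _ + _ + X]eq_bigr do rewrite mulrBl.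
      by rewrite !sumrB E.
    have lipnu j : lip_at H Xs (fun X => pd_nu X j 0 - pd_nu Xs j 0).
      by apply: lip_atD; [apply: lip_at_C1 => //; exact: pd_nu_C1|exact: lip_at_cst].
    have liplam j : lip_at H Xs (fun X => pd_lam X j 0 - pd_lam Xs j 0).
      by apply: lip_atD; [apply: lip_at_C1 => //; exact: pd_lam_C1|exact: lip_at_cst].
    apply: lip_atD; first apply: lip_atD; first apply: lip_atD; first apply: lip_atD.
    + exact: lipcurv.
    + apply: lip_at_sum => j; have [B HB] := curvature_bounded (usubmx w) r (C2g j).
      by apply: lip_at_mul_bounded HB; [exact: subrr|exact: lipnu].
    + apply: lip_at_sum => j; have [B HB] := curvature_bounded (usubmx w) r (C2h j).
      by apply: lip_at_mul_bounded HB; [exact: subrr|exact: liplam].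
    + apply: lip_at_sum => j; apply: lip_atMl; exact: (lip_at_grad_entry _ (C2g j)).
    + apply: lip_at_sum => j; apply: lip_atMl; exact: (lip_at_grad_entry _ (C2h j)).
  - apply: (@lip_at_ext _ _ _ _ (fun X =>
      (grad S (gi i) X.1 *m usubmx w) 0 0 + dir_slack w i 0)) => //.
      by move=> X HX; rewrite kkt_sensitivity_g.
    by apply: lip_atD; [exact: (lip_at_grad _ (C2g i))|exact: lip_at_cst].
  - apply: (@lip_at_ext _ _ _ _ (fun X => (grad S (hj j) X.1 *m usubmx w) 0 0)) => //.
      by move=> X HX; rewrite kkt_sensitivity_h.
    exact: (lip_at_grad _ (C2h j)).
  - apply: (@lip_at_ext _ _ _ _ (fun X => dir_nu w i 0 * pd_slack X i 0
      + dir_slack w i 0 * pd_nu X i 0)) => //.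
      move=> X HX; rewrite kkt_sensitivity_slack //.
      by rewrite [dir_nu _ _ _ * _]mulrC.
    apply: lip_atD; apply: lip_atMl; apply: lip_at_C1 => //.
      exact: pd_slack_C1.
    exact: pd_nu_C1.
have [K HK] : exists K : 'I_(n * m + d) -> 'I_(n * m + d) -> R, forall r c, 0 <= K r c /\
    \forall X \near Xs, H X -> `|J X r c - J Xs r c| <= K r c * `|X - Xs|.
  have ex r : exists K : 'I_(n * m + d) -> R, forall c, 0 <= K c /\
    \forall X \near Xs, H X -> `|J X r c - J Xs r c| <= K c * `|X - Xs|.
    have ec c : exists K : R, 0 <= K /\
        \forall X \near Xs, H X -> `|J X r c - J Xs r c| <= K * `|X - Xs|.
      by have [K K0 HK] := lipJ r c; exists K; split.
    by have [K HK] := choice ec; exists K.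
  have [K HK] := choice ex; by exists K.
have K0 r c : 0 <= K r c by case: (HK r c).
exists (\sum_r \sum_c K r c); first by apply: sumr_ge0 => r _; apply: sumr_ge0.
have nrows : \forall X \near Xs, forall r c, H X -> `|J X r c - J Xs r c| <= K r c * `|X - Xs|.
  have cols r : \forall X \near Xs, forall c, H X -> `|J X r c - J Xs r c| <= K r c * `|X - Xs|.
    apply: (filter_forall (nbhs_filter Xs)) => c.
    by case: (HK r c).
  exact: (filter_forall (nbhs_filter Xs) cols).
apply: filterS nrows => X rX HX; apply: mx_norm_le => [|r c].
  by rewrite mulr_ge0 // sumr_ge0 // => r _; apply: sumr_ge0.
rewrite subr_mxE (le_trans (rX r c HX)) // ler_wpM2r //.
rewrite (bigD1 r) //= (bigD1 c) //= -addrA lerDl addr_ge0 ?sumr_ge0 // => r' _.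
by apply: sumr_ge0.
Qed.

(** A bound e on |J Y - J Xs| over the points Y that the curve from X to its
    update can reach bounds the Newton remainder by a multiple of e |w|. The
    hypothesis is restricted to such points so that e may depend on X and w. *)
Lemma newton_remainder_aux : exists2 K : R, 0 < K & forall r2 : R, 0 < r2 ->
  exists2 r : R, 0 < r & forall X w (e : R), H X -> `|X - Xs| < r -> enorm w < r ->
    (forall Y : point, H Y -> `|Y - Xs| < r2 -> `|Y - Xs| <= `|X - Xs| + K * enorm w ->
       `|J Y - J Xs| <= e) ->
    enorm (F (upd X w) - F X - J X *m w) <= D%:R * (D%:R * (2 * e)) * enorm w.
Proof.
have [K K0 HK] := @pd_update_displacement R n N m n1 n2 S Xs.
have [r1 r10 Hr1] := kkt_taylor.
exists K => // r2 r20; pose q := r2 / (1 + K).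
have q0 : 0 < q by rewrite divr_gt0 // addr_gt0.
have qE : q + K * q = r2 by rewrite -{1}[q]mul1r -mulrDl mulrC divfK // gt_eqF // addr_gt0.
exists (Num.min (Num.min r1 1) q); first by rewrite !lt_min r10 ltr01 q0.
move=> X w e HX; rewrite !lt_min => /andP[/andP[Xr1 X1] Xq] /andP[/andP[wr1 w1] wq] HJ.
have wn : `|w| <= enorm w := ler_norm_enorm w.
have Xr2 : `|X - Xs| < r2.
  by rewrite (lt_le_trans Xq) // -qE lerDl mulr_ge0 // ltW.
have JX : `|J X - J Xs| <= e.
  by apply: HJ => //; rewrite lerDl mulr_ge0 ?enorm_ge0 // ltW.
have e0 : 0 <= e by exact: le_trans JX.
have Ju th : 0 < th < 1 -> `|J (upd X (th *: w)) - J X| <= 2 * e.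
  move=> /andP[th0 th1].
  have thw : `|th *: w| <= enorm w.
    by rewrite normrZ (gtr0_norm th0) (le_trans _ wn) // ler_piMl // ltW.
  have dY : `|upd X (th *: w) - Xs| <= `|X - Xs| + K * enorm w.
    apply: (le_trans (ler_distD X _ _)); rewrite addrC lerD2l.
    by rewrite (le_trans (HK _ _ X1 (le_lt_trans thw w1))) // ler_wpM2l // ltW.
  have JY : `|J (upd X (th *: w)) - J Xs| <= e.
    apply: HJ => //; first exact: pd_group_update.
    by rewrite (le_lt_trans dY) // -qE ltr_leD // ler_wpM2l ?ltW.
  apply: (le_trans (ler_distD (J Xs) _ _)).
  rewrite mulrDl mul1r; apply: lerD; first exact: JY.
  by rewrite distrC; exact: JX.
rewrite (le_trans (ler_enorm_norm _)) // -!mulrA ler_wpM2l //.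
rewrite (le_trans (Hr1 X w (2 * e) HX Xr1 (le_lt_trans wn wr1) Ju)) // -!mulrA.
by do 3! apply: ler_wpM2l => //.
Qed.

Lemma newton_remainder_small (e : R) : 0 < e ->
  exists2 r : R, 0 < r & forall X w, H X -> `|X - Xs| < r -> enorm w < r ->
    enorm (F (upd X w) - F X - J X *m w) <= e * enorm w.
Proof.
move=> e0; have [K K0 HK] := newton_remainder_aux.
pose c : R := D%:R * (D%:R * 2) + 1; have c0 : 0 < c by rewrite ltr_wpDl // !mulr_ge0.
have /nbhs_ballP[r2 /= r20 Hr2] :=
  kkt_sensitivity_continuous (divr_gt0 e0 c0).
have [r r0 Hr] := HK r2 r20; exists r => // X w HX Xr wr.
apply: (le_trans (Hr X w (e / c) HX Xr wr _)) => [Y HY Yr2 _|].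
  by apply: Hr2 => //; rewrite -ball_normE /= distrC.
rewrite ler_wpM2r ?enorm_ge0 // !mulrA -[_ * _ * 2 * e]mulrA.
rewrite mulrA ler_pdivrMr // mulrC ler_wpM2l ?ltW // /c mulrA.
by rewrite ltrDl.
Qed.

Lemma newton_remainder_quadratic :
  (exists M : R, \forall Y \near Xs.1, in_group G Y ->
     `|curvature S (lagrangian f g h (pd_nu Xs) (pd_lam Xs)) Y
       - curvature S (lagrangian f g h (pd_nu Xs) (pd_lam Xs)) Xs.1| <= M * `|Y - Xs.1|) ->
  exists M r : R, [/\ 0 <= M, 0 < r & forall X w, H X -> `|X - Xs| < r -> enorm w < r ->
    enorm (F (upd X w) - F X - J X *m w) <= M * (`|X - Xs| + enorm w) * enorm w].
Proof.
move=> lipH; have [K K0 HK] := newton_remainder_aux.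
have [M M0 HM] := kkt_sensitivity_lipschitz lipH.
have /nbhs_ballP[r2 /= r20 Hr2] := HM.
have [r r0 Hr] := HK r2 r20.
exists (D%:R * (D%:R * (2 * (M * (1 + K))))), r; split => //.
  by rewrite !mulr_ge0 // addr_ge0 // ltW.
move=> X w HX Xr wr.
apply: (le_trans (Hr X w (M * (`|X - Xs| + K * enorm w)) HX Xr wr _)) => [Y HY Yr2 dY|].
  rewrite (le_trans (Hr2 Y _ HY)) ?ler_wpM2l //.
  by rewrite -ball_normE /= distrC.
rewrite ler_wpM2r ?enorm_ge0 // -!mulrA; do 2! rewrite ler_wpM2l //.
rewrite ler_wpM2l // ler_wpM2l //.
rewrite mulrDl mul1r [K * (_ + _)]mulrDr.
rewrite -addrA lerD2l -[leLHS]add0r lerD ?enorm_ge0 // lerDr mulr_ge0 // ltW //.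
Qed.

Lemma near_slack : (forall i, 0 < pd_slack Xs i 0) ->
  \forall X \near Xs, forall i, 0 < pd_slack X i 0.
Proof.
move=> s0; apply: (filter_forall (nbhs_filter Xs)) => i.
have lin : linear (fun Z : 'M[R]_(d + 1) => dsubmx (dsubmx (ursubmx Z)) i 0).
  by move=> a u v; rewrite !mxE.
have [L LE] := linear_of lin.
have cL : {for Xs.2, continuous L} by exact: linear_mx_continuous.
have c : {for Xs, continuous (fun X : point => L X.2)}.
  by apply: (@continuous_comp _ _ _ snd L); [exact: cvg_snd|exact: cL].
have sE X : pd_slack X i 0 = L X.2 by rewrite LE.
have L0 : 0 < L Xs.2 by rewrite -sE.
have nL : \forall X \near Xs, 0 < L X.2 by have := cvgr_gt _ c; apply.
by apply: filterS nL => X /=; rewrite sE.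
Qed.

(** * Nondegeneracy and the lower bound on the KKT residual *)

Context (FXs : F Xs = 0).

(** The linearised constraint g + s = 0 gives the slack direction as - grad g
    zeta, and linearised complementarity gives s_i (nu direction)_i = nu_i
    (grad g_i zeta). Pairing the gradient rows with zeta then writes zero as
    the curvature form of the Lagrangian at zeta plus a sum of nonnegative
    terms, so zeta = 0 by the second-order condition; independence of the
    gradients of h then kills the lam component. *)
Lemma kkt_sensitivity_inj : 0 < mu -> (forall i, 0 < pd_slack Xs i 0) ->
  free ([seq grad S (fun Y => h Y j 0) Xs.1 | j : 'I_n2] ++
        [seq grad S (fun Y => g Y i 0) Xs.1 | i in active g Xs.1]) ->
  (forall zeta : 'cV[R]_(n * m), zeta != 0 ->
     (forall j, grad S (fun Y => h Y j 0) Xs.1 *m zeta = 0) ->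
     (forall i, i \in active g Xs.1 ->
        grad S (fun Y => g Y i 0) Xs.1 *m zeta = 0) ->
     0 < (zeta^T *m curvature S (lagrangian f g h (pd_nu Xs) (pd_lam Xs)) Xs.1 *m zeta) 0 0) ->
  forall w, J Xs *m w = 0 -> w = 0.
Proof.
move=> mu0 s0 /catl_free fr sosc w Jw.
have row r : (J Xs *m w) r 0 = 0 by rewrite Jw mxE.
set z := usubmx w.
pose t i := (grad S (gi i) Xs.1 *m z) 0 0.
have Et i : dir_slack w i 0 = - t i.
  have := row (rshift (n * m) (lshift (n2 + n1) i)).
  rewrite kkt_sensitivity_g // => /eqP.
  by rewrite addrC addr_eq0 => /eqP.
have Eh j : (grad S (hj j) Xs.1 *m z) 0 0 = 0.
  rewrite -(row (rshift (n * m) (rshift n1 (lshift n1 j)))).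
  by rewrite kkt_sensitivity_h.
have Es i : pd_slack Xs i 0 * dir_nu w i 0 = pd_nu Xs i 0 * t i.
  have := row (rshift (n * m) (rshift n1 (rshift n2 i))).
  rewrite kkt_sensitivity_slack // => /eqP.
  by rewrite addr_eq0 Et mulNr opprK mulrC => /eqP; rewrite [t i * _]mulrC mulrC => ->.
have Emu i : pd_slack Xs i 0 * pd_nu Xs i 0 = mu.
  have := kkt_slack Xs i; rewrite FXs mxE => /esym/eqP.
  by rewrite subr_eq0 => /eqP.
have nu0 i : 0 < pd_nu Xs i 0 by rewrite -(pmulr_rgt0 _ (s0 i)) Emu.
(* Multiplied by s_i, this product is nu_i times a square. *)
have at0 i : 0 <= dir_nu w i 0 * t i.
  rewrite -(pmulr_rge0 _ (s0 i)) mulrA Es -mulrA.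
  by apply: mulr_ge0; [exact: ltW|rewrite -expr2 sqr_ge0].
pose L := lagrangian f g h (pd_nu Xs) (pd_lam Xs).
have Eg c : (curvature S L Xs.1 *m z) c 0
  + \sum_j dir_nu w j 0 * grad S (gi j) Xs.1 0 c
  + \sum_j dir_lam w j 0 * grad S (hj j) Xs.1 0 c = 0.
  have := row (lshift d c).
  rewrite kkt_sensitivity_grad //.
have z0 : z = 0.
  apply/eqP; apply: contraT => zn0.
  have Hpos : 0 < (z^T *m curvature S L Xs.1 *m z) 0 0.
    apply: sosc => // [j|i].
      by apply/matrixP => a b; rewrite !ord1 [RHS]mxE; exact: Eh.
    rewrite inE => /eqP gi0; have := kkt_g Xs i.
    by rewrite FXs mxE /component gi0 add0r => s0'; have := s0 i; rewrite -s0' ltxx.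
  have : \sum_c z c 0 * ((curvature S L Xs.1 *m z) c 0
    + \sum_j dir_nu w j 0 * grad S (gi j) Xs.1 0 c
    + \sum_j dir_lam w j 0 * grad S (hj j) Xs.1 0 c) = 0.
    by apply: big1 => c _; rewrite Eg mulr0.
  under eq_bigr do rewrite !mulrDr.
  rewrite !big_split /=.
  have -> : \sum_c z c 0 * (curvature S L Xs.1 *m z) c 0 =
      (z^T *m curvature S L Xs.1 *m z) 0 0.
    by rewrite -mulmxA [RHS]mxE; apply: eq_bigr => c _; rewrite [z^T _ _]mxE.
  have sw k (a : 'I_k -> R) (v : 'I_k -> 'rV[R]_(n * m)) :
     \sum_c z c 0 * \sum_j a j * v j 0 c = \sum_j a j * (v j *m z) 0 0.
    under eq_bigr do rewrite mulr_sumr.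
    rewrite exchange_big; apply: eq_bigr => j _; rewrite mxE mulr_sumr.
    by apply: eq_bigr => c _; rewrite mulrCA [z _ _ * _]mulrC.
  rewrite !sw [X in _ + _ + X = _]big1 ?addr0 => [|j _]; last by rewrite Eh mulr0.
  move=> E; have : 0 < (z^T *m curvature S L Xs.1 *m z) 0 0 +
      \sum_i dir_nu w i 0 * (grad S (gi i) Xs.1 *m z) 0 0.
    by rewrite ltr_wpDr // sumr_ge0 // => i _; exact: at0.
  by rewrite E ltxx.
have t0 i : t i = 0 by rewrite /t z0 mulmx0 mxE.
have c0 : dir_slack w = 0.
  by apply/matrixP => i j; rewrite ord1 Et t0 oppr0 mxE.
have a0 : dir_nu w = 0.
  apply/matrixP => i j; rewrite ord1 [RHS]mxE; apply/eqP.
  by have /eqP := Es i; rewrite t0 mulr0 mulf_eq0 gt_eqF.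
have b0 : dir_lam w = 0.
  apply/matrixP => i j; rewrite ord1 [RHS]mxE.
  apply: (free_rows_eq0 (c := fun j => dir_lam w j 0) fr) => b.
  rewrite -[RHS](Eg b) z0 mulmx0 mxE add0r a0 [X in _ = X + _]big1 ?add0r // => k _.
  by rewrite mxE mul0r.
rewrite -(vsubmxK w) -/z z0 -(vsubmxK (dsubmx w)) -(vsubmxK (dsubmx (dsubmx w))).
rewrite -/(dir_nu w) -/(dir_lam w) -/(dir_slack w) a0 b0 c0.
by rewrite !col_mx0.
Qed.

Context (Jinj : forall w, J Xs *m w = 0 -> w = 0).

(** Each row of J Xs w is a differential applied to the velocity of w. *)
Lemma kkt_sensitivity_velocity w : vel Xs w = 0 -> J Xs *m w = 0.
Proof.
move=> v0; apply/matrixP => r j; rewrite ord1 kkt_sensitivity_sens [RHS]mxE.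
have [U [psi [oU Ux cU pp]]] := kkt_C1_near r HXs.
by rewrite (sens_diff _ (pd_is_flow Ggrp GS) oU cU pp Ux HXs) v0 linear0.
Qed.

(** A vector killed by S, placed in the i-th block, would be a nonzero direction
    of zero velocity, hence in the kernel of J Xs. So S is injective into the
    Lie algebra, and both spaces have dimension m. *)
Lemma lie_algebra_surj (i : 'I_n) B : lie_dim G m -> lie_algebra G B ->
  exists zeta, S zeta = B.
Proof.
move=> [V [VG dV]] GB.
have Sinj : injective S.
  move=> a b Sab; apply/eqP; rewrite -subr_eq0; apply/eqP.
  pose c := a - b; have Sc : S c = 0 by rewrite linearB Sab subrr.
  (* A direction that moves the i-th entry by c and nothing else. *)
  pose z : 'cV[R]_(n * m) := (mxvec (\matrix_(k, l) (if k == i then c l 0 else 0)))^T.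
  have bz k : block z k = if k == i then c else 0.
    apply/matrixP => l j; rewrite ord1 !mxE mxvecE mxE.
    by case: eqP => _; rewrite ?mxE.
  have w0 : col_mx z 0 = 0 :> 'cV[R]_(n * m + d).
    apply: Jinj; apply: kkt_sensitivity_velocity.
    rewrite /pd_velocity col_mxKu col_mxKd; congr pair.
      apply: entryP => k; rewrite entry_mktuple bz.
      have -> : S (if k == i then c else 0) = 0 by case: (k == i); rewrite ?Sc ?linear0.
      by rewrite mulmx0; apply/matrixP => p q; rewrite entryE !mxE.
    by rewrite -[0](scale0r (0 : 'cV[R]_d)) trans_algZ scale0r mulmx0.
  have : z = 0 by rewrite -(col_mxKu z (0 : 'cV[R]_d)) w0 linear0.
  move=> z0; have := bz i; rewrite eqxx z0 -/c => <-.
  by apply/matrixP => l j; rewrite !mxE.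
pose L := linfun S.
have LE a : L a = S a by rewrite lfunE.
have kerL : lker L == 0%VS by apply/lker0P => a b; rewrite !LE; exact: Sinj.
have LV : (limg L <= V)%VS.
  by apply/subvP => A /memv_imgP[a _ ->]; rewrite LE; apply/VG.
have dL : \dim (limg L) = m.
  rewrite limg_dim_eq; last by rewrite (eqP kerL) capv0.
  by rewrite dimvf /dim /= muln1.
have : (limg L == V)%VS by rewrite eqEdim LV dV dL leqnn.
move=> /eqP LVE; have : B \in V by apply/VG.
by rewrite -LVE => /memv_imgP[a _ ->]; exists a; rewrite LE.
Qed.

(** By contradiction, along points X_k of the group with |F X_k| = o(|X_k -
    Xs|). The normalised differences have a limit of norm 1 along an
    ultrafilter; this limit is a velocity vel Xs w, and the differential of F
    kills it, so J Xs w = 0 and w = 0. *)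
Lemma kkt_lower_bound : lie_dim G m ->
  exists2 k : R, 0 < k & \forall X \near Xs, H X -> k * `|X - Xs| <= `|F X|.
Proof.
move=> Gdim; apply: contrapT => noK.
have ex (k : nat) : exists X : point, [/\ H X, `|X - Xs| < k.+1%:R^-1 &
    `|F X| < k.+1%:R^-1 * `|X - Xs| ].
  apply: contrapT => nX; apply: noK; exists k.+1%:R^-1; first by rewrite invr_gt0.
  apply/nbhs_ballP; exists k.+1%:R^-1; first by rewrite /= invr_gt0.
  move=> X; rewrite -ball_normE /= distrC => XXs HX.
  by rewrite leNgt; apply/negP => FX; apply: nX; exists X.
have [X HX] := choice ex.
pose t k := `|X k - Xs|.
have t0 k : 0 < t k.
  have [_ _ FX] := HX k.
  by have := le_lt_trans (normr_ge0 _) FX; rewrite pmulr_rgt0 // invr_gt0.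
pose W k : point := (t k)^-1 *: (X k - Xs).
have W1 k : `|W k| = 1 by rewrite normrZ normfV normr_id mulVf // gt_eqF // t0.
have [U [UU oU]] := ultraFilterLemma (eventually_filter : ProperFilter \oo).
have UP := @ultra_proper _ _ UU.
have [W0 cW0] : exists l : mxtuple R n N, (W k).1 @[k --> U] --> l.
  apply: (@ultra_cvg_mx R nat U _ _ (fun k => (W k).1) 1) => //; apply: nearW => k.
  by have := lexx `|W k|; rewrite {1}ler_pair_norm W1 => /andP[].
have [Z0 cZ0] : exists l : 'M[R]_(d + 1), (W k).2 @[k --> U] --> l.
  apply: (@ultra_cvg_mx R nat U _ _ (fun k => (W k).2) 1) => //; apply: nearW => k.
  by have := lexx `|W k|; rewrite {1}ler_pair_norm W1 => /andP[].
pose Winf : point := (W0, Z0).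
have cW : W k @[k --> U] --> Winf.
  rewrite (_ : W = fun k => ((W k).1, (W k).2)); first exact: (cvg_pair cW0 cZ0).
  by apply/funext => k; case: (W k).
have tlt k : t k < k.+1%:R^-1 by case: (HX k).
(* The ultrafilter refines the filter at infinity, so that limits of sequences
   persist along it. *)
have invU : (k.+1%:R^-1 : R) @[k --> U] --> (0 : R).
  move=> A nA; apply: oU; exact: (@cvg_harmonic R A nA).
have tU : t k @[k --> U] --> (0 : R).
  apply/cvgr0Pnorm_le => e e0; near=> k.
  apply: (@le_trans _ _ `|k.+1%:R^-1 : R|).
    by rewrite normr_id [leRHS]ger0_norm ?invr_ge0 // ltW // tlt.
  by near: k; exact: cvgr0_norm_le.
have XU : X k @[k --> U] --> Xs.
  apply/cvgrPdist_lt => e e0.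
  move/cvgrPdist_lt : tU => /(_ e e0); apply: filterS => k.
  by rewrite sub0r normrN /t normr_id distrC.
(* The limit direction is annihilated by the differential of each row. *)
have dF r : exists U0 psi, [/\ open U0, U0 Xs, C1 U0 psi,
    forall Y : point, U0 Y -> H Y -> psi Y = F Y r 0 & 'd psi Xs Winf = 0].
  have [U0 [psi [oU0 Ux cU pp]]] := kkt_C1_near r HXs.
  exists U0, psi; split => //.
  have [dpsi _] := cU _ Ux.
  have c1 : 'd psi Xs (W k) @[k --> U] --> 'd psi Xs Winf.
    have cd : {for Winf, continuous ('d psi Xs)} by exact: diff_continuous.
    exact: (@cvg_comp _ _ _ W ('d psi Xs) _ _ _ cW cd).
  have c2 : 'd psi Xs (W k) @[k --> U] --> (0 : R).
    apply/cvgr0Pnorm_le => e e0; near=> k.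
    have HXk : H (X k) by case: (HX k).
    have U0X : U0 (X k).
      by near: k; exact: (XU _ (open_nbhs_nbhs (conj oU0 Ux))).
    have E : `|psi (X k) - psi Xs - 'd psi Xs (X k - Xs)| <= e / 2 * t k.
      by near: k; exact: (XU _ (differentiable_expansion dpsi (divr_gt0 e0 (ltr0Sn R 1)))).
    have Fk : `|psi (X k)| <= e / 2 * t k.
      rewrite pp // (le_trans (ler_mx_entry _ _ _)) //.
      have [_ _ /ltW FX] := HX k; rewrite (le_trans FX) // ler_wpM2r //.
      rewrite -[k.+1%:R^-1]ger0_norm ?invr_ge0 //.
      by near: k; apply: cvgr0_norm_le => //; rewrite divr_gt0.
    rewrite /W linearZ normrZ normfV (ger0_norm (ltW (t0 k))) ler_pdivrMl //.
    rewrite (pp Xs) // FXs mxE subr0 in E.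
    rewrite -[X in `|X|](subKr (psi (X k))) (le_trans (ler_normB _ _)) //.
    by rewrite (le_trans (lerD Fk E)) // -mulrDl -splitr mulrC.
  exact: (cvg_unique _ c1 c2).
have [GXs [zs _ Zs]] := HXs.
have [Gunit _ GM GV _] := Ggrp.
(* Each component of the limit direction is tangent to the group, after
   translation to the identity. *)
have tang i : exists zeta, entry Xs.1 i *m S zeta = entry W0 i.
  have Ui : entry Xs.1 i \in unitmx by exact: (Gunit _ (GXs i)).
  have cWi : entry (W k).1 i @[k --> U] --> entry W0 i.
    have [L LE] := linear_of (@entry_linear R n N i).
    have -> : entry W0 i = L W0 by rewrite LE.
    have -> : (fun k => entry (W k).1 i) = fun k => L (W k).1 by rewrite LE.
    have cL : {for W0, continuous L} by exact: linear_mx_continuous.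
    exact: (@cvg_comp _ _ _ (fun k => (W k).1) L _ _ _ cW0 cL).
  have [zeta zE] : exists zeta, S zeta = invmx (entry Xs.1 i) *m entry W0 i.
    apply: (lie_algebra_surj i Gdim).
    apply: (@tangent_lie_algebra R N nat U UP G
      (fun k => invmx (entry Xs.1 i) *m entry (X k).1 i) t _ Ggrp) => //.
    - by apply: nearW => k; apply: GM; [exact: GV|case: (HX k) => -[GXk _] _ _; exact: GXk].
    - exact: nearW.
    - rewrite (_ : (fun k => _) = fun k => invmx (entry Xs.1 i) *m entry (W k).1 i).
        by apply: cvg_mulmx; [exact: cvg_cst|exact: cWi].
      apply/funext => k; rewrite -(mulVmx Ui) -mulmxBr scalemxAr; congr (_ *m _).
      by apply/matrixP => a b; rewrite mxE subr_mxE !entryE !mxE.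
  by exists zeta; rewrite zE mulKVmx.
have [zeta zetaE] := choice tang.
(* Differences of translation matrices are translation generators, and these
   are unchanged by left multiplication by a translation. *)
have ZE : Xs.2 *m trans_alg (ursubmx Z0) = Z0.
  have Zk k : (W k).2 = trans_alg (ursubmx (W k).2).
    case: (HX k) => -[_ [zk _ Zk]] _ _.
    have -> : (W k).2 = (t k)^-1 *: (trans_mx zk - trans_mx zs) by rewrite Zk Zs.
    rewrite /trans_mx opp_block_mx add_block_mx scale_block_mx !subrr !scaler0 block_mxKur.
    by [].
  have cz : trans_alg (ursubmx (W k).2) @[k --> U] --> trans_alg (ursubmx Z0).
    have lin : linear (fun Z : 'M[R]_(d + 1) => trans_alg (ursubmx Z)).
      move=> a u v; rewrite -trans_alg_linear; congr trans_alg.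
      by apply/matrixP => p q; rewrite !mxE.
    have [L LE] := linear_of lin.
    have -> : (fun k => trans_alg (ursubmx (W k).2)) = fun k => L (W k).2 by rewrite LE.
    have -> : trans_alg (ursubmx Z0) = L Z0 by rewrite LE.
    have cL : {for Z0, continuous L} by exact: linear_mx_continuous.
    exact: (@cvg_comp _ _ _ (fun k => (W k).2) L _ _ _ cZ0 cL).
  have -> : Z0 = trans_alg (ursubmx Z0).
    have EZ : (fun k => trans_alg (ursubmx (W k).2)) = (fun k => (W k).2).
      by apply/funext => k; rewrite -Zk.
    rewrite EZ in cz; apply: (cvg_unique _ cZ0 cz); exact: norm_hausdorff.
  rewrite -Zs /trans_mx /trans_alg block_mxKur mulmx_block.
  by rewrite !mul0mx !mulmx0 !addr0 mul1mx.
pose w : 'cV[R]_(n * m + d) :=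
  col_mx (mxvec (\matrix_(i, a) zeta i a 0))^T (ursubmx Z0).
have velw : vel Xs w = Winf.
  rewrite /pd_velocity col_mxKu col_mxKd ZE; congr pair; apply: entryP => i.
  rewrite entry_mktuple -zetaE; congr (_ *m S _).
  by apply/matrixP => a b; rewrite ord1 !mxE mxvecE mxE.
have w0 : w = 0.
  apply: Jinj; apply/matrixP => r j; rewrite ord1 kkt_sensitivity_sens [RHS]mxE.
  have [U0 [psi [oU0 Ux cU pp dW]]] := dF r.
  by rewrite (sens_diff _ (pd_is_flow Ggrp GS) oU0 cU pp Ux HXs) velw.
have W00 : Winf = 0.
  have [L LE] := linear_of (@pd_velocity_linear R n N m n1 n2 S Xs).
  by rewrite -velw w0 -LE linear0.
have : `|Winf| = 1.
  have c1 : `|W k| @[k --> U] --> `|Winf| by exact: cvg_norm.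
  apply: (cvg_unique _ c1); first exact: norm_hausdorff.
  have -> : (fun k => `|W k|) = cst 1 by apply/funext => k; rewrite W1.
  exact: cvg_cst.
by rewrite W00 normr0 => /eqP; rewrite eq_sym oner_eq0.
Unshelve. all: by end_near. Qed.

(** * Contraction of the residual and convergence *)

Context (s0 : forall i, 0 < pd_slack Xs i 0) (Gdim : lie_dim G m).

Lemma kkt_local_estimates : exists k r : R, [/\ 0 < k, 0 < r, r <= 1 &
  forall X, H X -> `|X - Xs| < r ->
    [/\ k * `|X - Xs| <= res X, forall w, k * enorm w <= enorm (J X *m w) &
        forall i, 0 < pd_slack X i 0]].
Proof.
have [k1 k10 n1'] := kkt_lower_bound Gdim.
have [k2 k20 n2'] := kkt_sensitivity_lower Jinj.
have n3 := near_slack s0.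
pose k := Num.min k1 (k2 / (D%:R + 1)).
have k0 : 0 < k by rewrite lt_min k10 divr_gt0 // ltr_wpDl.
have n12 : \forall X \near Xs, [/\ H X -> k1 * `|X - Xs| <= `|F X|,
   H X -> forall w, k2 * `|w| <= `|J X *m w| & forall i, 0 < pd_slack X i 0].
  by apply: filterS3 n1' n2' n3 => X.
have /nbhs_ballP[r /= r0 Hr] := n12.
exists k, (Num.min r 1); split => //; first by rewrite lt_min r0 ltr01.
  by rewrite ge_min lexx orbT.
move=> X HX; rewrite lt_min => /andP[Xr _].
have [|a b c] := Hr X; first by rewrite -ball_normE /= distrC.
split => // [|w].
  rewrite (le_trans _ (ler_norm_enorm _)) // (le_trans _ (a HX)) // ler_wpM2r //.
  by rewrite ge_min lexx.
rewrite (le_trans _ (ler_norm_enorm _)) // (le_trans _ (b HX w)) //.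
apply: (@le_trans _ _ (k2 / (D%:R + 1) * enorm w)).
  by rewrite ler_wpM2r ?enorm_ge0 // ge_min lexx orbT.
rewrite -mulrA ler_pM2l // ler_pdivrMl ?ltr_wpDl //.
by rewrite (le_trans (ler_enorm_norm _)) // ler_wpM2r // lerDl.
Qed.

(** As J X is bounded below, |w| is at most |F X| + |rho| up to the factor k. *)
Lemma newton_step_length (k b : R) X w rho : 0 < k -> b <= 1 ->
  (forall w, k * enorm w <= enorm (J X *m w)) ->
  J X *m w = - F X + rho -> enorm rho <= b * res X -> enorm w <= 2 / k * res X.
Proof.
move=> k0 b1 low JE rb; rewrite mulrAC ler_pdivlMr // mulrC (le_trans (low w)) // JE.
rewrite (le_trans (ler_enormD _ _)) // enormN mulrDl mul1r lerD2l (le_trans rb) //.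
by rewrite ler_piMl // enorm_ge0.
Qed.

(** Substituting the Newton equation J X w = - F X + rho in the first-order
    expansion of F leaves (1 - al) F X + al rho and the remainder. *)
Lemma newton_step_residual (al ep : R) X w rho : 0 < al <= 1 ->
  J X *m w = - F X + rho ->
  enorm (F (upd X (al *: w)) - F X - J X *m (al *: w)) <= ep ->
  res (upd X (al *: w)) <= (1 - al) * res X + al * enorm rho + ep.
Proof.
move=> /andP[al0 al1] JE rem.
have -> : F (upd X (al *: w)) = ((1 - al) *: F X + al *: rho)
    + (F (upd X (al *: w)) - F X - J X *m (al *: w)).
  rewrite -scalemxAr JE scalerDr scalerN scalerBl scale1r.
  by apply/matrixP => i j; rewrite !mxE; ring.
apply: (le_trans (ler_enormD _ _)); apply: lerD; last exact: rem.
apply: (le_trans (ler_enormD _ _)).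
by rewrite !enormZ (gtr0_norm al0) ger0_norm ?subr_ge0.
Qed.

Lemma near_residual_le (dl : R) : 0 < dl -> \forall X \near Xs, H X -> res X <= dl.
Proof.
move=> dl0; have D0 : 0 < D%:R + 1 :> R by rewrite ltr_wpDl.
have := kkt_continuous (divr_gt0 dl0 D0).
apply: filterS => X FX HX; have := FX HX; rewrite FXs subr0 ler_pdivlMr // => FXd.
rewrite (le_trans (ler_enorm_norm _)) // (le_trans _ FXd) // mulrC ler_wpM2l //.
by rewrite lerDl.
Qed.

(** The perturbation costs al b |F X| with b < 1, so the linear part contracts
    by 1 - al (1 - b). Half of the gap al (1 - b) is spent on the remainder: as
    |al w| <= (2 / k) |F X|, a relative error ep = k al (1 - b) / 4 is enough.
    The bound dl on the residual also keeps the next iterate within r0 of Xs,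
    since both |X - Xs| and the length of the step are multiples of |F X|. *)
Lemma newton_local_contraction (k r0 al C : R) (p : nat) :
  0 < k -> 0 < r0 -> r0 <= 1 ->
  (forall X, H X -> `|X - Xs| < r0 ->
    [/\ k * `|X - Xs| <= res X, forall w, k * enorm w <= enorm (J X *m w) &
        forall i, 0 < pd_slack X i 0]) ->
  0 < al <= 1 -> (p = 1%N /\ C < 1) \/ p = 2%N ->
  exists th dl : R, [/\ 0 < th < 1, 0 < dl &
    forall X w rho, H X -> `|X - Xs| < r0 -> res X <= dl ->
      J X *m w = - F X + rho -> (rho = 0 \/ enorm rho <= C * res X ^+ p) ->
      [/\ H (upd X (al *: w)), `|upd X (al *: w) - Xs| < r0,
          res (upd X (al *: w)) <= th * res X & enorm w <= 2 / k * res X] ].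
Proof.
move=> k0 r00 r01 loc al01 pC; have /andP[al0 al1] := al01.
have [b [dl0 [b0 b1 dl00 rb]]] := @residual_bound R D p C pC.
have q0 : 0 < al * (1 - b) by rewrite mulr_gt0 // subr_gt0.
have q1 : al * (1 - b) <= 1.
  have b2 : 0 <= 1 - b <= 1 by apply/andP; split; lra.
  by have /andP[b3 b4] := b2; rewrite mulr_ile1 // ltW.
pose ep := k * (al * (1 - b)) / 4.
have ep0 : 0 < ep by rewrite divr_gt0 // mulr_gt0.
have [r r00' Hr] := newton_remainder_small ep0.
have [K K0 HK] := @pd_update_displacement R n N m n1 n2 S Xs.
pose rr := Num.min r r0; have rr0 : 0 < rr by rewrite lt_min r00' r00.
have A0 : 0 < 3 + 2 * K by rewrite addr_gt0 // mulr_gt0.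
pose dl := Num.min dl0 (k * (rr / 2 / (3 + 2 * K))).
have dlp : 0 < dl by rewrite lt_min dl00 !(mulr_gt0, divr_gt0, invr_gt0).
exists (1 - al * (1 - b) / 2), dl; split => //; first by apply/andP; split; lra.
move=> X w rho HX Xr eX JE rC.
have [lb low _] := loc X HX Xr.
have e0 : 0 <= res X := enorm_ge0 _.
have eX1 : res X <= dl0 by rewrite (le_trans eX) // ge_min lexx.
have eX2 : (3 + 2 * K) * (res X / k) <= rr / 2.
  rewrite mulrC -ler_pdivlMr // ler_pdivrMr // mulrC (le_trans eX) //.
  by rewrite ge_min lexx orbT.
have ek0 : 0 <= res X / k by rewrite divr_ge0 // ltW.
have Kek0 : 0 <= K * (res X / k) by rewrite mulr_ge0 // ltW.
have Xek : `|X - Xs| <= res X / k by rewrite ler_pdivlMr // mulrC.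
have rrr : rr <= r by rewrite ge_min lexx.
have rrr0 : rr <= r0 by rewrite ge_min lexx orbT.
have eX3 : 3 * (res X / k) + 2 * (K * (res X / k)) <= rr / 2.
  by rewrite [2 * (K * _)]mulrA -mulrDl.
have [A1 A2 A3 A4] : [/\ 2 * (res X / k) < r, 2 * (res X / k) < 1,
    2 * (K * (res X / k)) + res X / k < r0 & res X / k <= 2 * (res X / k)].
  by clear -ek0 Kek0 eX3 rrr rrr0 rr0 r01; split; lra.
have rbX : enorm rho <= b * res X by apply: rb => //; rewrite e0 eX1.
have we := newton_step_length k0 (ltW b1) low JE rbX.
have wek : enorm (al *: w) <= 2 * (res X / k).
  rewrite enormZ (gtr0_norm al0) (le_trans (_ : _ <= enorm w)) //.
    by rewrite ler_piMl ?enorm_ge0.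
  by rewrite (le_trans we) // mulrAC mulrA.
have wr : enorm (al *: w) < r := le_lt_trans wek A1.
have w1 : `|al *: w| < 1 := le_lt_trans (le_trans (ler_norm_enorm _) wek) A2.
have Xr' : `|X - Xs| < r := le_lt_trans (le_trans Xek A4) A1.
have X1 : `|X - Xs| < 1 := lt_le_trans Xr r01.
have rem := Hr X (al *: w) HX Xr' wr.
have est := newton_step_residual al01 JE rem.
split => //; first exact: pd_group_update.
- apply: (le_lt_trans (ler_distD X _ _)).
  have h1 := HK X (al *: w) X1 w1.
  have h2 : K * `|al *: w| <= K * (2 * (res X / k)).
    by rewrite ler_wpM2l ?(le_trans (ler_norm_enorm _)) // ltW.
  have h3 : K * (2 * (res X / k)) = 2 * (K * (res X / k)) by ring.
  by rewrite (le_lt_trans _ A3) // lerD // -h3 (le_trans h1).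
- apply: (le_trans est).
  have h1 : al * enorm rho <= al * (b * res X) by rewrite ler_wpM2l // ltW.
  have h2 : ep * enorm (al *: w) <= al * (1 - b) / 2 * res X.
    have -> : al * (1 - b) / 2 * res X = ep * (2 * (res X / k)).
      by rewrite /ep; field; rewrite gt_eqF.
    by rewrite ler_wpM2l // ltW.
  have h3 : (1 - al * (1 - b) / 2) * res X =
      (1 - al) * res X + al * (b * res X) + al * (1 - b) / 2 * res X.
    by field.
  by rewrite h3; apply: lerD => //; rewrite lerD2l.
Qed.

End KKT.

Lemma cvg_geometric_bound (R : realType) (V : normedModType R) (u : nat -> V) (l : V)
    (A th : R) : 0 < th < 1 -> (forall k, `|u k - l| <= th ^+ k * A) -> u @ \oo --> l.
Proof.
move=> /andP[th0 th1] ul; apply/cvgrPdist_lt => eps eps0.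
have c : geometric A th @ \oo --> 0 by apply: cvg_geometric; rewrite ger0_norm // ltW.
have nc : \forall k \near \oo, `|0 - geometric A th k| < eps by move/cvgrPdist_lt : c; exact.
apply: filterS nc => k; rewrite sub0r normrN => kA.
by rewrite distrC (le_lt_trans (ul k)) // (le_lt_trans (ler_norm _)) // mulrC.
Qed.

Theorem theorem2 (R : realType) (N m n n1 n2 : nat)
    (G : set 'M[R]_N) (S : {linear 'cV[R]_m -> 'M[R]_N})
    (f : mxtuple R n N -> R) (g : mxtuple R n N -> 'cV[R]_n1)
    (h : mxtuple R n N -> 'cV[R]_n2) (mu : R) (Xs : pd_type R n N n1 n2) :
  matrix_lie_group G -> lie_dim G m ->
  (forall zeta, lie_algebra G (S zeta)) ->
  C2_on_group G f ->
  (forall i, C2_on_group G (fun Y => g Y i 0)) ->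
  (forall j, C2_on_group G (fun Y => h Y j 0)) ->
  (exists Y, feasible g h G Y) ->
  (exists Y, strictly_feasible g h G Y) ->
  0 < mu ->
  pd_point G Xs ->
  let F := kkt S f g h mu in
  let J := pd_sensitivity S F in
  let L := lagrangian f g h (pd_nu Xs) (pd_lam Xs) in
  F Xs = 0 ->
  free ([seq grad S (fun Y => h Y j 0) Xs.1 | j : 'I_n2] ++
        [seq grad S (fun Y => g Y i 0) Xs.1 | i in active g Xs.1]) ->
  (forall i, g Xs.1 i 0 = 0 -> 0 < pd_nu Xs i 0) ->
  (forall zeta : 'cV[R]_(n * m), zeta != 0 ->
     (forall j, grad S (fun Y => h Y j 0) Xs.1 *m zeta = 0) ->
     (forall i, i \in active g Xs.1 ->
        grad S (fun Y => g Y i 0) Xs.1 *m zeta = 0) ->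
     0 < (zeta^T *m curvature S L Xs.1 *m zeta) 0 0) ->
  exists U : set (pd_type R n N n1 n2), nbhs Xs U /\
    forall (alpha C : R) (p : nat),
      0 < alpha <= 1 -> (p = 1%N /\ C < 1) \/ p = 2%N ->
      exists V : set (pd_type R n N n1 n2), nbhs Xs V /\
        forall (X : nat -> pd_type R n N n1 n2)
               (dx rho : nat -> 'cV[R]_(n * m + pd_dim n1 n2)),
          U (X 0%N) -> V (X 0%N) -> pd_point G (X 0%N) ->
          let step k := newton_step S f g h mu alpha X dx rho k /\
            (rho k = 0 \/ enorm (rho k) <= C * enorm (F (X k)) ^+ p) in
          (forall K, (forall k, (k < K)%N -> step k) ->
             [/\ U (X K), pd_point G (X K) &
                 forall r, exists! d, J (X K) *m d = - F (X K) + r]) /\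
          ((forall k, step k) ->
             [/\ X @ \oo --> Xs,
                 (alpha = 1 -> p = 2%N ->
                  (exists M : R, \forall Y \near Xs.1, in_group G Y ->
                     `|curvature S L Y - curvature S L Xs.1|
                       <= M * `|Y - Xs.1|) ->
                  quadratic_rate (fun k => enorm (F (X k)))),
                 (alpha = 1 -> p = 1%N ->
                  linear_rate (fun k => enorm (F (X k)))) &
                 (alpha < 1 -> p = 1%N ->
                  linear_rate (fun k => enorm (F (X k))))]).
Proof.
move=> Ggrp Gdim GS C2f C2g C2h _ _ mu0 [GXs ZXs s0] F J L FXs fr _ sosc.
have HXs : pd_group G Xs by split.
have Jinj : forall w : 'cV[R]_(n * m + pd_dim n1 n2), J Xs *m w = 0 -> w = 0.
  exact: (kkt_sensitivity_inj Ggrp GS C2f C2g C2h HXs FXs mu0 s0 fr sosc).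
have [k [r0 [k0 r00 r01 loc]]] :=
  kkt_local_estimates Ggrp GS C2f C2g C2h HXs FXs Jinj s0 Gdim.
exists [set X | `|X - Xs| < r0]; split.
  by have near_r0 := near_ball_lt Xs r00; apply near_r0.
move=> al C p al01 pC; have /andP[al0 al1] := al01.
have [th [dl [th01 dl0 contr]]] := newton_local_contraction Ggrp GS C2f C2g C2h
  HXs k0 r00 r01 loc al01 pC.
have /andP[th0 th1] := th01.
exists [set X | pd_group G X -> enorm (F X) <= dl]; split.
  exact: (near_residual_le Ggrp GS C2f C2g C2h HXs FXs dl0).
move=> X dx rho U0 V0 [GX0 ZX0 _] step.
have H0 : pd_group G (X 0%N) by split.
(* Membership in the group and proximity to Xs are invariants; the geometric
   decay of the residual keeps it below the threshold dl. *)
pose inv j := [/\ pd_group G (X j), `|X j - Xs| < r0 &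
  enorm (F (X j)) <= th ^+ j * enorm (F (X 0%N))].
have dlj j : inv j -> enorm (F (X j)) <= dl.
  move=> [_ _ ej]; rewrite (le_trans ej) // (le_trans _ (V0 H0)) //.
  by rewrite ler_piMl ?enorm_ge0 // exprn_ile1 // ltW.
have inv0 : inv 0%N by split => //; rewrite expr0 mul1r.
have stepE j : inv j -> step j -> [/\ inv j.+1,
    enorm (F (X j.+1)) <= th * enorm (F (X j)) &
    enorm (dx j) <= 2 / k * enorm (F (X j))].
  move=> invj [[Jdx XS] rC]; have [Hj Xj ej] := invj.
  have [Hj' Xj' ej' dxj] : [/\ pd_group G (X j.+1), `|X j.+1 - Xs| < r0,
      enorm (F (X j.+1)) <= th * enorm (F (X j)) &
      enorm (dx j) <= 2 / k * enorm (F (X j))].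
    by rewrite XS; exact: (contr (X j) (dx j) (rho j) Hj Xj (dlj j invj) Jdx rC).
  split; [split; [exact: Hj'|exact: Xj'|]|exact: ej'|exact: dxj].
  apply: (le_trans ej'); rewrite exprS -mulrA.
  by apply: ler_wpM2l; [exact: ltW|exact: ej].
have invK K : (forall j, (j < K)%N -> step j) -> inv K.
  elim: K => [//|K IH] stK.
  have invK : inv K by apply: IH => j jK; apply: stK; exact: ltnW.
  by case: (stepE K invK (stK K (leqnn _))).
split=> [K stK|st].
  have [HK XK _] := invK K stK; have [_ low sK] := loc (X K) HK XK.
  split => //; first by case: HK.
  move=> r; apply: unitmx_unique_solution; apply: mulmx_inj_unit => w Jw.
  apply: enorm0_eq0; apply/eqP; rewrite eq_le enorm_ge0 andbT.
  have := low w; rewrite Jw => /le_trans => /(_ 0).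
  rewrite pmulr_rle0 //; apply.
  by rewrite (le_trans (ler_enorm_norm _)) // normr0 mulr0.
have inva j : inv j by apply: invK => i _; exact: st.
have lin : linear_rate (fun j => enorm (F (X j))).
  exists th; split => //; apply: nearW => j.
  by case: (stepE j (inva j) (st j)).
have Xk j : `|X j - Xs| <= enorm (F (X j)) / k.
  have [Hj Xj _] := inva j; have [lb _ _] := loc (X j) Hj Xj.
  by rewrite ler_pdivlMr // mulrC.
have cX : X @ \oo --> Xs.
  apply: (cvg_geometric_bound (A := enorm (F (X 0%N)) / k) th01) => j.
  rewrite (le_trans (Xk j)) // mulrA ler_wpM2r ?invr_ge0 ?(ltW k0) //.
  by case: (inva j).
split => // al1E p2 lipH.
have [M [r [M0 r1 HM]]] := newton_remainder_quadratic mu Ggrp GS C2f C2g C2h HXs lipH.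
exists (`|C| + M * (3 / k) * (2 / k)).
have ce : (fun j => enorm (F (X j))) @ \oo --> (0 : R).
  apply: (cvg_geometric_bound (A := enorm (F (X 0%N))) th01) => j.
  by rewrite subr0 ger0_norm ?enorm_ge0 //; case: (inva j).
have rk0 : 0 < r * k / 2 by rewrite !mulr_gt0 // invr_gt0.
have nce : \forall j \near \oo, `|0 - enorm (F (X j))| < r * k / 2.
  by move/cvgrPdist_lt : ce; exact.
near=> j; have e0 : 0 <= enorm (F (X j)) := enorm_ge0 _.
have [_ _ dxj] := stepE j (inva j) (st j).
have [[Jdx XS] rC] := st j; have [Hj Xj _] := inva j.
have ej : enorm (F (X j)) < r * k / 2.
  by rewrite -[ltLHS]ger0_norm // -normrN -sub0r; near: j.
set E := enorm (F (X j)) in e0 dxj ej.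
have XE : `|X j - Xs| <= E / k := Xk j.
have dE : 2 / k * E < r.
  by rewrite mulrAC ltr_pdivrMr // mulrC -ltr_pdivlMr.
have EE : E / k <= 2 / k * E.
  rewrite mulrC -[leLHS]mul1r mulrA; apply: ler_wpM2r => //.
  by rewrite mul1r ler_pdivlMr // mulVf ?gt_eqF // ler1n.
have XS1 : X j.+1 = pd_update S (X j) (dx j) by rewrite XS al1E scale1r.
have rem := HM (X j) (dx j) Hj (le_lt_trans (le_trans XE EE) dE) (le_lt_trans dxj dE).
have rhoE : enorm (rho j) <= `|C| * E ^+ 2.
  case: rC => [->|]; last first.
    rewrite p2 => /le_trans; apply; apply: ler_wpM2r; [exact: sqr_ge0|exact: ler_norm].
  apply: (le_trans (ler_enorm_norm _)); rewrite normr0 mulr0.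
  by apply: mulr_ge0 => //; exact: sqr_ge0.
have eE : enorm (F (X j.+1)) <= enorm (rho j) + M * (`|X j - Xs| + enorm (dx j)) * enorm (dx j).
  have FE : F (X j.+1) = rho j + (F (pd_update S (X j) (dx j)) - F (X j) - J (X j) *m dx j).
    have aux (a b c : 'cV[R]_(n * m + pd_dim n1 n2)) : a = c + (a - b - (- b + c)).
      by apply/matrixP => i' j'; rewrite !mxE; ring.
    by rewrite XS1 Jdx -aux.
  by rewrite FE; apply: (le_trans (ler_enormD _ _)); rewrite lerD2l.
apply: (le_trans eE); rewrite [leRHS]mulrDl; apply: lerD => //.
have -> : M * (3 / k) * (2 / k) * E ^+ 2 = M * (E / k + 2 / k * E) * (2 / k * E).
  by field; rewrite gt_eqF.
apply: ler_pM => //; first by apply: mulr_ge0 => //; apply: addr_ge0 => //; exact: enorm_ge0.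
  exact: enorm_ge0.
by apply: ler_wpM2l => //; exact: lerD.
Unshelve. all: by end_near. Qed.
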